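(* Let $\Omega\subset\mathbb{R}^d$ be an open set of finite measure, and let $\lambda_1(\Omega)<\lambda_2(\Omega)\le\dots$ be the eigenvalues (counted with multiplicity) of the operator $\mathcal H=\frac12\log(-\Delta)$ in $\Omega$ with Dirichlet condition $\varphi=0$ on $\mathbb{R}^d\setminus\Omega$. Then $$\liminf_{\lambda\to\infty}e^{-d\lambda}\sum_k(\lambda-\lambda_k(\Omega))_+\ge\frac{1}{(2\pi)^d}\,|\Omega|\,|B_d|\,d^{-1}.$$
   Context: Here $d\ge1$ is an integer, $\Omega$ is nonempty, $|\cdot|$ of a set is Lebesgue measure, $B_d$ is the unit ball in $\mathbb{R}^d$, and $(t)_+=\max\{t,0\}$. The Fourier transform is $\widehat\varphi(\xi)=\int_{\mathbb{R}^d}e^{-ix\cdot\xi}\varphi(x)\,dx$, and $L^2(\Omega)$ is identified with the functions in $L^2(\mathbb{R}^d)$ vanishing on $\mathbb{R}^d\setminus\Omega$. Let $\mathbb{H}(\Omega)\subset L^2(\Omega)$ be the closure (completion) of $C_c^\infty(\Omega)$ with respect to the norm $\|\varphi\|_*$ given by $\|\varphi\|_*^2=\int_{\mathbb{R}^d}\log(e+|\xi|)\,|\widehat\varphi(\xi)|^2\,d\xi$. The quadratic form $$(\varphi,\varphi)_{\log}=\frac{1}{(2\pi)^d}\int_{\mathbb{R}^d}\log(|\xi|)\,|\widehat\varphi(\xi)|^2\,d\xi$$ (with associated sesquilinear form $(\varphi,\psi)_{\log}=\frac{1}{(2\pi)^d}\int_{\mathbb{R}^d}\log(|\xi|)\,\widehat\varphi(\xi)\overline{\widehat\psi(\xi)}\,d\xi$)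 with domain $\mathbb{H}(\Omega)$ is closed, symmetric and semibounded in $L^2(\Omega)$; $\mathcal H$ is the associated self-adjoint operator in $L^2(\Omega)$. Eigenvalues are understood weakly: $\varphi\in\mathbb{H}(\Omega)\setminus\{0\}$ is an eigenfunction with eigenvalue $\lambda$ if $(\varphi,\psi)_{\log}=\lambda\int_\Omega\varphi\overline{\psi}\,dx$ for all $\psi\in\mathbb{H}(\Omega)$. The spectrum is discrete: there is a sequence of eigenvalues $\lambda_1(\Omega)<\lambda_2(\Omega)\le\dots$, $\lambda_k(\Omega)\to\infty$, with a corresponding complete orthonormal system of eigenfunctions in $L^2(\Omega)$. *)

(* Defs.v *)
From HB Require Import structures.
From mathcomp Require Import all_boot all_order all_algebra.
From mathcomp Require Import complex.
From mathcomp Require Import all_classical all_reals all_analysis.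

Set Implicit Arguments.
Unset Strict Implicit.
Unset Printing Implicit Defensive.

Import Order.TTheory GRing.Theory Num.Theory.
Import numFieldNormedType.Exports.

Local Open Scope classical_set_scope.
Local Open Scope ring_scope.
Local Open Scope complex_scope.

Section measurable_rV.
Context {R : realType} {n : nat}.

Definition rV_coord (i : 'I_n) (x : 'rV[R]_n) : measurableTypeR R := x 0 i.

Let rV_set0 : g_sigma_preimage rV_coord set0.
Proof. exact: sigma_algebra0. Qed.

Let rV_setC A : g_sigma_preimage rV_coord A -> g_sigma_preimage rV_coord (~` A).
Proof. exact: sigma_algebraC. Qed.

Let rV_bigcup (F : (set 'rV[R]_n)^nat) :
  (forall i, g_sigma_preimage rV_coord (F i)) ->
  g_sigma_preimage rV_coord (\bigcup_i (F i)).
Proof. exact: sigma_algebra_bigcup. Qed.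

(* The product sigma-algebra, i.e. the Borel sets of R^n. *)
HB.instance Definition _ := @isMeasurable.Build default_measure_display
  'rV[R]_n (g_sigma_preimage rV_coord) rV_set0 rV_setC rV_bigcup.

End measurable_rV.

Section lebesgue_rV.
Context {R : realType}.

Lemma measurable_rV_coord n (i : 'I_n) : measurable_fun setT (@rV_coord R n i).
Proof.
move=> _ Y mY; rewrite setTI; apply: sub_sigma_algebra.
rewrite -bigcup_seq/=; exists i => /=; first by rewrite mem_index_enum.
by exists Y => //; rewrite setTI.
Qed.

Lemma measurable_fun_rVP d (T : measurableType d) n (f : T -> 'rV[R]_n) :
  (forall i, measurable_fun setT (rV_coord i \o f)) -> measurable_fun setT f.
Proof.
move=> mf.
suff H : g_sigma_preimage (@rV_coord R n) `<=` [set A | measurable (f @^-1` A)].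
  by move=> _ A /H; rewrite setTI.
apply: smallest_sub.
  split=> /=; first by rewrite preimage_set0.
  - by move=> A mA; rewrite setTD preimage_setC; exact: measurableC.
  - by move=> F mF; rewrite preimage_bigcup; exact: bigcup_measurable.
case: n f mf => [|n] f mf; first by rewrite big_ord0.
rewrite -bigcup_mkord_ord; apply: bigcup_sub => i _ A [B mB <-] /=.
have := mf (inord i) measurableT B mB.
by rewrite !setTI.
Qed.

Definition rV_cons n (p : measurableTypeR R * 'rV[R]_n) : 'rV[R]_n.+1 :=
  row_mx (const_mx p.1 : 'rV_1) p.2.

Definition rV_uncons n (x : 'rV[R]_n.+1) : measurableTypeR R * 'rV[R]_n :=
  (x 0 0, rsubmx (x : 'rV_(1 + n))).

Lemma rV_consK n : cancel (@rV_cons n) (@rV_uncons n).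
Proof.
move=> [x v]; rewrite /rV_uncons /rV_cons row_mxKr; congr pair.
transitivity (row_mx (const_mx x : 'rV[R]_1) v 0 (@lshift 1 n 0)).
  by congr (row_mx _ _ _ _); exact/val_inj.
by rewrite row_mxEl mxE.
Qed.

Lemma measurable_rV_cons n : measurable_fun setT (@rV_cons n).
Proof.
apply: measurable_fun_rVP => i.
rewrite -(@splitK 1 n i); case: (fintype.split _) => j /=.
- rewrite (_ : _ \o _ = fst)//.
  by apply/funext => p; exact: etrans (row_mxEl _ _ _ _) (mxE _ _ _ _).
- rewrite (_ : _ \o _ = rV_coord j \o snd).
    by apply: measurableT_comp => //; exact: measurable_rV_coord.
  by apply/funext => p; exact: row_mxEr.
Qed.

Lemma measurable_rV_uncons n : measurable_fun setT (@rV_uncons n).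
Proof.
apply/measurable_fun_pairP; split; first exact: (measurable_rV_coord ord0).
apply: measurable_fun_rVP => i.
rewrite (_ : _ \o _ = rV_coord (@rshift 1 n i)); first exact: measurable_rV_coord.
by apply/funext => x; rewrite /= /rV_coord mxE.
Qed.

Section step.
Variables (n : nat) (m : {sigma_finite_measure set 'rV[R]_n -> \bar R}).

Definition rV_step : set 'rV[R]_n.+1 -> \bar R :=
  pushforward (@lebesgue_measure R \x m)%E (@rV_cons n).

Let rV_step0 : rV_step set0 = 0%E.
Proof. by rewrite /rV_step /pushforward preimage_set0 measure0. Qed.

Let rV_step_ge0 A : (0 <= rV_step A)%E.
Proof. by apply: integral_ge0 => // x _; exact: measure_ge0. Qed.

Let rV_step_sigma_additive : semi_sigma_additive rV_step.
Proof.
move=> F mF tF mUF; rewrite /rV_step /pushforward preimage_bigcup.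
have mc A : measurable A -> measurable (@rV_cons n @^-1` A).
  by move=> mA; rewrite -[X in measurable X]setTI; exact: measurable_rV_cons.
apply: measure_semi_sigma_additive => //.
- by move=> k; exact: mc.
- apply/trivIsetP => i j _ _ ij; rewrite -preimage_setI.
  by move/trivIsetP : tF => /(_ _ _ _ _ ij) ->//; rewrite preimage_set0.
- by rewrite -preimage_bigcup; exact: mc.
Qed.

HB.instance Definition _ := isMeasure.Build _ _ _ rV_step
  rV_step0 rV_step_ge0 rV_step_sigma_additive.

Let rV_step_sigma_finite : sigma_finite setT rV_step.
Proof.
have /sigma_finiteP[F [TF ndF Foo]] := sigma_finiteT (@lebesgue_measure R).
have /sigma_finiteP[G [TG ndG Goo]] := sigma_finiteT m.
exists (fun k => @rV_uncons n @^-1` (F k `*` G k)).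
  rewrite -preimage_bigcup (_ : \bigcup_k (F k `*` G k) = setT) ?preimage_setT//.
  apply/seteqP; split => // -[x v] _.
  have [i _ Fx] : (\bigcup_k F k) x by rewrite -TF.
  have [j _ Gv] : (\bigcup_k G k) v by rewrite -TG.
  exists (maxn i j) => //; split.
    by move: x Fx; exact/subsetPset/ndF/leq_maxl.
  by move: v Gv; exact/subsetPset/ndG/leq_maxr.
move=> k; have [mF Fk] := Foo k; have [mG Gk] := Goo k; split.
  rewrite -[X in measurable X]setTI; apply: measurable_rV_uncons => //.
  exact: measurableX.
rewrite /rV_step /pushforward -comp_preimage (_ : _ \o _ = id); last first.
  by apply/funext => p /=; rewrite rV_consK.
by rewrite preimage_id product_measure1E// lte_mul_pinfty// ge0_fin_numE.
Qed.

HB.instance Definition _ := Measure_isSigmaFinite.Build _ _ _ rV_step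
  rV_step_sigma_finite.

End step.

Fixpoint lebesgue_rV n : {sigma_finite_measure set 'rV[R]_n -> \bar R} :=
  match n with
  | 0 => \d_(0 : 'rV[R]_0)
  | k.+1 => rV_step (lebesgue_rV k)
  end.

End lebesgue_rV.

Section log_laplacian.
Context {R : realType} {d : nat}.
Local Notation E := 'rV[R]_d.
Local Notation mu := (@lebesgue_rV R d).
Implicit Types (Omega : set E) (f phi psi : E -> R[i]) (x xi : E).

Definition dotp x xi : R := \sum_(i < d) x 0 i * xi 0 i.

(* `|x| on matrices is the sup norm, hence the explicit Euclidean norm. *)
Definition enorm x : R := Num.sqrt (dotp x x).

Definition unit_ball : set E := [set x | enorm x < 1].

Definition Cintegral (D : set E) f : R[i] :=
  (\int[mu]_(x in D) complex.Re (f x)) +i* (\int[mu]_(x in D) complex.Im (f x)).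

Definition expi (t : R) : R[i] := cos t +i* sin t.

(* The integral converges absolutely on L2 Omega if Omega has finite measure. *)
Definition fourier phi xi : R[i] :=
  Cintegral setT (fun x => expi (- dotp x xi) * phi x).

Definition Cmeasurable phi : Prop :=
  measurable_fun setT (fun x => complex.Re (phi x)) /\
  measurable_fun setT (fun x => complex.Im (phi x)).

Definition sqnorm (D : set E) phi : \bar R :=
  (\int[mu]_(x in D) ((Normc.normc (phi x)) ^+ 2)%:E)%E.

(* Genuine functions stand for their classes modulo equality a.e. *)
Definition L2 Omega phi : Prop :=
  [/\ Cmeasurable phi, (forall x, ~ Omega x -> phi x = 0) &
      (sqnorm setT phi < +oo)%E].

Definition l2dot Omega phi psi : R[i] :=
  Cintegral Omega (fun x => phi x * (psi x)^*).

Definition partials (f : E -> R) (s : seq 'I_d) : E -> R :=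
  foldr (fun i g => 'D_(delta_mx 0 i) g) f s.

Definition smooth (f : E -> R) : Prop := forall s : seq 'I_d,
  continuous (partials f s) /\
  forall i x, derivable (partials f s) x (delta_mx 0 i).

Definition support phi : set E := closure [set x | phi x != 0].

Definition Cc_infty Omega phi : Prop :=
  [/\ smooth (fun x => complex.Re (phi x)), smooth (fun x => complex.Im (phi x)),
      compact (support phi) & support phi `<=` Omega].

Definition sqnorm_star phi : \bar R :=
  (\int[mu]_xi (ln (expR 1 + enorm xi) * Normc.normc (fourier phi xi) ^+ 2)%:E)%E.

(* Since the squared *-norm dominates (2 pi)^d times the squared L2 norm, the
   completion of Cc_infty Omega is realized inside L2 Omega. *)
Definition Hspace Omega phi : Prop :=
  L2 Omega phi /\ exists2 u : nat -> E -> R[i], (forall n, Cc_infty Omega (u n)) &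
    sqnorm_star (fun x => u n x - phi x) @[n --> \oo] --> 0%E.

(* In mathcomp-analysis ln 0 = 0; only the null set {0} is concerned. *)
Definition log_form phi psi : R[i] :=
  ((2 * pi) ^- d)%:C *
  Cintegral setT (fun xi => (ln (enorm xi))%:C * (fourier phi xi * (fourier psi xi)^*)).

Definition eigenfunction Omega (l : R) phi : Prop :=
  [/\ Hspace Omega phi, ~ {ae mu, forall x, phi x = 0} &
      forall psi, Hspace Omega psi -> log_form phi psi = l%:C * l2dot Omega phi psi].

Definition orthonormal_system Omega (phi : nat -> E -> R[i]) : Prop :=
  forall j k, l2dot Omega (phi j) (phi k) = (j == k)%:R.

Definition complete_system Omega (phi : nat -> E -> R[i]) : Prop :=
  forall f, L2 Omega f ->
    sqnorm Omega (fun x => f x - \sum_(k < n) l2dot Omega f (phi k) * phi k x)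
      @[n --> \oo] --> 0%E.

(* Completeness of the orthonormal eigenfunctions forces every eigenvalue to be
   listed exactly as often as its multiplicity; indices start at 0. *)
Definition eigenvalue_sequence Omega (lam : nat -> R) : Prop :=
  [/\ lam 0%N < lam 1%N, (forall k, lam k <= lam k.+1),
      lam k @[k --> \oo] --> +oo &
      exists phi : nat -> E -> R[i],
        [/\ forall k, eigenfunction Omega (lam k) (phi k),
            orthonormal_system Omega phi & complete_system Omega phi]].

Definition riesz_mean (lam : nat -> R) (l : R) : \bar R :=
  (\sum_(0 <= k <oo) (Num.max (l - lam k) 0)%:E)%E.

End log_laplacian.

Arguments unit_ball : clear implicits.

(* Main.v *)
Require Import Defs.
From HB Require Import structures.
From mathcomp Require Import all_boot all_order all_algebra.
From mathcomp Require Import complex.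
From mathcomp Require Import all_classical all_reals all_analysis.
From mathcomp Require Import measurable_realfun.
From mathcomp Require Import ring lra.

Set Implicit Arguments.
Unset Strict Implicit.
Unset Printing Implicit Defensive.

Import Order.TTheory GRing.Theory Num.Theory.
Import numFieldNormedType.Exports.

Local Open Scope classical_set_scope.
Local Open Scope ring_scope.

(* Plane waves cut off inside Omega are trial functions. For a smooth cutoff
   0 <= chi <= 1 supported in Omega and psi_xi = e^{i x.xi} chi, expanding in the
   eigenfunctions phi_k gives
     l |psi_xi|^2 - (psi_xi, psi_xi)_log <= sum_k (l - lam_k)_+ |<psi_xi, phi_k>|^2.
   As a function of xi, <psi_xi, phi_k> is up to conjugation the Fourier transform
   of chi phi_k, so that by Bessel's inequality the right-hand side integrates to
   at most (2 pi)^d sum_k (l - lam_k)_+. On the left,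
   ln |eta| <= ln |xi| + |eta - xi| / |xi| yields
   (psi_xi, psi_xi)_log <= |chi|^2 ln |xi| + C / |xi| for |xi| >= 1. Integrating
   over the ball |xi| < e^l, where the integral of (l - ln |xi|) equals
   e^{d l} |B_d| / d, the part |xi| < A contributing only O(l), and letting
   l -> oo, then A -> oo and finally chi -> 1_Omega gives the bound. *)

(** * Lebesgue measure on row vectors *)

(** The aim is a lower bound, so every analytic input is a one-sided estimate. The Fourier transform
    enters through [bessel], which bounds its squared L^2 norm by (2 pi)^n |u|^2. The proof puts the
    weight exp(- e (|xi_1| + ... + |xi_n|)) on the frequency side, whose transform is a product of
    Poisson kernels, and lets e -> 0 by Fatou. The obstacle in the eigenfunction expansion is that
    L^2 convergence of the partial sums does not control the logarithmic form. Remainders get around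
    it: removing the first N modes lowers l |f|^2 - (f, f)_log by exactly the first N terms of the
    sum, and what is left is at most a constant times the squared norm of the remainder, because the
    form is bounded below. That lower bound rests on two facts: |hat u|^2 <= |Omega| |u|^2 pointwise
    for u vanishing off Omega, and ln |xi| has an integrable negative part. The restriction |xi| >=
    1 makes ln |xi| nonnegative, so that [bessel] may be multiplied by it. *)

Section affine.
Context {R : realType}.
Local Open Scope ereal_scope.
Notation leb := (@lebesgue_measure R).

Lemma measurable_affine (r a : R) :
  measurable_fun setT (fun t : measurableTypeR R => (r * t + a)%R : measurableTypeR R).
Proof. by apply: measurable_funD => //; exact: measurable_funM. Qed.

(** Uniqueness of Lebesgue measure: [r] times its image under the inverse affine map gives every
    interval []x, y]] its length. *)
Lemma lebesgue_measure_affine (r a : R) (A : set R) : (0 < r)%R ->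
  measurable A ->
  leb A = r%:E * leb ((fun t : R => r * t + a)%R @^-1` A).
Proof.
move=> r0 mA.
pose rn := NngNum (ltW r0).
pose phi : measurableTypeR R -> measurableTypeR R := fun t => (r * t + a)%R.
have mphi : measurable_fun setT phi by exact: measurable_affine.
pose H := isMeasurableFun.Build _ _ _ _ phi mphi.
pose phi' : {mfun _ >-> _} := HB.pack phi H.
rewrite (@lebesgue_measure_unique _ (mscale rn (pushforward leb phi')))//.
move=> _ [[x y]] _ <-.
transitivity (r%:E * leb (phi @^-1` `]x, y]%classic)); last by [].
have -> : phi @^-1` `]x, y]%classic = `](r^-1 * (x - a))%R, (r^-1 * (y - a))%R]%classic.
  apply/seteqP; split=> t; rewrite /phi/= !in_itv/=.
    by rewrite ltr_pdivrMl// ler_pdivlMl// ltrBlDr lerBrDr.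
  by rewrite ltr_pdivrMl// ler_pdivlMl// ltrBlDr lerBrDr.
rewrite !lebesgue_measure_itv/= !lte_fin.
rewrite ltr_pM2l ?invr_gt0// ltrD2r; case: ifPn => _; last by rewrite mule0.
rewrite -!EFinB -EFinM; congr EFin.
by rewrite -mulrBr mulrA mulfV ?gt_eqF// mul1r; ring.
Qed.

Lemma integral_affine (r a : R) (f : R -> \bar R) : (0 < r)%R ->
  measurable_fun setT f -> (forall x, 0 <= f x) ->
  \int[leb]_t f t = r%:E * \int[leb]_t f (r * t + a)%R.
Proof.
move=> r0 mf f0.
pose rn := NngNum (ltW r0).
pose phi : measurableTypeR R -> measurableTypeR R := fun t => (r * t + a)%R.
have mphi : measurable_fun setT phi by exact: measurable_affine.
pose H := isMeasurableFun.Build _ _ _ _ phi mphi.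
pose phi' : {mfun _ >-> _} := HB.pack phi H.
rewrite (@eq_measure_integral _ _ _ _ (mscale rn (pushforward leb phi'))); last first.
  by move=> A mA _; exact: lebesgue_measure_affine.
rewrite ge0_integral_mscale//.
by rewrite ge0_integral_pushforward//.
Qed.

End affine.

Section rV_measure.
Context {R : realType}.
Local Notation leb := (@lebesgue_measure R).

Lemma rV_cons0 n (t : R) (v : 'rV[R]_n) : rV_cons (t, v) 0 ord0 = t.
Proof. by have /(congr1 fst) := rV_consK (t, v). Qed.

Lemma rV_consS n (t : R) (v : 'rV[R]_n) i : rV_cons (t, v) 0 (lift ord0 i) = v 0 i.
Proof.
rewrite /rV_cons/= -rshift1.
exact: row_mxEr.
Qed.

Lemma rV_ext n (x y : 'rV[R]_n) : (forall i, x 0 i = y 0 i) -> x = y.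
Proof. by move=> xy; apply/rowP. Qed.

Lemma rV_cons_affine n (r : R) a (b : 'rV[R]_n) t v :
  rV_cons (r * t + a, r *: v + b) = r *: rV_cons (t, v) + rV_cons (a, b).
Proof.
apply: rV_ext => i; rewrite [RHS]mxE [X in _ = X + _]mxE.
have [j ->|->] := unliftP ord0 i; first by rewrite !rV_consS !mxE.
by rewrite !rV_cons0.
Qed.

Lemma measurable_rV_scale n (r : R) (b : 'rV[R]_n) :
  measurable_fun setT (fun x : 'rV[R]_n => r *: x + b).
Proof.
apply: measurable_fun_rVP => i.
rewrite (_ : _ \o _ = fun x => r * rV_coord i x + b 0 i); last first.
  by apply/funext => x; rewrite /rV_coord/= !mxE.
apply: measurable_funD => //; apply: measurable_funM => //.
exact: measurable_rV_coord.
Qed.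

Local Open Scope ereal_scope.

Lemma integral_rV_cons n (f : 'rV[R]_n.+1 -> \bar R) :
  measurable_fun setT f -> (forall x, 0 <= f x) ->
  \int[lebesgue_rV n.+1]_x f x =
  \int[leb]_t \int[lebesgue_rV n]_v f (rV_cons (t, v)).
Proof.
move=> mf f0.
transitivity (\int[pushforward (leb \x lebesgue_rV n)%E (@rV_cons R n)]_x f x).
  by [].
rewrite ge0_integral_pushforward//; last exact: measurable_rV_cons.
rewrite preimage_setT (fubini_tonelli1 (f \o @rV_cons R n))//.
  by apply: measurableT_comp => //; exact: measurable_rV_cons.
by move=> p; exact: f0.
Qed.

(** Induction on the dimension: [lebesgue_rV] is an iterated product, and scaling and translation
    act coordinatewise, so the first coordinate contributes one factor [r] and the tail the
    remaining [r ^+ n]. *)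
Lemma integral_rV_affine n (r : R) (b : 'rV[R]_n) (f : 'rV[R]_n -> \bar R) :
  (0 < r)%R -> measurable_fun setT f -> (forall x, 0 <= f x) ->
  \int[lebesgue_rV n]_x f x = (r ^+ n)%:E * \int[lebesgue_rV n]_x f (r *: x + b)%R.
Proof.
move=> r0; elim: n b f => [|n ih] b f mf f0.
  rewrite expr0 mul1e; apply: eq_integral => x _; congr f.
  by apply: rV_ext => -[].
have mf' : measurable_fun setT (fun x : 'rV[R]_n.+1 => f (r *: x + b)%R).
  apply: (measurableT_comp mf); exact: measurable_rV_scale.
have mg : measurable_fun setT (fun p : measurableTypeR R * 'rV[R]_n => f (rV_cons p)).
  by apply: measurableT_comp => //; exact: measurable_rV_cons.
rewrite !integral_rV_cons//.
pose F t := \int[lebesgue_rV n]_v f (rV_cons (t, v)).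
have mF : measurable_fun setT F.
  exact: (measurable_fun_fubini_tonelli_F (fun p => f (rV_cons p))).
have F0 t : 0 <= F t by exact: integral_ge0.
rewrite -[LHS]/(\int[leb]_t F t) (integral_affine (b 0%R ord0) r0 mF F0).
rewrite exprS EFinM -muleA; congr (_ * _).
rewrite -ge0_integralZl//; last 3 first.
- pose g p := f (r *: rV_cons p + b)%R.
  apply: (measurable_fun_fubini_tonelli_F g); last by move=> p; exact: f0.
  by apply: (measurableT_comp mf'); exact: measurable_rV_cons.
- by move=> t _; exact: integral_ge0.
- by rewrite lee_fin exprn_ge0// ltW.
apply: eq_integral => t _.
pose b' : 'rV[R]_n := (\row_i b 0 (lift ord0 i))%R.
rewrite /F (ih b' (fun v => f (rV_cons (r * t + b 0 ord0, v)%R)))//; last first.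
  exact: (measurable_fun_pair2 (r * t + b 0 ord0)%R mg).
congr (_ * _); apply: eq_integral => v _; congr f.
rewrite rV_cons_affine; congr (_ + _)%R.
apply: rV_ext => i; have [j ->|->] := unliftP ord0 i.
  by rewrite rV_consS mxE.
by rewrite rV_cons0.
Qed.

Lemma integral_rV_shift n (b : 'rV[R]_n) (f : 'rV[R]_n -> \bar R) :
  measurable_fun setT f -> (forall x, 0 <= f x) ->
  \int[lebesgue_rV n]_x f (x + b)%R = \int[lebesgue_rV n]_x f x.
Proof.
move=> mf f0; rewrite [RHS](@integral_rV_affine n 1 b)// expr1n mul1e.
by apply: eq_integral => x _; rewrite scale1r.
Qed.

End rV_measure.

(** * Measurability of open sets and of continuous functions *)

Section rV_open.
Context {R : realType}.

Definition cube n (c : 'rV[R]_n) (r : R) : set 'rV[R]_n :=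
  [set x | forall i, `|x 0 i - c 0 i| < r].

Definition ccube n (c : 'rV[R]_n) (r : R) : set 'rV[R]_n :=
  [set x | forall i, `|x 0 i - c 0 i| <= r].

Lemma measurable_rV_forall n (P : 'I_n -> set (measurableTypeR R)) :
  (forall i, measurable (P i)) -> measurable [set x : 'rV[R]_n | forall i, P i (x 0 i)].
Proof.
move=> mP; rewrite (_ : mkset _ = \big[setI/setT]_(i < n) (rV_coord i @^-1` P i)).
  apply: bigsetI_measurable => i _; rewrite -[X in measurable X]setTI.
  exact: measurable_rV_coord.
rewrite -bigcap_seq.
apply/seteqP; split=> [x Px i _ |x Px i]; first exact: Px.
by apply: Px => /=; rewrite mem_index_enum.
Qed.
End rV_open.
Section rV_open2.
Context {R : realType}.
Variable n : nat.
Implicit Types U : set 'rV[R]_n.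

Lemma measurable_cube (c : 'rV[R]_n) r : measurable (cube c r).
Proof.
apply: (@measurable_rV_forall _ _ (fun i => [set t | `|t - c 0 i| < r])) => i.
rewrite (_ : mkset _ = ball (c 0 i) r); first exact: measurable_ball.
by apply/seteqP; split=> t; rewrite /ball/= distrC.
Qed.

Lemma open_ccube U x : open U -> U x -> exists2 r, 0 < r & ccube x r `<=` U.
Proof.
move=> oU Ux; have /nbhs_ballP[e /= e0 eU] : nbhs x U by exact: open_nbhs_nbhs.
exists (e / 2); first by rewrite divr_gt0.
move=> y xy; apply: eU; split => // i j; rewrite (ord1 i) /ball/= distrC.
by rewrite (le_lt_trans (xy j))// gtr_pMr// invf_lt1// ltr1n.
Qed.

Definition rat_cube_center (q : 'rV[rat]_n * nat) : 'rV[R]_n := map_mx ratr q.1.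
Definition rat_cube_radius (q : 'rV[rat]_n * nat) : R := q.2.+1%:R^-1.

(** The measurable sets are generated by the coordinates and not by the topology, so open sets are
    reached through countably many cubes. The open cube contains [x] while the closed one stays in
    [U]; being compact, the latter also carries the supports of the bumps used for the cutoffs. *)
Lemma rat_cube_basis U x : open U -> U x -> exists q,
  cube (rat_cube_center q) (rat_cube_radius q) x /\
  ccube (rat_cube_center q) (rat_cube_radius q) `<=` U.
Proof.
move=> oU /(open_ccube oU)[r r0 rU].
(* Both [x] and [y] are within one radius of the rational center, hence the factor 2. *)
have [k kr] : exists k : nat, k.+1%:R^-1 < r / 2.
  have r20 : 0 < r / 2 by rewrite divr_gt0.
  have [N _ /(_ N (leqnn N))] := near_infty_natSinv_lt (PosNum r20).
  by exists N.
have ex i : exists q : rat, `|x 0 i - ratr q| < k.+1%:R^-1.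
  have /rat_in_itvoo[q] : x 0 i - k.+1%:R^-1 < x 0 i + k.+1%:R^-1.
    by rewrite ltrD2l gtrN// invr_gt0.
  rewrite in_itv/= => /andP[q1 q2]; exists q.
  by rewrite ltr_distlC q1.
have [q qP] := choice ex.
exists (\row_i q i, k); split=> [i|y yU].
  by rewrite /rat_cube_center/= !mxE.
apply: rU => i.
have := yU i; have := qP i; rewrite /rat_cube_center/= !mxE /rat_cube_radius/=.
move=> h1 h2; rewrite distrC (le_trans (ler_distD (ratr (q i)) _ _))//.
rewrite distrC in h2.
by move: (k.+1%:R^-1 : R) kr h1 h2 => s kr h1 h2; lra.
Qed.

Lemma measurable_rV_open U : open U -> measurable U.
Proof.
move=> oU.
pose P q := ccube (rat_cube_center q) (rat_cube_radius q) `<=` U.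
rewrite (_ : U = \bigcup_(q in (P : set _)) cube (rat_cube_center q) (rat_cube_radius q)).
  rewrite bigcup_mkcond.
  pose F k := if unpickle k is Some q then
    (if q \in (P : set _) then cube (rat_cube_center q) (rat_cube_radius q) else set0) else set0.
  rewrite (_ : bigcup _ _ = \bigcup_k F k).
    apply: bigcupT_measurable => k; rewrite /F; case: unpickle => // q.
    by case: ifPn => // _; exact: measurable_cube.
  apply/seteqP; split=> [x [q _ xq]|x [k _]].
    by exists (pickle q) => //; rewrite /F pickleK.
  by rewrite /F; case: unpickle => // q xq; exists q.
apply/seteqP; split=> [x /(rat_cube_basis oU)[q [xq qU]]|x [q qU xq]].
  by exists q.
by apply: qU => i; exact/ltW/xq.
Qed.

Lemma continuous_rV_measurable (f : 'rV[R]_n -> R) : continuous f ->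
  measurable_fun setT f.
Proof.
move=> /continuousP cf; apply: (measurability _ (RGenOpens.measurableE R)).
move=> _ [_ [a [b ->] <-]]; rewrite setTI; apply: measurable_rV_open.
exact/cf/interval_open.
Qed.

End rV_open2.

(** * The Poisson kernel *)

Section poisson1.
Context {R : realType}.
Notation leb := (@lebesgue_measure R).
Implicit Types e z t : R.

Definition expw e t : R := expR (- (e * `|t|)).

Lemma expw_ge0 e t : 0 <= expw e t. Proof. exact: expR_ge0. Qed.

(** The Fourier transform of [expw e], by [integral_expw_cos]. Its mass is 2 pi for every [e], which
    makes the bounds below uniform in [e]. *)
Definition poisson e z : R := 2 * e / (e ^+ 2 + z ^+ 2).

Lemma poisson_ge0 e z : 0 < e -> 0 <= poisson e z.
Proof.
by move=> e0; rewrite divr_ge0// ?mulr_ge0// ?addr_ge0// ?sqr_ge0// ltW.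
Qed.

Lemma poissonN e z : poisson e (- z) = poisson e z.
Proof. by rewrite /poisson sqrrN. Qed.

Lemma continuous_expw e : continuous (expw e).
Proof.
move=> t; apply: continuous_comp; last exact: continuous_expR.
by apply: cvgN; apply: cvgM; [exact: cvg_cst|exact: norm_continuous].
Qed.

Lemma cvg_expNy e : 0 < e -> expR (- (e * t)) @[t --> +oo] --> (0 : R).
Proof.
move=> e0; apply/cvgrPdist_lt => eps eps0.
near=> t; rewrite sub0r normrN ger0_norm ?expR_ge0//.
rewrite -[X in _ < X]lnK ?posrE// ltr_expR ltrNl mulrC -ltr_pdivrMr//.
by near: t; apply: nbhs_pinfty_gt; exact: num_real.
Unshelve. all: by end_near. Qed.

Local Open Scope ereal_scope.

(** The summand 1 keeps the integrand nonnegative, as the fundamental theorem of calculus on a half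
    line requires; it is subtracted again in [integral_expw_cos]. *)
Lemma integral0y_expcos e z : (0 < e)%R ->
  \int[leb]_(t in `[0%R, +oo[) (expR (- (e * t)) * (1 + cos (z * t)))%:E =
  (e^-1 + e / (e ^+ 2 + z ^+ 2))%:E.
Proof.
move=> e0.
have ez : (e ^+ 2 + z ^+ 2 != 0)%R.
  by rewrite gt_eqF// ltr_wpDr ?sqr_ge0// exprn_gt0.
pose q := ((e ^+ 2 + z ^+ 2)^-1)%R.
(* An explicit antiderivative that tends to 0 at infinity, so the integral is [- F 0]. *)
pose F t := (expR (- (e * t)) * (q * (z * sin (z * t) - e * cos (z * t)) - e^-1))%R.
have dF t : is_derive t (1 : R)%R F (expR (- (e * t)) * (1 + cos (z * t)))%R.
  rewrite /F.
  apply: is_derive_eq.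
  rewrite /GRing.scale/= /q; field; by rewrite ez gt_eqF.
rewrite (@ge0_continuous_FTC2y _ _ F _ 0).
- rewrite /F !mulr0 oppr0 expR0 sin0 cos0 -EFinB; congr EFin; rewrite /q.
  by field; rewrite ez gt_eqF.
- move=> t t0; rewrite mulr_ge0 ?expR_ge0// -lerBlDl sub0r cos_geN1.
- apply: continuous_subspaceT => t.
  apply: cvgM.
    apply: (@continuous_comp _ _ _ (fun t => - (e * t))%R expR); last exact: continuous_expR.
    by apply: cvgN; apply: cvgM; [exact: cvg_cst|exact: cvg_id].
  apply: cvgD; first exact: cvg_cst.
  apply: (@continuous_comp _ _ _ (fun t => z * t)%R (@cos R)); last exact: continuous_cos.
  by apply: cvgM; [exact: cvg_cst|exact: cvg_id].
- pose M := (`|q| * (`|z| + `|e|) + `|e^-1|)%R.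
  have M0 : (0 <= M)%R by rewrite addr_ge0// mulr_ge0// addr_ge0.
  have : (expR (- (e * t)) * M)%R @[t --> +oo%R] --> (0 * M)%R.
    by apply: cvgM; [exact: cvg_expNy|exact: cvg_cst].
  rewrite mul0r => h.
  apply/cvgr0Pnorm_le => eps eps0.
  move/cvgr0Pnorm_le : h => /(_ _ eps0); apply: filterS => t.
  apply: le_trans; rewrite /F !normrM ler_wpM2l//.
  rewrite (ger0_norm M0) (le_trans (ler_normB _ _))// lerD// normrM ler_wpM2l//.
  rewrite (le_trans (ler_normB _ _))// lerD// normrM ler_piMr//.
    by rewrite ler_norml sin_geN1 sin_le1.
  by rewrite ler_norml cos_geN1 cos_le1.
- by move=> t _; exact: ex_derive.
- apply: cvg_at_right_filter; apply: differentiable_continuous.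
  by apply/derivable1_diffP; exact: ex_derive.
- by move=> t _; rewrite derive1E; exact: derive_val.
Qed.

Lemma integral_expw_1cos e z : (0 < e)%R ->
  \int[leb]_t (expw e t * (1 + cos (z * t)))%:E = (2 / e + poisson e z)%:E.
Proof.
move=> e0; rewrite ge0_symfun_integralT.
- rewrite -set_itvcy.
  under eq_integral => t.
    rewrite inE/= in_itv/= andbT => t0.
    rewrite /expw ger0_norm//; over.
  by rewrite integral0y_expcos// -EFinM; congr EFin; rewrite /poisson; ring.
- move=> t; rewrite mulr_ge0 ?expw_ge0// -lerBlDl sub0r cos_geN1.
- move=> t; apply: cvgM; first exact: continuous_expw.
  apply: cvgD; first exact: cvg_cst.
  apply: continuous_comp; last exact: continuous_cos.
  by apply: cvgM; [exact: cvg_cst|exact: cvg_id].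
- by move=> t /=; rewrite /expw normrN mulrN cosN.
Qed.

Lemma integral_expw e : (0 < e)%R -> \int[leb]_t (expw e t)%:E = (2 / e)%:E.
Proof.
move=> e0; have := integral_expw_1cos 0 e0.
under eq_integral => t _ do rewrite mul0r cos0 mulrC EFinM.
rewrite ge0_integralZl//=; last 2 first.
- by apply/measurable_EFinP; apply: continuous_measurable_fun; exact: continuous_expw.
- by move=> t _; rewrite lee_fin expw_ge0.
rewrite -[(1 + 1)%R]/(2%:R) => /(congr1 (fun x => 2^-1%:E * x)).
rewrite muleA -EFinM mulVf// mul1e => ->; rewrite -EFinM; congr EFin.
by rewrite /poisson expr0n/= addr0; field; rewrite gt_eqF.
Qed.

Lemma measurable_expw e : measurable_fun setT (expw e).
Proof. by apply: continuous_measurable_fun; exact: continuous_expw. Qed.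

Lemma integrable_expw e : (0 < e)%R -> leb.-integrable setT (EFin \o expw e).
Proof.
move=> e0; apply/integrableP; split; first by apply/measurable_EFinP; exact: measurable_expw.
under eq_integral => t _ do rewrite /= ger0_norm ?expw_ge0//.
by rewrite integral_expw// ltry.
Qed.

Lemma integrable_expwM e (f : R -> R) : (0 < e)%R ->
  measurable_fun setT f -> (forall t, `|f t| <= 1)%R ->
  leb.-integrable setT (fun t => (expw e t * f t)%:E).
Proof.
move=> e0 mf f1; apply: le_integrable (integrable_expw e0) => //.
  apply/measurable_EFinP; apply: measurable_funM => //; exact: measurable_expw.
move=> t _; rewrite /= lee_fin normrM ler_piMr//.
Qed.

Lemma measurable_cosM z : measurable_fun setT (fun t : R => cos (z * t)).
Proof.
apply: continuous_measurable_fun => t.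
apply: continuous_comp; last exact: continuous_cos.
by apply: cvgM; [exact: cvg_cst|exact: cvg_id].
Qed.

Lemma measurable_sinM z : measurable_fun setT (fun t : R => sin (z * t)).
Proof.
apply: continuous_measurable_fun => t.
apply: continuous_comp; last exact: continuous_sin.
by apply: cvgM; [exact: cvg_cst|exact: cvg_id].
Qed.

Lemma normr_cos_le1 t : (`|cos t| <= 1)%R.
Proof. by rewrite ler_norml cos_geN1 cos_le1. Qed.

Lemma normr_sin_le1 t : (`|sin t| <= 1)%R.
Proof. by rewrite ler_norml sin_geN1 sin_le1. Qed.

Lemma integral_expw_cos e z : (0 < e)%R ->
  \int[leb]_t (expw e t * cos (z * t))%:E = (poisson e z)%:E.
Proof.
move=> e0; have := integral_expw_1cos z e0.
under eq_integral => t _ do rewrite mulrDr mulr1 EFinD.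
rewrite integralD//; last 2 first.
- exact: integrable_expw.
- apply: integrable_expwM => //; first exact: measurable_cosM.
  by move=> t; exact: normr_cos_le1.
rewrite integral_expw// EFinD => /(congr1 (fun x => x - (2 / e)%:E)).
by rewrite ![(2 / e)%:E + _]addeC !addeK.
Qed.

(** The integrand is odd. Reflection is applied to the nonnegative [expw e t * (1 + sin (z * t))],
    and comparing the two integrals gives I = - I. *)
Lemma integral_expw_sin e z : (0 < e)%R ->
  \int[leb]_t (expw e t * sin (z * t))%:E = 0.
Proof.
move=> e0.
have iS : leb.-integrable setT (fun t => (expw e t * sin (z * t))%:E).
  by apply: integrable_expwM => //; [exact: measurable_sinM|move=> t; exact: normr_sin_le1].
pose g t := (expw e t * (1 + sin (z * t)))%:E.
have mg : measurable_fun setT g.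
  apply/measurable_EFinP; apply: measurable_funM; first exact: measurable_expw.
  by apply: measurable_funD => //; exact: measurable_sinM.
have g0 t : 0 <= g t.
  by rewrite lee_fin mulr_ge0 ?expw_ge0//; have := sin_geN1 (z * t); lra.
have h : \int[leb]_t g t = \int[leb]_t g (- t)%R.
  rewrite -(@ge0_integral_pushforward _ _ _ _ R (-%R : measurableTypeR R -> measurableTypeR R) _ leb setT g)//.
  by apply: eq_measure_integral => A mA _; exact/esym/lebesgue_measureN.
have fin : \int[leb]_t (expw e t * sin (z * t))%:E \is a fin_num.
  exact: integrable_fin_num.
move: h; rewrite /g.
under eq_integral => t _ do rewrite mulrDr mulr1 EFinD.
rewrite integralD//; last exact: integrable_expw.
under [RHS]eq_integral => t _.
  rewrite mulrDr mulr1 mulrN sinN mulrN {1 2}/expw normrN -/(expw e t) EFinD EFinN; over.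
rewrite integralB//=; last exact: integrable_expw.
rewrite integral_expw// -(fineK fin) -EFinN -!EFinD => -[] h.
by congr EFin; move: h; lra.
Qed.

Lemma integral_poisson e : (0 < e)%R ->
  \int[leb]_z (poisson e z)%:E = (2 * pi)%:E.
Proof.
move=> e0; rewrite (@integral_affine _ e 0)//; last 2 first.
- apply/measurable_EFinP; apply: continuous_measurable_fun => z.
  apply: cvgM; first exact: cvg_cst.
  apply: cvgV; first by rewrite gt_eqF// ltr_wpDr ?sqr_ge0// exprn_gt0.
  by apply: cvgD; [exact: cvg_cst|exact: exprn_continuous].
- by move=> z; rewrite lee_fin poisson_ge0.
under eq_integral => z _.
  rewrite addr0 (_ : poisson _ _ = 2 / e * (oneDsqr z)^-1)%R; last first.
    rewrite /poisson /oneDsqr; field.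
    by rewrite !gt_eqF ?ltr_wpDr ?sqr_ge0 ?exprn_gt0.
  rewrite EFinM; over.
rewrite ge0_integralZl//; last 2 first.
- by apply/measurable_EFinP; apply: continuous_measurable_fun; exact: continuous_oneDsqrV.
- by rewrite lee_fin divr_ge0// ltW.
rewrite ge0_symfun_integralT//=; last 2 first.
- exact: continuous_oneDsqrV.
- by move=> z /=; rewrite /oneDsqr sqrrN.
rewrite -set_itvcy integral0y_oneDsqr -!EFinM; congr EFin.
by field; rewrite gt_eqF.
Qed.

End poisson1.

(** * Fatou's lemma and iterated integrals *)

Section integral_aux.
Context d (T : measurableType d) {R : realType} (mu : {measure set T -> \bar R}).
Local Open Scope ereal_scope.

(** Three limits are taken this way: removing the exponential weight in [bessel_real], turning
    difference quotients into the factor [xi 0 i] in [Cc_infty_coord], and replacing the cutoffs by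
    the indicator of Omega in [mass_le_of_cutoffs]. *)
Lemma fatou_le (f : (T -> \bar R)^nat) (g : T -> \bar R) (c : \bar R) :
  (forall n, measurable_fun setT (f n)) -> (forall n x, 0 <= f n x) ->
  (forall x, f n x @[n --> \oo] --> g x) ->
  (forall n, \int[mu]_x f n x <= c) -> \int[mu]_x g x <= c.
Proof.
move=> mf f0 fg fc.
have -> : \int[mu]_x g x = \int[mu]_x limn_einf (f^~ x).
  apply: eq_integral => x _; apply/esym.
  have cx : cvgn (f^~ x) by apply/cvg_ex; exists (g x); exact: fg.
  by rewrite (is_cvg_limn_einfE cx); exact/cvg_lim/fg.
apply: (le_trans (fatou _ _ _ _)) => //.
rewrite limn_einf_lim; apply: lime_le.
  exact: is_cvg_einfs.
apply: nearW => n; apply: le_trans (fc n).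
by apply: ereal_inf_lbound; exists n => /=.
Qed.

End integral_aux.

Section pair_aux.
Context d1 d2 (T1 : measurableType d1) (T2 : measurableType d2) {R : realType}.
Variables (m1 : {sigma_finite_measure set T1 -> \bar R})
          (m2 : {sigma_finite_measure set T2 -> \bar R}).

Lemma measurable_integral_pair (h : T1 * T2 -> R) : measurable_fun setT h ->
  measurable_fun setT (fun x => \int[m2]_y (h (x, y))%:E)%E.
Proof.
move=> mh.
rewrite (_ : (fun x => _) = (fun x => (\int[m2]_y (EFin \o h)^\+%E (x, y))) \- 
   (fun x => (\int[m2]_y (EFin \o h)^\-%E (x, y))))%E; last first.
  apply/funext => x; rewrite [LHS]integralE; congr (_ - _)%E; apply: eq_integral => y _.
    by rewrite (_ : (fun x0 => _) = (EFin \o h) \o pair x)// funepos_comp.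
  by rewrite (_ : (fun x0 => _) = (EFin \o h) \o pair x)// funeneg_comp.
have mh' : measurable_fun setT (EFin \o h) by exact/measurable_EFinP.
apply: emeasurable_funB.
- apply: (measurable_fun_fubini_tonelli_F ((EFin \o h)^\+)%E) => //.
  exact: measurable_funepos.
- apply: (measurable_fun_fubini_tonelli_F ((EFin \o h)^\-)%E) => //.
  exact: measurable_funeneg.
Qed.

Lemma measurable_Rintegral_pair (h : T1 * T2 -> R) : measurable_fun setT h ->
  measurable_fun setT (fun x => \int[m2]_y h (x, y)).
Proof.
move=> mh; rewrite /Rintegral.
apply: (@measurableT_comp _ _ _ _ _ _ (@fine R)); first exact: fine_measurable.
exact: measurable_integral_pair.
Qed.

Lemma integrable_pair_bound (h : T1 * T2 -> R) (u : T1 -> R) (v : T2 -> R) :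
  measurable_fun setT h -> (forall x y, `|h (x, y)| <= u x * v y) ->
  (forall x, 0 <= u x) -> (forall y, 0 <= v y) ->
  m1.-integrable setT (EFin \o u) -> m2.-integrable setT (EFin \o v) ->
  (m1 \x m2)%E.-integrable setT (EFin \o h).
Proof.
move=> mh huv u0 v0 iu iv; apply/integrable12ltyP; first exact/measurable_EFinP.
have mh' : measurable_fun setT (fun p => `|(h p)%:E|%E).
  by apply: measurableT_comp => //; exact/measurable_EFinP.
have mu := measurable_int _ iu; have mv := measurable_int _ iv.
apply: (@le_lt_trans _ _ (\int[m1]_x ((u x)%:E * \int[m2]_y (v y)%:E)))%E.
  apply: ge0_le_integral => //.
  - by move=> x _; exact: integral_ge0.
  - exact: (measurable_fun_fubini_tonelli_F (fun p => `|(h p)%:E|%E)).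
  - by apply: emeasurable_funM.
  - move=> x _; rewrite -ge0_integralZl//.
    + apply: ge0_le_integral => //.
      * exact: (measurable_fun_pair2 x mh').
      * exact: measurable_funeM.
      * by move=> y _; rewrite /= -EFinM lee_fin.
    + by move=> y _; rewrite lee_fin.
    + by rewrite lee_fin.
have fv : (\int[m2]_y (v y)%:E \is a fin_num)%E by exact: integrable_fin_num.
rewrite -(fineK fv); under eq_integral do rewrite muleC.
rewrite integralZl//.
by rewrite ltey_eq fin_numM// ?integrable_fin_num.
Qed.

(** Domination by a product suits the Fourier integrals below: the oscillating factors are bounded
    by 1, the weight is integrable in frequency and the function in space. *)
Lemma Fubini_bound (h : T1 -> T2 -> R) (u : T1 -> R) (v : T2 -> R) :
  measurable_fun setT (fun p => h p.1 p.2) ->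
  (forall x y, `|h x y| <= u x * v y) ->
  (forall x, 0 <= u x) -> (forall y, 0 <= v y) ->
  m1.-integrable setT (EFin \o u) -> m2.-integrable setT (EFin \o v) ->
  (\int[m1]_x \int[m2]_y (h x y)%:E = \int[m2]_y \int[m1]_x (h x y)%:E)%E.
Proof.
move=> mh huv u0 v0 iu iv.
apply: (Fubini (f := fun p => (h p.1 p.2)%:E)).
exact: (integrable_pair_bound mh huv).
Qed.

End pair_aux.

(** * Product densities and the Poisson kernel in n variables *)

Section rV_prod.
Context {R : realType}.
Local Notation leb := (@lebesgue_measure R).
Local Notation mu n := (lebesgue_rV (R := R) n).

(** For integrands that change sign, such as those of the cosine and sine transforms. *)
Lemma integral_rV_cons_integrable n (f : 'rV[R]_n.+1 -> \bar R) :
  (mu n.+1).-integrable setT f ->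
  (\int[mu n.+1]_x f x = \int[leb]_t \int[mu n]_v f (rV_cons (t, v)))%E.
Proof.
move=> fi; have mf := measurable_int _ fi.
pose L : {sigma_finite_measure set (measurableTypeR R) -> \bar R} := leb.
have mc := @measurable_rV_cons R n.
transitivity (\int[pushforward (L \x mu n)%E (@rV_cons R n)]_x f x)%E; first by [].
have ip : (L \x mu n)%E.-integrable setT (f \o @rV_cons R n).
  apply/integrableP; split; first exact: measurableT_comp.
  move/integrableP : fi => [_].
  rewrite (_ : (\int[mu n.+1]_x `|f x| = \int[pushforward (L \x mu n)%E (@rV_cons R n)]_x `|f x|)%E)//.
  rewrite ge0_integral_pushforward//; exact: measurableT_comp.
rewrite integral_pushforward//.
by rewrite preimage_setT -(integral12_prod_meas1 ip).
Qed.

Lemma prod_rV_cons n (f : R -> R) t (v : 'rV[R]_n) :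
  \prod_i f (rV_cons (t, v) 0 i) = f t * \prod_i f (v 0 i).
Proof.
rewrite big_ord_recl rV_cons0; congr (_ * _).
by apply: eq_bigr => i _; rewrite rV_consS.
Qed.

Lemma measurable_rV_prod n (f : R -> R) : measurable_fun setT f ->
  measurable_fun setT (fun x : 'rV[R]_n => \prod_i f (x 0 i)).
Proof.
move=> mf; apply: measurable_prod => i _.
apply: (@measurableT_comp _ _ _ _ _ _ f) => //; exact: measurable_rV_coord.
Qed.

Lemma integral_rV_prod n (f : R -> R) (c : R) : measurable_fun setT f ->
  (forall t, 0 <= f t) -> (\int[leb]_t (f t)%:E = c%:E)%E ->
  (\int[mu n]_x (\prod_i f (x 0 i))%:E = (c ^+ n)%:E)%E.
Proof.
move=> mf f0 fc; elim: n => [|n ih].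
  transitivity (\int[\d_(0%R : 'rV[R]_0)]_x (1%:E : \bar R))%E.
    by apply: eq_integral => x _; rewrite big_ord0.
  by rewrite integral_dirac// diracT mul1e.
have p0 m (x : 'rV[R]_m) : 0 <= \prod_i f (x 0 i) by rewrite prodr_ge0.
rewrite integral_rV_cons//; last 2 first.
- by apply/measurable_EFinP; exact: measurable_rV_prod.
- by move=> x; rewrite lee_fin.
under eq_integral => t _.
  under eq_integral => v _ do rewrite prod_rV_cons EFinM.
  rewrite ge0_integralZl//=; last 3 first.
  - by apply/measurable_EFinP; exact: measurable_rV_prod.
  - by move=> v _; rewrite lee_fin; exact: p0.
  - by rewrite lee_fin.
  rewrite ih muleC; over.
have c0 : 0 <= c by rewrite -lee_fin -fc; apply: integral_ge0 => t _; rewrite lee_fin.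
rewrite ge0_integralZl//=.
- by rewrite fc -EFinM exprSr.
- exact/measurable_EFinP.
- by move=> t _; rewrite lee_fin.
- by rewrite lee_fin exprn_ge0.
Qed.

Lemma integrable_rV_prod n (f : R -> R) (c : R) : measurable_fun setT f ->
  (forall t, 0 <= f t) -> (\int[leb]_t (f t)%:E = c%:E)%E ->
  (mu n).-integrable setT (fun x => (\prod_i f (x 0 i))%:E).
Proof.
move=> mf f0 fc; apply/integrableP; split.
  by apply/measurable_EFinP; exact: measurable_rV_prod.
under eq_integral => x _ do rewrite /= ger0_norm ?prodr_ge0//.
by rewrite (integral_rV_prod _ mf f0 fc) ltry.
Qed.

End rV_prod.

Section poisson_rV.
Context {R : realType}.
Local Notation leb := (@lebesgue_measure R).
Local Notation mu n := (lebesgue_rV (R := R) n).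

(** The exponential of the l^1 norm and not of the Euclidean one: it factors over the coordinates,
    and so does its transform. *)
Definition expw_rV n (e : R) (x : 'rV[R]_n) : R := \prod_i expw e (x 0 i).
Definition poisson_rV n (e : R) (x : 'rV[R]_n) : R := \prod_i poisson e (x 0 i).

Lemma expw_rV_ge0 n e (x : 'rV[R]_n) : 0 <= expw_rV e x.
Proof. by apply: prodr_ge0 => i _; exact: expw_ge0. Qed.

Lemma poisson_rV_ge0 n e (x : 'rV[R]_n) : 0 < e -> 0 <= poisson_rV e x.
Proof. by move=> e0; apply: prodr_ge0 => i _; exact: poisson_ge0. Qed.

Lemma measurable_expw_rV n e : measurable_fun setT (@expw_rV n e).
Proof. by apply: measurable_rV_prod; exact: measurable_expw. Qed.

Lemma measurable_poisson e : 0 < e -> measurable_fun setT (@poisson R e).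
Proof.
move=> e0; apply: continuous_measurable_fun => z.
apply: cvgM; first exact: cvg_cst.
apply: cvgV; first by rewrite gt_eqF// ltr_wpDr ?sqr_ge0// exprn_gt0.
by apply: cvgD; [exact: cvg_cst|exact: exprn_continuous].
Qed.

Lemma measurable_poisson_rV n e : 0 < e -> measurable_fun setT (@poisson_rV n e).
Proof. by move=> e0; apply: measurable_rV_prod; exact: measurable_poisson. Qed.

Lemma integrable_expw_rV n e : 0 < e -> (mu n).-integrable setT (EFin \o @expw_rV n e).
Proof.
move=> e0; apply: (integrable_rV_prod _ _ _ (integral_expw e0)).
  exact: measurable_expw.
exact: expw_ge0.
Qed.

Lemma integral_poisson_rV n e : 0 < e ->
  (\int[mu n]_x (poisson_rV e x)%:E = ((2 * pi) ^+ n)%:E)%E.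
Proof.
move=> e0; apply: (integral_rV_prod _ _ _ (integral_poisson e0)).
  exact: measurable_poisson.
by move=> t; exact: poisson_ge0.
Qed.

Lemma measurable_dotp_pair n :
  measurable_fun setT (fun p : 'rV[R]_n * 'rV[R]_n => dotp p.1 p.2).
Proof.
apply: measurable_sum => i; apply: measurable_funM.
- apply: (@measurableT_comp _ _ _ _ _ _ (rV_coord i)) => //; exact: measurable_rV_coord.
- apply: (@measurableT_comp _ _ _ _ _ _ (rV_coord i)) => //; exact: measurable_rV_coord.
Qed.

Lemma measurable_dotpr n (z : 'rV[R]_n) : measurable_fun setT (dotp z).
Proof. have h := @measurable_dotp_pair n.
exact: (measurable_fun_pair2 (f := fun p => dotp p.1 p.2) z h). Qed.

Lemma dotpC n (x y : 'rV[R]_n) : dotp x y = dotp y x.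
Proof. by apply: eq_bigr => i _; rewrite mulrC. Qed.

Lemma dotpDl n (x y z : 'rV[R]_n) : dotp (x + y) z = dotp x z + dotp y z.
Proof. by rewrite -big_split; apply: eq_bigr => i _; rewrite mxE mulrDl. Qed.

Lemma dotpNl n (x z : 'rV[R]_n) : dotp (- x) z = - dotp x z.
Proof. by rewrite -sumrN; apply: eq_bigr => i _; rewrite mxE mulNr. Qed.

Lemma dotpBl n (x y z : 'rV[R]_n) : dotp (x - y) z = dotp x z - dotp y z.
Proof. by rewrite dotpDl dotpNl. Qed.

Lemma measurable_cos : measurable_fun setT (@cos R).
Proof. by apply: continuous_measurable_fun; exact: continuous_cos. Qed.

Lemma measurable_sin : measurable_fun setT (@sin R).
Proof. by apply: continuous_measurable_fun; exact: continuous_sin. Qed.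

Lemma dotp_cons n (z : 'rV[R]_n.+1) t v :
  dotp z (rV_cons (t, v)) = z 0 ord0 * t + dotp (\row_i z 0 (lift ord0 i)) v.
Proof.
rewrite /dotp big_ord_recl rV_cons0; congr (_ + _).
by apply: eq_bigr => i _; rewrite rV_consS mxE.
Qed.

Lemma integrable_expw_rVM n e (f : 'rV[R]_n -> R) : 0 < e ->
  measurable_fun setT f -> (forall t, `|f t| <= 1) ->
  (mu n).-integrable setT (fun t => (expw_rV e t * f t)%:E).
Proof.
move=> e0 mf f1; apply: le_integrable (integrable_expw_rV n e0) => //.
  apply/measurable_EFinP; apply: measurable_funM => //; exact: measurable_expw_rV.
move=> t _; rewrite /= lee_fin normrM ler_piMr//.
Qed.

(** Cosine and sine are treated together because the addition formulas mix them when a coordinate is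
    split off; every term with a sine factor integrates to 0. *)
Lemma integral_expw_rV_cos_sin n e (z : 'rV[R]_n) : 0 < e ->
  (\int[mu n]_x (expw_rV e x * cos (dotp z x))%:E = (poisson_rV e z)%:E)%E /\
  (\int[mu n]_x (expw_rV e x * sin (dotp z x))%:E = 0)%E.
Proof.
move=> e0; elim: n z => [|n ih] z.
  split.
    transitivity (\int[\d_(0%R : 'rV[R]_0)]_x (1%:E : \bar R))%E.
      apply: eq_integral => x _.
      by rewrite /expw_rV /dotp !big_ord0 cos0 mul1r.
    by rewrite integral_dirac// diracT mul1e /poisson_rV big_ord0.
  rewrite (eq_integral (cst 0)%E) ?integral0// => x _.
  by rewrite /expw_rV /dotp !big_ord0 sin0 mul1r.
pose z' : 'rV[R]_n := \row_i z 0 (lift ord0 i).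
have mcz m (y : 'rV[R]_m) : measurable_fun setT (fun x => cos (dotp y x)).
  by apply: measurableT_comp; [exact: measurable_cos|exact: measurable_dotpr].
have msz m (y : 'rV[R]_m) : measurable_fun setT (fun x => sin (dotp y x)).
  by apply: measurableT_comp; [exact: measurable_sin|exact: measurable_dotpr].
have icz m (y : 'rV[R]_m) : (mu m).-integrable setT
    (fun x => (expw_rV e x * cos (dotp y x))%:E).
  by apply: integrable_expw_rVM => // t; exact: normr_cos_le1.
have isz m (y : 'rV[R]_m) : (mu m).-integrable setT
    (fun x => (expw_rV e x * sin (dotp y x))%:E).
  by apply: integrable_expw_rVM => // t; exact: normr_sin_le1.
have [ihc ihs] := ih z'.
split.
- rewrite integral_rV_cons_integrable//.
  transitivity (\int[leb]_t ((expw e t * cos (z 0 ord0 * t))%:E * (poisson_rV e z')%:E))%E.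
    apply: eq_integral => t _.
    under eq_integral => v _.
      rewrite dotp_cons cosD /expw_rV prod_rV_cons -/(expw_rV e v) -/z'.
      rewrite (_ : _ * _ = (expw e t * cos (z 0 ord0 * t)) * (expw_rV e v * cos (dotp z' v)) -
        (expw e t * sin (z 0 ord0 * t)) * (expw_rV e v * sin (dotp z' v))); last by ring.
      rewrite EFinB !(EFinM (expw e t * _)); over.
    rewrite integralB//; [|exact: integrableZl..].
    by rewrite !integralZl// ihc ihs mule0 sube0.
  rewrite integralZr//; last first.
    by apply: integrable_expwM => //; [exact: measurable_cosM|move=> t; exact: normr_cos_le1].
  rewrite integral_expw_cos// -EFinM; congr EFin.
  rewrite /poisson_rV big_ord_recl; congr (_ * _).
  by apply: eq_bigr => i _; rewrite mxE.
- rewrite integral_rV_cons_integrable//.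
  transitivity (\int[leb]_t ((expw e t * sin (z 0 ord0 * t))%:E * (poisson_rV e z')%:E))%E.
    apply: eq_integral => t _.
    under eq_integral => v _.
      rewrite dotp_cons sinD /expw_rV prod_rV_cons -/(expw_rV e v) -/z'.
      rewrite (_ : _ * _ = (expw e t * sin (z 0 ord0 * t)) * (expw_rV e v * cos (dotp z' v)) +
        (expw e t * cos (z 0 ord0 * t)) * (expw_rV e v * sin (dotp z' v))); last by ring.
      rewrite EFinD !(EFinM (expw e t * _)); over.
    rewrite integralD//; [|exact: integrableZl..].
    by rewrite !integralZl// ihc ihs mule0 adde0.
  rewrite integralZr//; last first.
    by apply: integrable_expwM => //; [exact: measurable_sinM|move=> t; exact: normr_sin_le1].
  by rewrite integral_expw_sin// mul0e.
Qed.

End poisson_rV.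

(** * Bessel's inequality for the Fourier transform *)

Section bessel.
Context {R : realType} {n : nat}.
Local Notation mu := (lebesgue_rV (R := R) n).
Local Notation E := 'rV[R]_n.
Variables (a b : E -> R).
Hypotheses (ia : mu.-integrable setT (EFin \o a)) (ib : mu.-integrable setT (EFin \o b)).

Let ma : measurable_fun setT a.
Proof. by apply/measurable_EFinP; exact: measurable_int ia. Qed.
Let mb : measurable_fun setT b.
Proof. by apply/measurable_EFinP; exact: measurable_int ib. Qed.

(** Real and imaginary parts of exp(- i x.xi) (a + i b); [F] dominates both, uniformly in [xi]. *)
Let al (xi x : E) := cos (dotp x xi) * a x + sin (dotp x xi) * b x.
Let be (xi x : E) := cos (dotp x xi) * b x - sin (dotp x xi) * a x.
Let F x := `|a x| + `|b x|.

Let F0 x : 0 <= F x. Proof. by rewrite addr_ge0. Qed.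

Let iF : mu.-integrable setT (EFin \o F).
Proof.
rewrite (_ : _ \o _ = (fun x => (`|a x|%R)%:E) \+ (fun x => (`|b x|%R)%:E))%E; last by [].
by apply: integrableD => //; [exact: (integrable_norm ia)|exact: (integrable_norm ib)].
Qed.

Let mcs (f : R -> R) : measurable_fun setT f ->
  measurable_fun setT (fun p : E * E => f (dotp p.2 p.1)).
Proof.
move=> mf; apply: (@measurableT_comp _ _ _ _ _ _ f) => //.
rewrite (_ : (fun _ => _) = fun p => dotp p.1 p.2); last first.
  by apply/funext => p; rewrite dotpC.
exact: measurable_dotp_pair.
Qed.

Let ms2 (f : E -> R) : measurable_fun setT f ->
  measurable_fun setT (fun p : E * E => f p.2).
Proof. by move=> mf; exact: (@measurableT_comp _ _ _ _ _ _ f). Qed.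

Let ms1 (f : E -> R) : measurable_fun setT f ->
  measurable_fun setT (fun p : E * E => f p.1).
Proof. by move=> mf; exact: (@measurableT_comp _ _ _ _ _ _ f). Qed.

Let mal : measurable_fun setT (fun p : E * E => al p.1 p.2).
Proof.
apply: measurable_funD; apply: measurable_funM;
  [exact: (mcs measurable_cos)|exact: ms2|exact: (mcs measurable_sin)|exact: ms2].
Qed.

Let mbe : measurable_fun setT (fun p : E * E => be p.1 p.2).
Proof.
apply: measurable_funB; apply: measurable_funM;
  [exact: (mcs measurable_cos)|exact: ms2|exact: (mcs measurable_sin)|exact: ms2].
Qed.

Let alF xi x : `|al xi x| <= F x.
Proof.
rewrite (le_trans (ler_normD _ _))// lerD// normrM ler_piMl//.
  exact: normr_cos_le1.
exact: normr_sin_le1.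
Qed.

Let beF xi x : `|be xi x| <= F x.
Proof.
rewrite (le_trans (ler_normB _ _))// /F addrC lerD// normrM ler_piMl//.
  exact: normr_sin_le1.
exact: normr_cos_le1.
Qed.

Let ial xi : mu.-integrable setT (EFin \o al xi).
Proof.
apply: le_integrable iF => //.
  apply/measurable_EFinP; exact: (measurable_fun_pair2 xi mal).
by move=> x _; rewrite /= lee_fin (ger0_norm (F0 x)).
Qed.

Let ibe xi : mu.-integrable setT (EFin \o be xi).
Proof.
apply: le_integrable iF => //.
  apply/measurable_EFinP; exact: (measurable_fun_pair2 xi mbe).
by move=> x _; rewrite /= lee_fin (ger0_norm (F0 x)).
Qed.

Let A xi := \int[mu]_x al xi x.
Let B xi := \int[mu]_x be xi x.
Let N := \int[mu]_x F x.

Let N0 : 0 <= N. Proof. exact: Rintegral_ge0. Qed.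

Let AN xi : `|A xi| <= N.
Proof.
rewrite (le_trans (le_normr_Rintegral _ (ial xi)))//; apply: le_Rintegral => //.
by apply: (integrable_norm (ial xi)).
Qed.

Let BN xi : `|B xi| <= N.
Proof.
rewrite (le_trans (le_normr_Rintegral _ (ibe xi)))//; apply: le_Rintegral => //.
by apply: (integrable_norm (ibe xi)).
Qed.

Let mA : measurable_fun setT A.
Proof. exact: (measurable_Rintegral_pair _ mal). Qed.

Let mB : measurable_fun setT B.
Proof. exact: (measurable_Rintegral_pair _ mbe). Qed.

Lemma EFin_Rintegral d (T : measurableType d) (m : {measure set T -> \bar R}) (f : T -> R) :
  m.-integrable setT (EFin \o f) -> (\int[m]_x f x)%:E = (\int[m]_x (f x)%:E)%E.
Proof. by move=> fi; rewrite /Rintegral fineK//; exact: integrable_fin_num. Qed.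

Section eps.
Variables (e : R) (e0 : 0 < e).
Let W := @expw_rV R n e.
Let K := @poisson_rV R n e.
Let W0 x : 0 <= W x. Proof. exact: expw_rV_ge0. Qed.
Let mW : measurable_fun setT W. Proof. exact: measurable_expw_rV. Qed.
Let iW : mu.-integrable setT (EFin \o W). Proof. exact: integrable_expw_rV. Qed.

(** Only one factor of the square is written out as an integral. The other stays the bounded
    function [A] or [B], so [W xi * (2 * N * F x)] dominates and the integrals commute. *)
Let step1 : (\int[mu]_xi (W xi * (A xi ^+ 2 + B xi ^+ 2))%:E =
  \int[mu]_x \int[mu]_xi (W xi * (A xi * al xi x + B xi * be xi x))%:E)%E.
Proof.
rewrite -(@Fubini_bound _ _ _ _ _ mu mu
   (fun xi x => W xi * (A xi * al xi x + B xi * be xi x)) W (fun x => 2 * N * F x))//.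
- apply: eq_integral => xi _.
  transitivity (\int[mu]_x ((W xi * A xi)%:E * (al xi x)%:E + (W xi * B xi)%:E * (be xi x)%:E))%E.
    rewrite integralD//; [|exact: (integrableZl _ _ (ial xi))|exact: (integrableZl _ _ (ibe xi))].
    rewrite !integralZl//; [|exact: ibe|exact: ial].
    by rewrite -!EFin_Rintegral// -!EFinM -EFinD; congr EFin; rewrite -/(A xi) -/(B xi); ring.
  by apply: eq_integral => x _; rewrite -!EFinM -EFinD; congr EFin; ring.
- apply: measurable_funM; first exact: ms1.
  by apply: measurable_funD; apply: measurable_funM => //; exact: ms1.
- move=> xi x; rewrite normrM (ger0_norm (W0 _)) ler_wpM2l//.
  rewrite (le_trans (ler_normD _ _))// mulrDl mul1r mulrDl lerD// normrM ler_pM//.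
- by move=> x; rewrite !mulr_ge0.
- by apply: (@integrableZl _ _ _ mu setT _ (2 * N)%R (EFin \o F)).
Qed.

(** Writing out the second factor and integrating first over [xi] leaves the transform of [W] at
    [x - y], which is [K (x - y)]. The antisymmetric part of the product is multiplied by the sine
    transform, which vanishes. *)
Let step2 x : (\int[mu]_xi (W xi * (A xi * al xi x + B xi * be xi x))%:E =
  \int[mu]_y (K (x - y) * (a x * a y + b x * b y))%:E)%E.
Proof.
transitivity (\int[mu]_xi \int[mu]_y (W xi * (al xi x * al xi y + be xi x * be xi y))%:E)%E.
  apply: eq_integral => xi _; apply/esym.
  transitivity (\int[mu]_y ((W xi * al xi x)%:E * (al xi y)%:E + (W xi * be xi x)%:E * (be xi y)%:E))%E.
    by apply: eq_integral => y _; rewrite -!EFinM -EFinD; congr EFin; ring.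
  rewrite integralD//; [|exact: (integrableZl _ _ (ial xi))|exact: (integrableZl _ _ (ibe xi))].
  rewrite !integralZl//; [|exact: ibe|exact: ial].
  by rewrite -!EFin_Rintegral// -!EFinM -EFinD; congr EFin; rewrite -/(A xi) -/(B xi); ring.
have mc (f : E -> E -> R) : measurable_fun setT (fun p : E * E => f p.1 p.2) ->
    measurable_fun setT (fun p : E * E => f p.1 x).
  by move=> mf; exact: (ms1 (measurable_fun_pair1 (f := fun p => f p.1 p.2) x mf)).
rewrite (@Fubini_bound _ _ _ _ _ mu mu
   (fun xi y => W xi * (al xi x * al xi y + be xi x * be xi y)) W (fun y => 2 * F x * F y))//.
- apply: eq_integral => y _.
  have [hc hs] := integral_expw_rV_cos_sin (x - y) e0.
  transitivity (\int[mu]_xi ((W xi * cos (dotp (x - y) xi))%:E * (a x * a y + b x * b y)%:E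
     + (W xi * sin (dotp (x - y) xi))%:E * (b x * a y - a x * b y)%:E))%E.
    apply: eq_integral => xi _; rewrite -!EFinM -EFinD; congr EFin.
    by rewrite dotpBl cosB sinB /al /be; ring.
  have i1 : mu.-integrable setT (fun xi => (W xi * cos (dotp (x - y) xi))%:E).
    apply: integrable_expw_rVM => //; last by move=> ?; exact: normr_cos_le1.
    by apply: measurableT_comp; [exact: measurable_cos|exact: measurable_dotpr].
  have i2 : mu.-integrable setT (fun xi => (W xi * sin (dotp (x - y) xi))%:E).
    apply: integrable_expw_rVM => //; last by move=> ?; exact: normr_sin_le1.
    by apply: measurableT_comp; [exact: measurable_sin|exact: measurable_dotpr].
  rewrite integralD//; [|exact: integrableZr|exact: integrableZr].
  by rewrite !integralZr// hc hs mul0e adde0.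
- apply: measurable_funM; first exact: ms1.
  by apply: measurable_funD; apply: measurable_funM => //; exact: mc.
- move=> xi y; rewrite normrM (ger0_norm (W0 _)) ler_wpM2l//.
  by rewrite (le_trans (ler_normD _ _))// -mulrA mulr_natl mulr2n lerD// normrM ler_pM.
- by move=> y; rewrite !mulr_ge0.
- by apply: (@integrableZl _ _ _ mu setT _ (2 * F x)%R (EFin \o F)).
Qed.

Let Q x := a x ^+ 2 + b x ^+ 2.

Let mKB : measurable_fun setT (fun p : E * E => K (p.1 - p.2)).
Proof.
apply: (@measurableT_comp _ _ _ _ _ _ K); first exact: measurable_poisson_rV.
apply: measurable_fun_rVP => i.
rewrite (_ : _ \o _ = fun p => rV_coord i p.1 - rV_coord i p.2); last first.
  by apply/funext => p; rewrite /rV_coord/= !mxE.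
apply: measurable_funB; apply: measurableT_comp => //; exact: measurable_rV_coord.
Qed.

Let KB x y : K (x - y) = K (y - x).
Proof.
by apply: eq_bigr => i _; rewrite -opprB !mxE poissonN.
Qed.

Let step3 : (\int[mu]_x \int[mu]_y (K (x - y) * Q x)%:E =
  ((2 * pi) ^+ n)%:E * \int[mu]_x (Q x)%:E)%E.
Proof.
have mQ : measurable_fun setT Q by apply: measurable_funD; exact: measurable_funX.
have Q0 x : 0 <= Q x by rewrite addr_ge0// sqr_ge0.
have mK : measurable_fun setT K by exact: measurable_poisson_rV.
rewrite -ge0_integralZl//; last 3 first.
- exact/measurable_EFinP.
- by move=> x _; rewrite lee_fin.
- by rewrite lee_fin exprn_ge0// mulr_ge0// pi_ge0.
apply: eq_integral => x _.
rewrite -(integral_poisson_rV n e0) muleC -ge0_integralZl//; last 3 first.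
- exact/measurable_EFinP.
- by move=> y _; rewrite lee_fin poisson_rV_ge0.
- by rewrite lee_fin.
rewrite -(@integral_rV_shift _ _ (- x) (fun y => (Q x)%:E * (K y)%:E)%E)//.
- by apply: eq_integral => y _; rewrite -EFinM KB mulrC.
- by apply: measurable_funeM; exact/measurable_EFinP.
- by move=> y; rewrite mule_ge0// lee_fin// poisson_rV_ge0.
Qed.

(* Weighted by [W], the squared transform is a quadratic form with the Poisson
   kernel [K], of total mass [(2 pi)^n]; Schur's test bounds it. *)
Lemma bessel_expw :
  (\int[mu]_xi (W xi * (A xi ^+ 2 + B xi ^+ 2))%:E <=
   ((2 * pi) ^+ n)%:E * \int[mu]_x (Q x)%:E)%E.
Proof.
have mQ : measurable_fun setT Q by apply: measurable_funD; exact: measurable_funX.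
have Q0 x : 0 <= Q x by rewrite addr_ge0// sqr_ge0.
have K0 x : 0 <= K x by exact: poisson_rV_ge0.
rewrite step1.
under eq_integral do rewrite step2.
pose g x y := K (x - y) * (a x * a y + b x * b y).
have mg : measurable_fun setT (fun p : E * E => g p.1 p.2).
  apply: measurable_funM => //.
  by apply: measurable_funD; apply: measurable_funM; [exact: ms1|exact: ms2|exact: ms1|exact: ms2].
pose h x y := K (x - y) * Q x.
have h0 x y : 0 <= h x y by rewrite mulr_ge0.
have mh : measurable_fun setT (fun p : E * E => h p.1 p.2).
  by apply: measurable_funM => //; exact: ms1.
have mh' : measurable_fun setT (fun p : E * E => h p.2 p.1).
  have := measurableT_comp mh (@measurable_swap _ _ _ _); exact.
have h0e p : (0 <= (h p.1 p.2)%:E)%E by rewrite lee_fin.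
have h0e' p : (0 <= (h p.2 p.1)%:E)%E by rewrite lee_fin.
have meh : measurable_fun setT (fun p : E * E => (h p.1 p.2)%:E) by exact/measurable_EFinP.
have meh' : measurable_fun setT (fun p : E * E => (h p.2 p.1)%:E) by exact/measurable_EFinP.
have mI : measurable_fun setT (fun x => \int[mu]_y (h x y)%:E)%E.
  exact: (measurable_fun_fubini_tonelli_F (fun p : E * E => (h p.1 p.2)%:E)).
have mI' : measurable_fun setT (fun x => \int[mu]_y (h y x)%:E)%E.
  exact: (measurable_fun_fubini_tonelli_F (fun p : E * E => (h p.2 p.1)%:E)).
apply: (@le_trans _ _ (\int[mu]_x (2^-1%:E * (\int[mu]_y (h x y)%:E + \int[mu]_y (h y x)%:E)))%E).
  apply: (le_trans (lee_abs _)).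
  have mgx : measurable_fun setT (fun x => \int[mu]_y (g x y)%:E)%E.
    exact: (measurable_integral_pair _ mg).
  apply: (le_trans (le_abse_integral _ _ _)) => //.
  apply: ge0_le_integral => //.
  - exact: measurableT_comp.
  - by apply: measurable_funeM; exact: emeasurable_funD.
  - move=> x _.
    apply: (le_trans (le_abse_integral _ _ _)) => //.
      by apply/measurable_EFinP; exact: (measurable_fun_pair2 x mg).
    rewrite -ge0_integralD//; last 4 first.
    + by move=> y _; rewrite lee_fin.
    + exact: (measurable_fun_pair2 x meh).
    + by move=> y _; rewrite lee_fin.
    + exact: (measurable_fun_pair2 x meh').
    rewrite -ge0_integralZl//.
    + apply: ge0_le_integral => //.
      * apply: measurableT_comp => //; apply/measurable_EFinP.
        exact: (measurable_fun_pair2 x mg).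
      * apply: measurable_funeM; apply: emeasurable_funD.
          exact: (measurable_fun_pair2 x meh).
        exact: (measurable_fun_pair2 x meh').
      * move=> y _; rewrite /= -EFinD -EFinM lee_fin /h (KB y x) /g -mulrDr mulrCA.
        rewrite normrM (ger0_norm (K0 _)) ler_wpM2l// /Q.
        have := sqr_ge0 (a x - a y); have := sqr_ge0 (b x - b y).
        have := sqr_ge0 (a x + a y); have := sqr_ge0 (b x + b y).
        by rewrite ler_norml; move=> *; apply/andP; split; nra.
    + apply: emeasurable_funD.
        exact: (measurable_fun_pair2 x meh).
      exact: (measurable_fun_pair2 x meh').
    + by move=> y _; rewrite adde_ge0 ?lee_fin.
rewrite ge0_integralZl//; last 2 first.
- exact: emeasurable_funD.
- by move=> x _; apply: adde_ge0; apply: integral_ge0 => y _; rewrite lee_fin.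
rewrite ge0_integralD//; last 2 first.
- by move=> x _; apply: integral_ge0 => y _; rewrite lee_fin.
- by move=> x _; apply: integral_ge0 => y _; rewrite lee_fin.
rewrite (fubini_tonelli (fun p : E * E => (h p.2 p.1)%:E))//= step3.
rewrite -mule2n -mule_natl muleA -EFinM mulVf// mul1e//.
Qed.

End eps.

(** The right-hand side of [bessel_expw] does not depend on [e], while the weight tends to 1 at
    every point as [e] goes to 0. *)
Lemma bessel_real : (\int[mu]_xi (A xi ^+ 2 + B xi ^+ 2)%:E <=
   ((2 * pi) ^+ n)%:E * \int[mu]_x (a x ^+ 2 + b x ^+ 2)%:E)%E.
Proof.
pose e k : R := k.+1%:R^-1.
have e0 k : 0 < e k by rewrite invr_gt0.
apply: (@fatou_le _ _ _ mu (fun k xi => (expw_rV (e k) xi * (A xi ^+ 2 + B xi ^+ 2))%:E)).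
- move=> k; apply/measurable_EFinP; apply: measurable_funM; first exact: measurable_expw_rV.
  by apply: measurable_funD; exact: measurable_funX.
- by move=> k x; rewrite lee_fin mulr_ge0// ?expw_rV_ge0// addr_ge0// sqr_ge0.
- move=> x; apply: cvg_EFin; first exact: nearW.
  rewrite -[X in _ --> X]mul1r; apply: cvgM; last exact: cvg_cst.
  rewrite (_ : 1 = \prod_(i < n) 1); last by rewrite big1.
  apply: cvg_big => [|i _]; first by move=> ?; exact: mul_continuous.
  rewrite /expw -(@expR0 R); apply: continuous_cvg; first exact: continuous_expR.
  have h : (e k * `|x 0 i|) @[k --> \oo] --> 0 * `|x 0 i|.
    by apply: cvgM; [exact: cvg_harmonic|exact: cvg_cst].
  by have := cvgN h; rewrite mul0r oppr0; exact.
- by move=> k; exact: bessel_expw.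
Qed.

End bessel.

(** * Complex-valued functions and weighted sesquilinear forms *)

Section complex_aux.
Context {R : rcfType}.
Local Open Scope complex_scope.
Implicit Types x y : R[i].
Local Notation Re := complex.Re.
Local Notation Im := complex.Im.

Lemma Re_mulc x y : Re (x * y) = Re x * Re y - Im x * Im y.
Proof. by case: x y => a b [c d]. Qed.

Lemma Im_mulc x y : Im (x * y) = Re x * Im y + Im x * Re y.
Proof. by case: x y => a b [c d]. Qed.

Lemma Re_subc x y : Re (x - y) = Re x - Re y.
Proof. by case: x y => a b [c d]. Qed.

Lemma Im_subc x y : Im (x - y) = Im x - Im y.
Proof. by case: x y => a b [c d]. Qed.

Lemma Re_conjc x : Re x^* = Re x.
Proof. by case: x. Qed.

Lemma Im_conjc x : Im x^* = - Im x.
Proof. by case: x. Qed.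

Lemma eq_complexP x y : Re x = Re y -> Im x = Im y -> x = y.
Proof. by case: x y => a b [c d] /= -> ->. Qed.

Lemma conjc_realM (r : R) x : (r%:C * x)^* = r%:C * x^*.
Proof. by case: x => a b; apply: eq_complexP; rewrite !(Re_mulc, Im_mulc, Re_conjc, Im_conjc)/=; ring. Qed.

Lemma Re_realM (r : R) x : Re (r%:C * x) = r * Re x.
Proof. by rewrite Re_mulc/= mul0r subr0. Qed.

Lemma Re_real (r : R) : Re r%:C = r. Proof. by []. Qed.

Lemma normc_sq x : Normc.normc x ^+ 2 = Re x ^+ 2 + Im x ^+ 2.
Proof. by case: x => a b; rewrite sqr_sqrtr// addr_ge0// sqr_ge0. Qed.

Lemma mulc_conj x : x * x^* = (Normc.normc x ^+ 2)%:C.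
Proof.
by rewrite normc_sq; apply: eq_complexP; rewrite !(Re_mulc, Im_mulc, Re_conjc, Im_conjc)/=; ring.
Qed.

(** Parallelogram identity: the difference of the two sides is the squared modulus of
    [x + c * y]. *)
Lemma normc_sq_subM x y c : Normc.normc (x - c * y) ^+ 2 <=
  2 * Normc.normc x ^+ 2 + 2 * Normc.normc c ^+ 2 * Normc.normc y ^+ 2.
Proof.
rewrite !normc_sq Re_subc Im_subc Re_mulc Im_mulc.
rewrite -subr_ge0 [leRHS](_ : _ = (Re x + (Re c * Re y - Im c * Im y)) ^+ 2 +
  (Im x + (Re c * Im y + Im c * Re y)) ^+ 2); last by ring.
by rewrite addr_ge0// sqr_ge0.
Qed.

End complex_aux.

Definition compE := (@Re_mulc, @Im_mulc, @Re_subc, @Im_subc, @Re_conjc, @Im_conjc).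

Section complex_integral.
Context {R : realType} {n : nat}.
Local Open Scope complex_scope.
Local Notation mu := (lebesgue_rV (R := R) n).
Local Notation E := 'rV[R]_n.
Local Notation Re := complex.Re.
Local Notation Im := complex.Im.
Local Notation normc := Normc.normc.
Implicit Types (f g phi psi : E -> R[i]) (c : R[i]) (w : E -> R).

Definition Cintegrable f := mu.-integrable setT (fun x => (Re (f x))%:E) /\
  mu.-integrable setT (fun x => (Im (f x))%:E).

Lemma Cmeasurable_subM f g c : Cmeasurable f -> Cmeasurable g ->
  Cmeasurable (fun x => f x - c * g x).
Proof.
move=> [mf1 mf2] [mg1 mg2]; split.
- rewrite (_ : (fun _ => _) = fun x => Re (f x) - (Re c * Re (g x) - Im c * Im (g x))).
    by apply: measurable_funB => //; apply: measurable_funB; exact: measurable_funM.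
  by apply/funext => x; rewrite !compE.
- rewrite (_ : (fun _ => _) = fun x => Im (f x) - (Re c * Im (g x) + Im c * Re (g x))).
    by apply: measurable_funB => //; apply: measurable_funD; exact: measurable_funM.
  by apply/funext => x; rewrite !compE.
Qed.

Lemma CmeasurableM f g : Cmeasurable f -> Cmeasurable g ->
  Cmeasurable (fun x => f x * g x).
Proof.
move=> [mf1 mf2] [mg1 mg2]; split.
- rewrite (_ : (fun _ => _) = fun x => Re (f x) * Re (g x) - Im (f x) * Im (g x)).
    by apply: measurable_funB => //; exact: measurable_funM.
  by apply/funext => x; rewrite !compE.
- rewrite (_ : (fun _ => _) = fun x => Re (f x) * Im (g x) + Im (f x) * Re (g x)).
    by apply: measurable_funD => //; exact: measurable_funM.
  by apply/funext => x; rewrite !compE.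
Qed.

Lemma measurable_normc_sq f : Cmeasurable f ->
  measurable_fun setT (fun x => normc (f x) ^+ 2).
Proof.
move=> [m1 m2]; under eq_fun do rewrite normc_sq.
by apply: measurable_funD; exact: measurable_funX.
Qed.

Lemma measurable_enormc_sq f : Cmeasurable f ->
  measurable_fun setT (fun x => (normc (f x) ^+ 2)%:E).
Proof. by move=> mf; apply/measurable_EFinP; exact: measurable_normc_sq. Qed.

Lemma Cintegrable_bound f (u : E -> R) : Cmeasurable f ->
  mu.-integrable setT (EFin \o u) ->
  (forall x, `|Re (f x)| <= u x) -> (forall x, `|Im (f x)| <= u x) -> Cintegrable f.
Proof.
move=> [m1 m2] iu h1 h2; split; apply: le_integrable iu => //; try exact/measurable_EFinP.
- by move=> x _; rewrite /= lee_fin (le_trans (h1 x))// ler_norm.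
- by move=> x _; rewrite /= lee_fin (le_trans (h2 x))// ler_norm.
Qed.

Lemma integrableZl_EFin (D : set E) (k : R) (f : E -> R) : measurable D ->
  mu.-integrable D (fun x => (f x)%:E) -> mu.-integrable D (fun x => (k * f x)%:E).
Proof. by move=> mD fi; exact: (@integrableZl _ _ _ mu D mD k (EFin \o f)). Qed.

Lemma Cintegral_subM f g c : Cintegrable f -> Cintegrable g ->
  Cintegral setT (fun x => f x - c * g x) = Cintegral setT f - c * Cintegral setT g.
Proof.
move=> [f1 f2] [g1 g2]; apply: eq_complexP; rewrite !compE /Cintegral/=.
- under eq_Rintegral do rewrite !compE.
  rewrite RintegralB//; last first.
    by apply: (@integrableB _ _ _ mu setT _ (fun x => (Re c * Re (g x))%:E) (fun x => (Im c * Im (g x))%:E)) => //; exact: integrableZl_EFin.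
  by rewrite [X in _ - X]RintegralB//; [|exact: integrableZl_EFin..]; rewrite !RintegralZl.
- under eq_Rintegral do rewrite !compE.
  rewrite RintegralB//; last first.
    by apply: (@integrableD _ _ _ mu setT _ (fun x => (Re c * Im (g x))%:E) (fun x => (Im c * Re (g x))%:E)) => //; exact: integrableZl_EFin.
  by rewrite RintegralD//; [|exact: integrableZl_EFin..]; rewrite !RintegralZl.
Qed.

Lemma eq_Cintegral D f g : (forall x, f x = g x) -> Cintegral D f = Cintegral D g.
Proof. by move=> fg; congr Cintegral; apply/funext. Qed.

Lemma Cintegral_conj D f : mu.-integrable D (fun x => (Im (f x))%:E) -> measurable D ->
  Cintegral D (fun x => (f x)^*) = (Cintegral D f)^*.
Proof.
move=> fi mD; apply: eq_complexP; rewrite !compE /Cintegral/=.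
  by apply: eq_Rintegral => x _; rewrite compE.
rewrite -mulN1r -RintegralZl//; apply: eq_Rintegral => x _.
by rewrite compE mulN1r.
Qed.

Lemma Cintegral_restrict D f : (forall x, ~ D x -> f x = 0) ->
  Cintegral D f = Cintegral setT f.
Proof.
move=> f0; apply: eq_complexP; rewrite /Cintegral/= Rintegral_mkcond.
- apply: eq_Rintegral => x _; rewrite patchE; case: ifPn => // /negP.
  by rewrite inE => /f0 ->.
- apply: eq_Rintegral => x _; rewrite patchE; case: ifPn => // /negP.
  by rewrite inE => /f0 ->.
Qed.

(* [wform w] is the sesquilinear form with density [w]: the L2 product for
   [w = 1] and, on Fourier transforms, the logarithmic form for [w = ln |xi|]. *)
Definition wform w phi psi := Cintegral setT (fun x => (w x)%:C * (phi x * (psi x)^*)).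

(** Absolute convergence of the form on the diagonal. The absolute value matters for [w = ln |xi|],
    which is negative inside the unit ball. *)
Definition wint w phi := Cmeasurable phi /\
  mu.-integrable setT (fun x => (`|w x| * normc (phi x) ^+ 2)%:E).

Section wform.
Variables (w : E -> R) (mw : measurable_fun setT w).

Lemma wform_integrable phi psi : wint w phi -> wint w psi ->
  Cintegrable (fun x => (w x)%:C * (phi x * (psi x)^*)).
Proof.
move=> [m1 i1] [m2 i2].
apply: (@Cintegrable_bound _ (fun x => `|w x| * normc (phi x) ^+ 2 + `|w x| * normc (psi x) ^+ 2)).
- apply: CmeasurableM; first by split => //=; exact: measurable_cst.
  apply: CmeasurableM => //; case: m2 => m21 m22; split.
    by rewrite (_ : (fun _ => _) = fun x => Re (psi x))//; apply/funext => x; rewrite compE.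
  rewrite (_ : (fun _ => _) = fun x => - Im (psi x)); first exact: measurable_funN.
  by apply/funext => x; rewrite compE.
- exact: (integrableD _ i1 i2).
- move=> x; rewrite !compE/= mul0r subr0 -mulrDr normrM ler_wpM2l// !normc_sq.
  move: (Re (phi x)) (Im (phi x)) (Re (psi x)) (Im (psi x)) => a b a' b'.
  have := sqr_ge0 (a - a'); have := sqr_ge0 (b - b').
  have := sqr_ge0 (a + a'); have := sqr_ge0 (b + b').
  by rewrite ler_norml; move=> *; apply/andP; split; nra.
- move=> x; rewrite !compE/= mul0r addr0 -mulrDr normrM ler_wpM2l// !normc_sq.
  move: (Re (phi x)) (Im (phi x)) (Re (psi x)) (Im (psi x)) => a b a' b'.
  have := sqr_ge0 (a - b'); have := sqr_ge0 (b - a').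
  have := sqr_ge0 (a + b'); have := sqr_ge0 (b + a').
  by rewrite ler_norml; move=> *; apply/andP; split; nra.
Qed.

Lemma wint_subM phi psi c : wint w phi -> wint w psi ->
  wint w (fun x => phi x - c * psi x).
Proof.
move=> [m1 i1] [m2 i2]; have m3 := Cmeasurable_subM c m1 m2; split => //.
apply: (@le_integrable _ _ _ mu setT _ _ (fun x => (2%:E * (`|w x| * normc (phi x) ^+ 2)%:E +
  (2 * normc c ^+ 2)%:E * (`|w x| * normc (psi x) ^+ 2)%:E)%E)) => //.
- apply/measurable_EFinP; apply: measurable_funM; first exact: measurableT_comp.
  exact: measurable_normc_sq.
- move=> x _; rewrite -!EFinM -EFinD /= lee_fin [leLHS]ger0_norm; last by rewrite mulr_ge0// sqr_ge0.
  apply: le_trans (ler_norm _).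
  rewrite [leRHS](_ : _ = `|w x| * (2 * normc (phi x) ^+ 2 +
    2 * normc c ^+ 2 * normc (psi x) ^+ 2)); last by ring.
  by rewrite ler_wpM2l// normc_sq_subM.
- by apply: integrableD => //; exact: integrableZl.
Qed.

Lemma wformBr phi psi chi c : wint w phi -> wint w psi -> wint w chi ->
  wform w phi (fun x => chi x - c * psi x) = wform w phi chi - c^* * wform w phi psi.
Proof.
move=> h1 h2 h3; rewrite /wform -Cintegral_subM; [|exact: wform_integrable..].
by apply: eq_Cintegral => x; rewrite rmorphB rmorphM/=; ring.
Qed.

Lemma wformBl phi psi chi c : wint w phi -> wint w psi -> wint w chi ->
  wform w (fun x => chi x - c * psi x) phi = wform w chi phi - c * wform w psi phi.
Proof.
move=> h1 h2 h3; rewrite /wform -Cintegral_subM; [|exact: wform_integrable..].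
by apply: eq_Cintegral => x; ring.
Qed.

Lemma wformC phi psi : wint w phi -> wint w psi ->
  wform w psi phi = (wform w phi psi)^*.
Proof.
move=> h1 h2; rewrite /wform -Cintegral_conj//; last by have [] := wform_integrable h1 h2.
apply: eq_Cintegral => x; apply: eq_complexP; rewrite !compE/=; ring.
Qed.

Lemma wform_diag phi : wform w phi phi =
  (\int[mu]_x (w x * normc (phi x) ^+ 2))%:C.
Proof.
apply: eq_complexP; rewrite /wform/Cintegral/=.
  by apply: eq_Rintegral => x _; rewrite mulc_conj !compE/= mul0r subr0.
under eq_Rintegral do rewrite mulc_conj !compE/= mulr0 mul0r addr0.
by rewrite /Rintegral integral0.
Qed.

End wform.

End complex_integral.

(** * The Fourier transform of complex-valued functions *)

Section fourier.
Context {R : realType} {n : nat}.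
Local Open Scope complex_scope.
Local Notation mu := (lebesgue_rV (R := R) n).
Local Notation E := 'rV[R]_n.
Local Notation Re := complex.Re.
Local Notation Im := complex.Im.
Local Notation normc := Normc.normc.
Implicit Types (f g phi psi : E -> R[i]) (c : R[i]) (xi : E).

Lemma Re_expiM phi xi x : Re (expi (- dotp x xi) * phi x) =
  cos (dotp x xi) * Re (phi x) + sin (dotp x xi) * Im (phi x).
Proof. by rewrite compE/= cosN sinN mulNr opprK. Qed.

Lemma Im_expiM phi xi x : Im (expi (- dotp x xi) * phi x) =
  cos (dotp x xi) * Im (phi x) - sin (dotp x xi) * Re (phi x).
Proof. by rewrite compE/= cosN sinN mulNr. Qed.

Lemma Re_fourier phi xi : Re (fourier phi xi) =
  \int[mu]_x (cos (dotp x xi) * Re (phi x) + sin (dotp x xi) * Im (phi x)).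
Proof. by rewrite /fourier/Cintegral/=; apply: eq_Rintegral => x _; rewrite Re_expiM. Qed.

Lemma Im_fourier phi xi : Im (fourier phi xi) =
  \int[mu]_x (cos (dotp x xi) * Im (phi x) - sin (dotp x xi) * Re (phi x)).
Proof. by rewrite /fourier/Cintegral/=; apply: eq_Rintegral => x _; rewrite Im_expiM. Qed.

Lemma bessel phi : Cintegrable phi ->
  (\int[mu]_xi (normc (fourier phi xi) ^+ 2)%:E <= ((2 * pi) ^+ n)%:E * sqnorm setT phi)%E.
Proof.
move=> [i1 i2]; apply: le_trans (le_trans (bessel_real i1 i2) _).
  rewrite le_eqVlt; apply/orP; left; apply/eqP; apply: eq_integral => xi _.
  by rewrite normc_sq Re_fourier Im_fourier.
rewrite le_eqVlt; apply/orP; left; apply/eqP; congr (_ * _)%E.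
by apply: eq_integral => x _; rewrite normc_sq.
Qed.

Lemma measurable_fourier phi : Cmeasurable phi -> Cmeasurable (fourier phi).
Proof.
move=> [m1 m2].
have mcs (f : R -> R) (g : E -> R) : measurable_fun setT f -> measurable_fun setT g ->
  measurable_fun setT (fun p : E * E => f (dotp p.2 p.1) * g p.2).
  move=> mf mg; apply: measurable_funM; last first.
    exact: (@measurableT_comp _ _ _ _ _ _ g).
  apply: (@measurableT_comp _ _ _ _ _ _ f) => //.
  rewrite (_ : (fun _ => _) = fun p => dotp p.1 p.2); last first.
    by apply/funext => p; rewrite dotpC.
  exact: measurable_dotp_pair.
split.
- under eq_fun do rewrite Re_fourier.
  apply: (measurable_Rintegral_pair _ (h := fun p : E * E =>
   cos (dotp p.2 p.1) * Re (phi p.2) + sin (dotp p.2 p.1) * Im (phi p.2))).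
  by apply: measurable_funD; [exact: (mcs _ _ measurable_cos m1)|exact: (mcs _ _ measurable_sin m2)].
- under eq_fun do rewrite Im_fourier.
  apply: (measurable_Rintegral_pair _ (h := fun p : E * E =>
   cos (dotp p.2 p.1) * Im (phi p.2) - sin (dotp p.2 p.1) * Re (phi p.2))).
  by apply: measurable_funB; [exact: (mcs _ _ measurable_cos m2)|exact: (mcs _ _ measurable_sin m1)].
Qed.

Lemma CmeasurableP phi : Cintegrable phi -> Cmeasurable phi.
Proof.
by move=> [/measurable_int/measurable_EFinP ? /measurable_int/measurable_EFinP ?].
Qed.

Lemma Cmeasurable_expi xi : Cmeasurable (fun x => expi (- dotp x xi)).
Proof.
have md : measurable_fun setT (fun x => - dotp x xi).
  rewrite (_ : (fun _ => _) = fun x => - dotp xi x); last by apply/funext => x; rewrite dotpC.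
  by apply: measurable_funN; exact: measurable_dotpr.
split.
- by apply: (@measurableT_comp _ _ _ _ _ _ (@cos R)) => //; exact: measurable_cos.
- by apply: (@measurableT_comp _ _ _ _ _ _ (@sin R)) => //; exact: measurable_sin.
Qed.

Lemma Cintegrable_expiM phi xi : Cintegrable phi ->
  Cintegrable (fun x => expi (- dotp x xi) * phi x).
Proof.
move=> ip; apply: (@Cintegrable_bound _ _ _ (fun x => `|Re (phi x)| + `|Im (phi x)|)).
- apply: CmeasurableM; [exact: Cmeasurable_expi|exact: CmeasurableP].
- have [/integrable_norm h1 /integrable_norm h2] := ip; exact: (integrableD _ h1 h2).
- move=> x; rewrite Re_expiM (le_trans (ler_normD _ _))// lerD// normrM ler_piMl//.
    exact: normr_cos_le1.
  exact: normr_sin_le1.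
- move=> x; rewrite Im_expiM (le_trans (ler_normB _ _))// addrC lerD// normrM ler_piMl//.
    exact: normr_sin_le1.
  exact: normr_cos_le1.
Qed.

Lemma fourier_subM phi psi c xi : Cintegrable phi -> Cintegrable psi ->
  fourier (fun x => phi x - c * psi x) xi = fourier phi xi - c * fourier psi xi.
Proof.
move=> h1 h2; rewrite /fourier -Cintegral_subM; [|exact: Cintegrable_expiM..].
by apply: eq_Cintegral => x; ring.
Qed.

End fourier.

(** * Euclidean balls *)

Section enorm.
Context {R : realType} {n : nat}.
Implicit Types x y : 'rV[R]_n.

Lemma dotpp_ge0 x : 0 <= dotp x x.
Proof. by apply: sumr_ge0 => i _; rewrite -expr2 sqr_ge0. Qed.

Lemma enorm_ge0 x : 0 <= enorm x. Proof. exact: sqrtr_ge0. Qed.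

Lemma enorm_sq x : enorm x ^+ 2 = dotp x x.
Proof. by rewrite sqr_sqrtr// dotpp_ge0. Qed.

Lemma coord_le_enorm x i : `|x 0 i| <= enorm x.
Proof.
rewrite -[leLHS]ger0_norm// -sqrtr_sqr ler_sqrt ?dotpp_ge0//.
rewrite real_normK ?num_real// /dotp (bigD1 i)//= expr2 lerDl.
by apply: sumr_ge0 => j _; rewrite -expr2 sqr_ge0.
Qed.

Lemma enorm_eq0 x : enorm x = 0 -> x = 0.
Proof.
move=> x0; apply/rowP => i; rewrite mxE; apply/eqP.
by rewrite -normr_le0 -x0 coord_le_enorm.
Qed.

Lemma enorm0 : enorm (0 : 'rV[R]_n) = 0.
Proof. by rewrite /enorm /dotp big1 ?sqrtr0// => i _; rewrite mxE mul0r. Qed.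

Lemma enormZ r x : 0 <= r -> enorm (r *: x) = r * enorm x.
Proof.
move=> r0; rewrite /enorm -[r in RHS]ger0_norm// -sqrtr_sqr -sqrtrM ?sqr_ge0//.
congr Num.sqrt; rewrite /dotp mulr_sumr; apply: eq_bigr => i _.
by rewrite mxE; ring.
Qed.

Lemma dotpZl r x y : dotp (r *: x) y = r * dotp x y.
Proof. by rewrite /dotp mulr_sumr; apply: eq_bigr => i _; rewrite mxE mulrA. Qed.

Lemma dotp0l y : dotp 0 y = 0.
Proof. by rewrite /dotp big1// => i _; rewrite mxE mul0r. Qed.

Lemma dotp_le_enorm x y : dotp x y <= enorm x * enorm y.
Proof.
have [x0|x0] := eqVneq (enorm x) 0.
  by rewrite x0 mul0r (enorm_eq0 x0) dotp0l.
have [y0|y0] := eqVneq (enorm y) 0.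
  by rewrite y0 mulr0 (enorm_eq0 y0) dotpC dotp0l.
have p : 0 < enorm x * enorm y by rewrite mulr_gt0// lt_neqAle eq_sym ?x0 ?y0 enorm_ge0.
(* This square expands to 2 |x| |y| (|x| |y| - x.y), and [p] allows the division. *)
have := dotpp_ge0 (enorm y *: x - enorm x *: y).
rewrite -scaleNr dotpDl !(dotpC _ (_ + _)) !dotpDl !dotpZl !(dotpC _ (_ *: _)) !dotpZl.
rewrite -!enorm_sq (dotpC y x) => h.
rewrite -(ler_pM2l p); move: h; lra.
Qed.

Lemma enormD x y : enorm (x + y) <= enorm x + enorm y.
Proof.
rewrite -[leRHS]ger0_norm ?addr_ge0 ?enorm_ge0// -sqrtr_sqr ler_sqrt ?sqr_ge0//.
rewrite dotpDl !(dotpC _ (_ + _)) !dotpDl -!enorm_sq (dotpC y x).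
have := dotp_le_enorm x y; lra.
Qed.

Lemma measurable_enorm : measurable_fun setT (@enorm R n).
Proof.
apply: (@measurableT_comp _ _ _ _ _ _ (@Num.sqrt R)).
  by apply: continuous_measurable_fun; exact: sqrt_continuous.
by apply: measurable_sum => i; apply: measurable_funM; exact: measurable_rV_coord.
Qed.

End enorm.

Section ball.
Context {R : realType} {n : nat}.
Local Notation mu := (lebesgue_rV (R := R) n).
Local Notation leb := (@lebesgue_measure R).
Local Notation E := 'rV[R]_n.

Definition oball (r : R) : set E := [set x | enorm x < r].

Lemma measurable_oball r : measurable (oball r).
Proof.
rewrite (_ : oball r = enorm @^-1` `]-oo, r[%classic).
  by rewrite -[X in measurable X]setTI; exact: measurable_enorm.
by apply/seteqP; split => x; rewrite /oball/= in_itv.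
Qed.

Lemma integral_indicT (A : set E) : measurable A -> (\int[mu]_x (\1_A x)%:E = mu A)%E.
Proof. by move=> mA; rewrite integral_indic// setIT. Qed.

Lemma lebesgue_rV_scale (r : R) (A : set E) : 0 < r -> measurable A ->
  (mu A = (r ^+ n)%:E * mu [set x | A (r *: x)])%E.
Proof.
move=> r0 mA.
have mA' : measurable [set x | A (r *: x)].
  have := @measurable_rV_scale R n r 0 measurableT A mA; rewrite setTI.
  by rewrite (_ : _ @^-1` _ = [set x | A (r *: x)])//; apply/seteqP; split => x; rewrite /= addr0.
rewrite -!integral_indicT// (integral_rV_affine 0 r0)//.
- by congr (_ * _)%E; apply: eq_integral => x _; rewrite addr0.
- by apply/measurable_EFinP; exact: measurable_indic.
Qed.

Lemma oball_scale r : 0 < r -> (mu (oball r) = (r ^+ n)%:E * mu (unit_ball R n))%E.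
Proof.
move=> r0; rewrite (lebesgue_rV_scale r0 (measurable_oball r)); congr (_ * mu _)%E.
by apply/seteqP; split => x; rewrite /oball/unit_ball/= enormZ ?ltW// gtr_pMr.
Qed.

Lemma oball1 : oball 1 = unit_ball R n. Proof. by []. Qed.

(** On the unit ball every coordinate is at most 1 in modulus, so the indicator is below e^n times
    the integrable weight [expw_rV 1]. *)
Lemma unit_ball_lty : (mu (unit_ball R n) < +oo)%E.
Proof.
rewrite -oball1 -integral_indicT; last exact: measurable_oball.
have iW := integrable_expw_rV n (@ltr01 R).
have mW := @measurable_expw_rV R n 1.
apply: (@le_lt_trans _ _ (\int[mu]_x ((expR 1 ^+ n)%:E * (expw_rV 1 x)%:E))%E).
  apply: ge0_le_integral => //.
  - by apply/measurable_EFinP; apply: measurable_indic; exact: measurable_oball.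
  - by apply: measurable_funeM; exact/measurable_EFinP.
  - move=> x _; rewrite indicE; case: (boolP (x \in _)) => [|_]; last first.
      by rewrite -EFinM lee_fin mulr_ge0// ?exprn_ge0 ?expR_ge0// expw_rV_ge0.
    rewrite inE /oball/= => x1; rewrite -EFinM lee_fin.
    rewrite -[n in _ ^+ n]card_ord -prodr_const -big_split/=.
    rewrite -[leLHS](_ : \prod_(i in 'I_n) 1 = 1); last by rewrite big1.
    apply: ler_prod => i _; rewrite ler01/= /expw mul1r -expRD -[leLHS]expR0 ler_expR subr_ge0.
    by rewrite (le_trans (coord_le_enorm x i))// ltW.
rewrite integralZl// ltey_eq fin_numM//; exact: integrable_fin_num.
Qed.

Lemma unit_ball_fin_num : mu (unit_ball R n) \is a fin_num.
Proof. by rewrite ge0_fin_numE// unit_ball_lty. Qed.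

Definition vball : R := fine (mu (unit_ball R n)).

Lemma vballE : mu (unit_ball R n) = vball%:E.
Proof. by rewrite /vball fineK// unit_ball_fin_num. Qed.

Lemma vball_ge0 : 0 <= vball. Proof. exact: fine_ge0. Qed.

Lemma oballE r : 0 < r -> mu (oball r) = (r ^+ n * vball)%:E.
Proof. by move=> r0; rewrite oball_scale// vballE. Qed.

Hypothesis n0 : (0 < n)%N.

Lemma measurable_origin : measurable [set (0 : E)].
Proof.
rewrite (_ : [set _] = enorm @^-1` [set 0]).
  rewrite -[X in measurable X]setTI; apply: measurable_enorm => //; exact: measurable_set1.
by apply/seteqP; split => x /=; [move=> ->; exact: enorm0|exact: enorm_eq0].
Qed.

(** The origin is fixed by the dilation by 2, so its mass m, finite because the unit ball has finite
    measure, satisfies m = 2^n m. In dimension 0 the measure is a Dirac mass, hence [n0]. *)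
Lemma lebesgue_rV_origin : mu [set (0 : E)] = 0%E.
Proof.
have f : mu [set (0 : E)] \is a fin_num.
  rewrite ge0_fin_numE//; apply: le_lt_trans unit_ball_lty.
  apply: le_measure; rewrite ?inE; [exact: measurable_origin|exact: measurable_oball|].
  by move=> x ->; rewrite /unit_ball/= enorm0.
have := lebesgue_rV_scale (@ltr0n R 2) measurable_origin.
rewrite (_ : [set x | _] = [set 0]); last first.
  by apply/seteqP; split => x /= => [/eqP|->]; rewrite ?scaler0// scaler_eq0 pnatr_eq0/= => /eqP.
rewrite -(fineK f) -EFinM => -[] h; congr EFin.
have h2 : 1 < (2 : R) ^+ n by rewrite exprn_egt1// ?ltr1n// -lt0n.
apply/eqP; rewrite -(mulrI_eq0 _ (lregP _ : GRing.lreg ((2 : R) ^+ n - 1))).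
  by rewrite mulrBl mul1r -h subrr.
by rewrite subr_eq0 gt_eqF.
Qed.

Lemma integral0y_expN : (\int[leb]_(t in `[0%R, +oo[) (expR (- (n%:R * t)))%:E = (n%:R^-1)%:E)%E.
Proof.
have n0' : 0 < n%:R :> R by rewrite ltr0n.
(* At frequency 0 the factor [1 + cos] is the constant 2, which is divided out below. *)
have := integral0y_expcos 0 n0'.
under eq_integral => t _ do rewrite mul0r cos0 mulrC EFinM.
rewrite ge0_integralZl//=; last first.
  apply/measurable_EFinP; apply: measurable_funTS.
  apply: (@measurableT_comp _ _ _ _ _ _ (@expR R)) => //.
  by apply: measurable_funN; exact: measurable_funM.
rewrite -[(1 + 1)%R]/(2%:R) => /(congr1 (fun x => 2^-1%:E * x)%E).
rewrite muleA -EFinM mulVf// mul1e => ->; rewrite -EFinM; congr EFin.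
by rewrite expr0n/= addr0; field; rewrite gt_eqF.
Qed.

(* Layer cake: for [xi != 0], [ln (r / |xi|)] is the length of the set of the
   [t >= 0] with [|xi| < r e^-t]. *)
Lemma integral_ln_ball r : 0 < r ->
  (\int[mu]_x (\1_(oball r) x * (ln r - ln (enorm x)))%:E = (r ^+ n * vball / n%:R)%:E)%E.
Proof.
move=> r0.
pose G : set (E * measurableTypeR R) := [set p | 0 <= p.2 /\ enorm p.1 < r * expR (- p.2)].
have mG : measurable G.
  rewrite (_ : G = (snd @^-1` `[0, +oo[%classic) `&`
    ((fun p => enorm p.1 < r * expR (- p.2)) @^-1` [set true])); last first.
    by apply/seteqP; split => p; rewrite /G/= in_itv/= andbT.
  apply: measurableI.
    by rewrite -[X in measurable X]setTI; apply: measurable_snd.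
  rewrite -[X in measurable X]setTI; apply: measurable_fun_ltr => //.
    by apply: measurableT_comp => //; exact: measurable_enorm.
  apply: measurable_funM => //.
  apply: (@measurableT_comp _ _ _ _ _ _ (@expR R)) => //; exact: measurable_funN.
pose g p : \bar R := (\1_G p)%:E.
have mg : measurable_fun setT g by apply/measurable_EFinP; exact: measurable_indic.
have g0 p : (0 <= g p)%E by rewrite lee_fin.
have oballP x t : 0 < enorm x -> (enorm x < r * expR (- t)) = (t < ln r - ln (enorm x)).
  move=> x0; rewrite -[r in LHS]lnK ?posrE// -expRD -[enorm x in LHS]lnK ?posrE//.
  by rewrite ltr_expR ltrBrDl -ltrBrDr addrC.
transitivity (\int[mu]_x \int[leb]_t g (x, t))%E.
  (* The layer-cake identity fails only at the origin, where [ln 0 = 0] by convention while the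
     section of [G] is a half line of infinite length. *)
  apply: ae_eq_integral => //.
  - apply/measurable_EFinP; apply: measurable_funM.
      by apply: measurable_indic; exact: measurable_oball.
    apply: measurable_funB => //; apply: (@measurableT_comp _ _ _ _ _ _ (@ln R)).
      exact: measurable_ln.
    exact: measurable_enorm.
  - exact: (measurable_fun_fubini_tonelli_F g).
  - exists [set 0]; split; [exact: measurable_origin|exact: lebesgue_rV_origin|].
    move=> x /= /not_implyP[_ nx]; apply: contrapT => x0; apply: nx.
    have {}x0 : 0 < enorm x.
      by rewrite lt_neqAle enorm_ge0 andbT eq_sym; apply/eqP => /enorm_eq0.
    transitivity (leb `[0, ln r - ln (enorm x)[%classic).
      rewrite lebesgue_measure_itv/= lte_fin sube0 indicE.
      have -> : (x \in oball r) = (0 < ln r - ln (enorm x)).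
        by rewrite -oballP// oppr0 expR0 mulr1; apply/idP/idP; rewrite inE.
      by case: ifPn; rewrite ?mul1r ?mul0r.
    rewrite -[LHS]mul1e -integral_cst// [LHS]integral_mkcond.
    apply: eq_integral => t _; rewrite patchE /g indicE.
    have -> : (t \in `[0, ln r - ln (enorm x)[%classic) = ((x, t) \in G).
      apply/idP/idP; rewrite !inE /G/= in_itv/= oballP//; first by move=> /andP[].
      by move=> [-> ->].
    by case: ifPn.
rewrite (fubini_tonelli g)//.
transitivity (\int[leb]_(t in `[0%R, +oo[) ((r ^+ n * vball)%:E * (expR (- (n%:R * t)))%:E))%E.
  rewrite [RHS]integral_mkcond; apply: eq_integral => t _; rewrite patchE.
  have -> : (t \in `[0%R, +oo[%classic) = (0 <= t).
    by apply/idP/idP; rewrite inE/= in_itv/= andbT.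
  case: ifPn => t0.
    have rt : 0 < r * expR (- t) by rewrite mulr_gt0// expR_gt0.
    transitivity (mu (oball (r * expR (- t)))).
      rewrite -integral_indicT; last exact: measurable_oball.
      apply: eq_integral => x _; rewrite /g !indicE; congr ((nat_of_bool _)%:R%:E).
      by apply/idP/idP; rewrite !inE /G/oball/= ?t0//; case.
    rewrite oballE// -EFinM; congr EFin; rewrite exprMn -expRM_natl; rewrite mulrN; ring.
  transitivity (\int[mu]_(x in setT) (0 : \bar R))%E; last by rewrite integral0.
  apply: eq_integral => x _; rewrite /g indicE.
  by rewrite memNset// /G/= (negbTE t0) => -[].
rewrite ge0_integralZl//; last 2 first.
- apply/measurable_EFinP; apply: measurable_funTS.
  apply: (@measurableT_comp _ _ _ _ _ _ (@expR R)) => //.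
  by apply: measurable_funN; exact: measurable_funM.
- by rewrite lee_fin mulr_ge0 ?exprn_ge0// ?vball_ge0// ltW.
by rewrite integral0y_expN -EFinM.
Qed.

End ball.

Arguments vball R n : clear implicits.

(** * Test functions lie in the form domain *)

Section lipschitz.
Context {R : realType} {V : normedModType R}.
Implicit Types (v : V -> R) (K : set V).

Lemma compact_supp_bounded v K : continuous v -> compact K ->
  (forall x, ~ K x -> v x = 0) -> exists2 M, 0 <= M & forall x, `|v x| <= M.
Proof.
move=> cv cK v0.
have /compact_bounded [M [Mr hM]] : compact (v @` K).
  by apply: continuous_compact => //; exact: continuous_subspaceT.
exists (`|M| + 1) => [|x]; first by rewrite addr_ge0.
have [Kx|/v0 ->] := pselect (K x); last by rewrite normr0 addr_ge0.
by apply: (hM (`|M| + 1)); [rewrite (le_lt_trans (ler_norm _))// ltrDl|exists x].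
Qed.

Lemma derive_out_supp v K e x : closed K -> (forall x, ~ K x -> v x = 0) ->
  ~ K x -> 'D_e v x = 0.
Proof.
move=> cK v0 Kx; rewrite /derive; apply: cvg_lim => //.
have oK : open (~` K) by exact: closed_openC.
have h0 : \forall h \near (0 : R)^', (~` K) (h *: e + x).
  have : (h *: e + x) @[h --> (0 : R)] --> 0 *: e + x.
    by apply: cvgD; [apply: cvgZ; [exact: cvg_id|exact: cvg_cst]|exact: cvg_cst].
  rewrite scale0r add0r => /(_ (~` K)) /= h; apply: nbhs_dnbhs; apply: h.
  exact: open_nbhs_nbhs.
apply: cvg_near_cst; apply: filterS h0 => h /v0 hx.
by rewrite /= hx (v0 _ Kx) subrr scaler0.
Qed.

Lemma is_derive_line v e x (t : R) : derivable v (t *: e + x) e ->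
  is_derive t (1 : R) (fun s : R => v (s *: e + x)) ('D_e v (t *: e + x)).
Proof.
move=> dv.
have E : (fun h => h^-1 *: (((fun s : R => v (s *: e + x)) \o shift t) (h *: (1 : R)) -
    v (t *: e + x))) =
  (fun h => h^-1 *: ((v \o shift (t *: e + x)) (h *: e) - v (t *: e + x))).
  apply/funext => h /=; congr (_ *: (v _ - _)).
  by rewrite [h%:A]mulr1 scalerDl addrA.
by split; rewrite /derivable /derive E.
Qed.

Lemma lipschitz_line v e M : (forall x, derivable v x e) ->
  (forall x, `|'D_e v x| <= M) -> forall x (h : R), 0 < h ->
  `|v (x + h *: e) - v x| <= M * h.
Proof.
move=> dv vM x h h0.
pose f (s : R) := v (s *: e + x).
have df (t : R) : is_derive t (1 : R) f ('D_e v (t *: e + x)) by exact: is_derive_line.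
have [c _] := @MVT R f _ 0 h h0 (fun t _ => df t)
  (continuous_subspaceT (fun t => differentiable_continuous
    (proj1 (derivable1_diffP _ _) (@ex_derive _ _ _ _ _ _ _ (df t))))).
rewrite /f scale0r add0r subr0 [h *: e + x]addrC => ->.
by rewrite normrM (gtr0_norm h0) ler_wpM2r// ltW.
Qed.

End lipschitz.

Section shift.
Context {R : realType} {n : nat}.
Local Open Scope complex_scope.
Local Notation mu := (lebesgue_rV (R := R) n).
Local Notation E := 'rV[R]_n.
Local Notation Re := complex.Re.
Local Notation Im := complex.Im.
Local Notation normc := Normc.normc.
Implicit Types (f g phi psi : E -> R[i]) (c : R[i]) (xi : E).

Lemma measurable_shift d (T : measurableType d) (b : E) (f : E -> T) :
  measurable_fun setT f -> measurable_fun setT (fun x : E => f (x + b)).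
Proof.
move=> mf; apply: (@measurableT_comp _ _ _ _ _ _ f) => //.
rewrite (_ : (fun _ => _) = fun x => 1 *: x + b); first exact: measurable_rV_scale.
by apply/funext => x; rewrite scale1r.
Qed.

Lemma integral_rV_shift_fun (b : E) (f : E -> \bar R) : measurable_fun setT f ->
  (\int[mu]_x f (x + b)%R = \int[mu]_x f x)%E.
Proof.
move=> mf; rewrite [LHS]integralE [RHS]integralE; congr (_ - _)%E.
  rewrite -(integral_rV_shift b (f := f^\+%E))//; last exact: measurable_funepos.
  apply: eq_integral => x _.
  by rewrite (_ : (fun x0 => _) = f \o (fun y => y + b))// funepos_comp.
rewrite -(integral_rV_shift b (f := f^\-%E))//; last exact: measurable_funeneg.
apply: eq_integral => x _.
by rewrite (_ : (fun x0 => _) = f \o (fun y => y + b))// funeneg_comp.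
Qed.

Lemma integrable_shift (b : E) (f : E -> \bar R) : mu.-integrable setT f ->
  mu.-integrable setT (fun x => f (x + b)).
Proof.
move=> /integrableP[mf fi]; apply/integrableP; split; first exact: measurable_shift.
rewrite (integral_rV_shift b (f := fun x => `|f x|%E))//.
exact: measurableT_comp.
Qed.

Lemma Cintegrable_shift b f : Cintegrable f -> Cintegrable (fun x => f (x + b)).
Proof. by move=> [f1 f2]; split; [exact: (integrable_shift b f1)|exact: (integrable_shift b f2)]. Qed.

Lemma Cintegral_shift b f : Cmeasurable f ->
  Cintegral setT (fun x => f (x + b)) = Cintegral setT f.
Proof.
move=> [m1 m2]; apply: eq_complexP; rewrite /Cintegral/= /Rintegral.
  by rewrite (integral_rV_shift_fun b (f := fun x => (Re (f x))%:E))//; exact/measurable_EFinP.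
by rewrite (integral_rV_shift_fun b (f := fun x => (Im (f x))%:E))//; exact/measurable_EFinP.
Qed.

Lemma Cintegral0 (D : set E) : Cintegral D (fun=> 0 : R[i]) = 0 :> R[i].
Proof. by apply: eq_complexP; rewrite /Cintegral/= /Rintegral integral0. Qed.

Lemma Cintegrable0 : Cintegrable (fun _ : E => 0 : R[i]).
Proof. by split; exact: integrable0. Qed.

Lemma CintegralZ c f : Cintegrable f ->
  Cintegral setT (fun x => c * f x) = c * Cintegral setT f.
Proof.
move=> fi; rewrite (@eq_Cintegral _ _ _ _ (fun x => 0 - (- c) * f x)); last first.
  by move=> x; rewrite mulNr sub0r opprK.
by rewrite Cintegral_subM//; [rewrite Cintegral0 mulNr sub0r opprK|exact: Cintegrable0].
Qed.

Lemma expiD (s t : R) : expi (s + t) = expi s * expi t.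
Proof. by apply: eq_complexP; rewrite !compE/= ?cosD ?sinD; ring. Qed.

Lemma expi0 : expi (0 : R) = 1.
Proof. by rewrite /expi cos0 sin0. Qed.

Lemma normc_expi (t : R) : normc (expi t) = 1.
Proof. by rewrite /= cos2Dsin2 sqrtr1. Qed.

Lemma fourier_shift b phi xi : Cintegrable phi ->
  fourier (fun x => phi (x + b)) xi = expi (dotp b xi) * fourier phi xi.
Proof.
move=> ip; rewrite /fourier -CintegralZ; last exact: Cintegrable_expiM.
rewrite -(Cintegral_shift b (f := fun x => expi (dotp b xi) * (expi (- dotp x xi) * phi x))).
  apply: eq_Cintegral => x; rewrite mulrA -expiD; congr (expi _ * _).
  by rewrite dotpDl opprD addrCA subrr addr0.
apply: CmeasurableM; first by split; exact: measurable_cst.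
by apply: CmeasurableP; exact: Cintegrable_expiM.
Qed.

Lemma fourier_mod b phi xi :
  fourier (fun x => expi (dotp x b) * phi x) xi = fourier phi (xi - b).
Proof.
apply: eq_Cintegral => x; rewrite mulrA -expiD; congr (expi _ * _).
by rewrite !(dotpC x) dotpBl opprB addrC.
Qed.

Lemma normc_expi_sub1 (t : R) : normc (expi t - 1) ^+ 2 = (2 * sin (t / 2)) ^+ 2.
Proof.
rewrite normc_sq !compE/= subr0 (_ : t = (t / 2) *+ 2); last by rewrite -mulr_natr; field.
rewrite cos_mulr2n sin_mulr2n; have := cos2Dsin2 (t / 2).
rewrite (_ : t / 2 *+ 2 / 2 = t / 2); last by rewrite -mulr_natr; field.
move: (cos (t / 2)) (sin (t / 2)) => c s h.
rewrite [LHS](_ : _ = 4 * (c ^+ 2 - 1) ^+ 2 + 4 * c ^+ 2 * s ^+ 2); last by ring.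
by rewrite (_ : c ^+ 2 = 1 - s ^+ 2); [ring|rewrite -h addrK].
Qed.

End shift.

Section Cc_infty_star.
Context {R : realType} {n : nat}.
Local Open Scope complex_scope.
Local Notation mu := (lebesgue_rV (R := R) n).
Local Notation E := 'rV[R]_n.
Local Notation Re := complex.Re.
Local Notation Im := complex.Im.
Local Notation normc := Normc.normc.
Implicit Types (f g phi psi : E -> R[i]) (c : R[i]) (xi : E).
Variables (Omega : set E) (mOmega : measurable Omega) (finOmega : (mu Omega < +oo)%E).

Lemma integrable_indic_fin (A : set E) : measurable A -> (mu A < +oo)%E ->
  mu.-integrable setT (fun x => (\1_A x)%:E).
Proof.
move=> mA fA; apply/integrableP; split; first by apply/measurable_EFinP; exact: measurable_indic.
under eq_integral => x _ do rewrite /= ger0_norm//.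
by rewrite integral_indicT.
Qed.

Lemma L2_sqint phi : L2 Omega phi -> mu.-integrable setT (fun x => (normc (phi x) ^+ 2)%:E).
Proof.
move=> [m _ f]; apply/integrableP; split; first exact: measurable_enormc_sq.
by under eq_integral => x _ do rewrite /= ger0_norm ?sqr_ge0//.
Qed.

(** Finite measure enters here: [|s| <= 1 + s ^+ 2] on Omega and [phi] vanishes elsewhere, so the
    indicator of Omega plus |phi|^2 dominates. *)
Lemma L2_Cintegrable phi : L2 Omega phi -> Cintegrable phi.
Proof.
move=> h; have [m z f] := h.
have bd (x : E) (s : R) : s ^+ 2 <= normc (phi x) ^+ 2 -> (~ Omega x -> s = 0) ->
    `|s| <= \1_Omega x + normc (phi x) ^+ 2.
  move=> s2 s0; rewrite indicE; case: (boolP (x \in Omega)) => [_|].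
    rewrite -real_normK ?num_real// in s2; apply: le_trans (lerD (lexx _) s2).
    rewrite -[true%:R]/(1 : R).
    by have := sqr_ge0 (`|s| - 1); have := normr_ge0 s; nra.
  rewrite -[false%:R]/(0 : R).
  by move=> /negP; rewrite inE => /s0 ->; rewrite normr0 add0r sqr_ge0.
apply: (@Cintegrable_bound _ _ _ (fun x => \1_Omega x + normc (phi x) ^+ 2)) => //.
- exact: (integrableD _ (integrable_indic_fin mOmega finOmega) (L2_sqint h)).
- move=> x; apply: bd; first by rewrite normc_sq lerDl sqr_ge0.
  by move=> /z ->.
- move=> x; apply: bd; first by rewrite normc_sq lerDr sqr_ge0.
  by move=> /z ->.
Qed.

Lemma Cc_infty_out phi x : Cc_infty Omega phi -> ~ Defs.support phi x -> phi x = 0.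
Proof.
move=> [_ _ _ _] sx; apply/eqP; apply: contrapT => /negP px.
by apply: sx; exact: (@subset_closure _ [set x | phi x != 0] x px).
Qed.

Lemma Cc_infty_bounded phi : Cc_infty Omega phi ->
  exists2 M, 0 <= M & forall x, normc (phi x) ^+ 2 <= M.
Proof.
move=> h; have [s1 s2 cS SO] := h.
have [c1 _] := s1 [::]; have [c2 _] := s2 [::].
have [M1 M10 h1] := compact_supp_bounded c1 cS (fun x sx => congr1 (@complex.Re R) (Cc_infty_out h sx)).
have [M2 M20 h2] := compact_supp_bounded c2 cS (fun x sx => congr1 (@complex.Im R) (Cc_infty_out h sx)).
exists (M1 ^+ 2 + M2 ^+ 2) => [|x]; first by rewrite addr_ge0// sqr_ge0.
by rewrite normc_sq lerD// -real_normK ?num_real// ler_sqr ?nnegrE//; [exact: h1|exact: h2].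
Qed.

Lemma Cc_infty_L2 phi : Cc_infty Omega phi -> L2 Omega phi.
Proof.
move=> h; have [s1 s2 cS SO] := h.
have [c1 _] := s1 [::]; have [c2 _] := s2 [::].
have m : Cmeasurable phi by split; exact: continuous_rV_measurable.
have z x : ~ Omega x -> phi x = 0.
  by move=> Ox; apply: (Cc_infty_out h) => sx; exact/Ox/SO.
split => //.
have [M M0 hM] := Cc_infty_bounded h.
apply: (@le_lt_trans _ _ (\int[mu]_x (M%:E * (\1_Omega x)%:E))%E).
  apply: ge0_le_integral => //.
  - by move=> x _; rewrite lee_fin sqr_ge0.
  - exact: measurable_enormc_sq.
  - by apply: measurable_funeM; apply/measurable_EFinP; exact: measurable_indic.
  - move=> x _; rewrite -EFinM lee_fin indicE; case: (boolP (x \in Omega)) => [_|].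
      by rewrite mulr1.
    by move=> /negP; rewrite inE => /z ->; rewrite Normc.normc0 expr0n mulr0.
rewrite ge0_integralZl//; last first.
  by apply/measurable_EFinP; exact: measurable_indic.
by rewrite integral_indicT// lte_mul_pinfty.
Qed.

(** These are the squared moduli of (exp(i h a) - 1) / h along h = 1 / (k + 1); the limit comes from
    the derivative of 2 sin(h a / 2) at h = 0. *)
Lemma sqr_diff_quotient (a : R) :
  ((2 * sin (k.+1%:R^-1 * a / 2)) / k.+1%:R^-1) ^+ 2 @[k --> \oo] --> a ^+ 2.
Proof.
apply: (@cvg_comp _ _ _ (fun k : nat => k.+1%:R^-1 : R)
  (fun h => (2 * sin (h * a / 2) / h) ^+ 2) _ ((0 : R)^')).
  move=> A; rewrite /dnbhs /within /= => hA.
  have h : \forall k \near \oo, (k.+1%:R^-1 : R) != 0 -> A k.+1%:R^-1 := @cvg_harmonic R _ hA.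
  by apply: filterS h => k; apply; rewrite gt_eqF// invr_gt0.
have d0 : is_derive (0 : R) 1 (fun h => 2 * sin (h * a / 2)) a.
  by apply: is_derive_eq; rewrite /GRing.scale/= mul0r mul0r cos0; field.
have /derivableP := @ex_derive _ _ _ _ _ _ _ d0.
rewrite (@derive_val _ _ _ _ _ _ _ d0) => -[+ dv].
rewrite /derivable /= => cv.
have : (fun h => h^-1 *: (((fun h => 2 * sin (h * a / 2)) \o shift 0) (h *: (1 : R)) -
    2 * sin (0 * a / 2))) @ 0^' --> a.
  by rewrite -[X in _ --> X]dv; exact: cv.
move=> hc.
have E0 (h : R) : h^-1 *: (((fun h => 2 * sin (h * a / 2)) \o shift 0) (h *: (1 : R)) -
    2 * sin (0 * a / 2)) = 2 * sin (h * a / 2) / h.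
  by rewrite /= !mul0r sin0 mulr0 subr0 addr0 [h%:A]mulr1 /GRing.scale/= mulrC.
have hq : 2 * sin (h * a / 2) / h @[h --> (0 : R)^'] --> a.
  by under eq_fun do rewrite -E0.
exact: (cvgM hq hq).
Qed.

Lemma dotp_delta (i : 'I_n) (h : R) xi : dotp (h *: delta_mx 0 i) xi = h * xi 0 i.
Proof.
rewrite dotpZl /dotp (bigD1 i)//= mxE !eqxx mul1r big1 ?addr0// => j ji.
by rewrite mxE (negbTE ji) andbF mul0r.
Qed.

(** A derivative estimate through difference quotients. The transform of [phi (x + s e) - phi x] is
    [expi (s * xi 0 i) - 1] times that of [phi], and [bessel] bounds it by the L^2 norm of the
    difference. By the mean value theorem that difference is O(s), and it lives on Omega and one
    translate of Omega. After division by s^2 the bound [C] is free of s, and Fatou applies as s ->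
    0. *)
Lemma Cc_infty_coord phi (i : 'I_n) : Cc_infty Omega phi ->
  (\int[mu]_xi ((xi 0 i) ^+ 2 * normc (fourier phi xi) ^+ 2)%:E < +oo)%E.
Proof.
move=> h; have [s1 s2 cS SO] := h.
have [_ d1] := s1 [::]; have [_ d2] := s2 [::].
have [c1 _] := s1 [:: i]; have [c2 _] := s2 [:: i].
have clS : closed (Defs.support phi) by exact: closed_closure.
set e : E := delta_mx 0 i.
have [M1 M10 h1] := compact_supp_bounded c1 cS (fun x sx =>
  derive_out_supp e clS (fun x sx => congr1 (@complex.Re R) (Cc_infty_out h sx)) sx).
have [M2 M20 h2] := compact_supp_bounded c2 cS (fun x sx =>
  derive_out_supp e clS (fun x sx => congr1 (@complex.Im R) (Cc_infty_out h sx)) sx).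
have l1 := lipschitz_line (fun x => d1 i x) h1.
have l2 := lipschitz_line (fun x => d2 i x) h2.
pose M := M1 ^+ 2 + M2 ^+ 2.
have M0 : 0 <= M by rewrite addr_ge0// sqr_ge0.
have L2phi := Cc_infty_L2 h; have ip := L2_Cintegrable L2phi.
have mphi := CmeasurableP ip; have [_ z _] := L2phi.
pose s k : R := k.+1%:R^-1.
have s0 k : 0 < s k by rewrite invr_gt0.
pose C := (((2 * pi) ^+ n)%:E * (M%:E * (mu Omega + mu Omega)))%E.
apply: (@le_lt_trans _ _ C); last first.
  by rewrite /C -(fineK (_ : mu Omega \is a fin_num)) ?ge0_fin_numE// -EFinD -!EFinM ltry.
have mf := measurable_fourier mphi; have mfs := measurable_normc_sq mf.
apply: (@fatou_le _ _ _ mu (fun k xi => (((2 * sin (s k * xi 0 i / 2)) / s k) ^+ 2 *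
   normc (fourier phi xi) ^+ 2)%:E)).
- move=> k; apply/measurable_EFinP; apply: measurable_funM => //.
  apply: measurable_funX; apply: measurable_funM => //; apply: measurable_funM => //.
  apply: (@measurableT_comp _ _ _ _ _ _ (@sin R)); first exact: measurable_sin.
  apply: measurable_funM => //; apply: measurable_funM => //; exact: measurable_rV_coord.
- by move=> k x; rewrite lee_fin mulr_ge0// sqr_ge0.
- move=> x; apply: cvg_EFin; first exact: nearW.
  by apply: cvgM; [exact: sqr_diff_quotient|exact: cvg_cst].
move=> k.
(* The factor 1 puts the difference in the shape that [fourier_subM] expects. *)
pose dphi x := phi (x + s k *: e) - 1 * phi x.
have idphi : Cintegrable dphi.
  have := Cintegrable_shift (s k *: e) ip => -[i1 i2]; have [j1 j2] := ip.
  split.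
    apply: eq_integrable (integrableB _ i1 j1) => // x _.
    by rewrite /dphi mul1r compE EFinB.
  apply: eq_integrable (integrableB _ i2 j2) => // x _.
  by rewrite /dphi mul1r compE EFinB.
have fd xi : fourier dphi xi = (expi (s k * xi 0 i) - 1) * fourier phi xi.
  rewrite /dphi fourier_subM//; last exact: Cintegrable_shift.
  by rewrite fourier_shift// dotp_delta mulrBl.
have hb : (\int[mu]_xi ((2 * sin (s k * xi 0 i / 2)) ^+ 2 *
    normc (fourier phi xi) ^+ 2)%:E <= ((2 * pi) ^+ n)%:E * sqnorm setT dphi)%E.
  apply: le_trans (bessel idphi); rewrite le_eqVlt; apply/orP; left; apply/eqP.
  by apply: eq_integral => xi _; rewrite fd Normc.normcM [in RHS]exprMn normc_expi_sub1.
have sk2 : 0 < (s k)^-1 ^+ 2 by rewrite exprn_gt0// invr_gt0.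
have hd x : normc (dphi x) ^+ 2 <= (s k) ^+ 2 * M * (\1_Omega x + \1_Omega (x + s k *: e)).
  have [Ox|Ox] := pselect (Omega x \/ Omega (x + s k *: e)); last first.
    rewrite /dphi !z ?mulr0 ?subr0 ?Normc.normc0 ?expr0n/=.
    - by apply: mulr_ge0; [apply: mulr_ge0 => //; exact: sqr_ge0|apply: addr_ge0].
    - by move=> ?; apply: Ox; left.
    - by move=> ?; apply: Ox; right.
  apply: (@le_trans _ _ (s k ^+ 2 * M)).
    rewrite /dphi mul1r normc_sq !compE /M mulrDr lerD// -real_normK ?num_real//.
      by rewrite -exprMn ler_sqr ?nnegrE// ?mulr_ge0// ?(ltW (s0 k))// mulrC l1.
    by rewrite -exprMn ler_sqr ?nnegrE// ?mulr_ge0// ?(ltW (s0 k))// mulrC l2.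
  apply: ler_peMr; first by apply: mulr_ge0 => //; exact: sqr_ge0.
  rewrite !indicE.
  by case: Ox => Ox; rewrite (mem_set Ox)/= ?lerDl ?lerDr.
have mO : measurable_fun setT (fun x => (\1_Omega x)%:E : \bar R).
  by apply/measurable_EFinP; exact: measurable_indic.
have hs : (sqnorm setT dphi <= (s k ^+ 2 * M)%:E * (mu Omega + mu Omega))%E.
  apply: (@le_trans _ _ (\int[mu]_x ((s k ^+ 2 * M)%:E *
     ((\1_Omega x)%:E + (\1_Omega (x + s k *: e))%:E)))%E).
    apply: ge0_le_integral => //.
    - by move=> x _; rewrite lee_fin sqr_ge0.
    - by apply: measurable_enormc_sq; exact: CmeasurableP.
    - apply: measurable_funeM; apply: emeasurable_funD => //.
      exact: (measurable_shift (s k *: e) mO).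
    - by move=> x _; rewrite -EFinD -EFinM lee_fin.
  rewrite ge0_integralZl//; last 3 first.
  - apply: emeasurable_funD => //; exact: (measurable_shift (s k *: e) mO).
  - by move=> x _; rewrite -EFinD lee_fin addr_ge0.
  - by rewrite lee_fin mulr_ge0// sqr_ge0.
  rewrite ge0_integralD//; last exact: (measurable_shift (s k *: e) mO).
  rewrite (integral_rV_shift (s k *: e) (f := fun x => (\1_Omega x)%:E))//.
  by rewrite integral_indicT.
rewrite (eq_integral (fun xi : E => ((s k)^-1 ^+ 2)%:E *
   ((2 * sin (s k * xi 0 i / 2)) ^+ 2 * normc (fourier phi xi) ^+ 2)%:E)%E); last first.
  by move=> xi _; rewrite -EFinM; congr EFin; rewrite !exprMn; ring.
rewrite ge0_integralZl//; last 3 first.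
- apply/measurable_EFinP; apply: measurable_funM => //.
  apply: measurable_funX; apply: measurable_funM => //.
  apply: (@measurableT_comp _ _ _ _ _ _ (@sin R)); first exact: measurable_sin.
  apply: measurable_funM => //; apply: measurable_funM => //; exact: measurable_rV_coord.
- by move=> x _; rewrite lee_fin mulr_ge0// sqr_ge0.
- by rewrite lee_fin ltW.
apply: (@le_trans _ _ (((s k)^-1 ^+ 2)%:E * (((2 * pi) ^+ n)%:E *
   ((s k ^+ 2 * M)%:E * (mu Omega + mu Omega))))%E).
  rewrite lee_pmul2l//; apply: (le_trans hb); rewrite lee_pmul2l//.
  by rewrite lte_fin exprn_gt0// mulr_gt0// pi_gt0.
rewrite /C !muleA -!EFinM; rewrite (_ : _ * _ * _ = (2 * pi) ^+ n * M)//.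
have := s0 k; rewrite lt0r => /andP[sk _]; field; exact: sk.
Qed.

Lemma Cc_infty_fourier_weight phi : Cc_infty Omega phi ->
  (\int[mu]_xi ((1 + enorm xi ^+ 2) * normc (fourier phi xi) ^+ 2)%:E < +oo)%E.
Proof.
move=> h; have L2phi := Cc_infty_L2 h; have ip := L2_Cintegrable L2phi.
have mf := measurable_fourier (CmeasurableP ip); have mfs := measurable_normc_sq mf.
rewrite (_ : (fun xi => _) = fun xi => ((normc (fourier phi xi) ^+ 2)%:E +
    \sum_(i < n) ((xi 0 i) ^+ 2 * normc (fourier phi xi) ^+ 2)%:E)%E); last first.
  apply/funext => xi; rewrite sumEFin -EFinD -mulr_suml enorm_sq mulrDl mul1r.
  by congr (_ + _ * _)%:E; apply: eq_bigr => i _; rewrite expr2.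
have mi i : measurable_fun setT (fun xi : E => ((xi 0 i) ^+ 2 * normc (fourier phi xi) ^+ 2)%:E).
  apply/measurable_EFinP; apply: measurable_funM => //; apply: measurable_funX.
  exact: measurable_rV_coord.
rewrite ge0_integralD//; last 4 first.
- by move=> x _; rewrite lee_fin sqr_ge0.
- exact/measurable_EFinP.
- by move=> x _; apply: sume_ge0 => i _; rewrite lee_fin mulr_ge0// sqr_ge0.
- exact: emeasurable_sum.
rewrite ge0_integral_sum//; last by move=> i x _; rewrite lee_fin mulr_ge0// sqr_ge0.
apply: lte_add_pinfty.
  apply: (le_lt_trans (bessel ip)); apply: lte_mul_pinfty => //.
    by rewrite lee_fin exprn_ge0// mulr_ge0// pi_ge0.
  by have [] := L2phi.
by apply: lte_sum_pinfty => i _; exact: Cc_infty_coord.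
Qed.

Lemma ln_e_enorm xi : ln (expR 1 + enorm xi) <= (2 * expR 1) * (1 + enorm xi ^+ 2).
Proof.
have e1 : 1 <= expR (1 : R) by rewrite -[leLHS]expR0 ler_expR.
have e0 := enorm_ge0 xi.
apply: (@le_trans _ _ (expR 1 + enorm xi)).
  by rewrite ltW// ln_sublinear// ltr_pwDl// expR_gt0.
by have := sqr_ge0 (enorm xi - 1); nra.
Qed.

Lemma ln_e_enorm_ge1 xi : 1 <= ln (expR 1 + enorm xi).
Proof.
rewrite -[leLHS](@expRK R) ler_ln ?posrE ?expR_gt0 ?lerDl ?enorm_ge0//.
by rewrite ltr_pwDl ?expR_gt0// enorm_ge0.
Qed.

Lemma measurable_ln_e : measurable_fun setT (fun xi : E => ln (expR 1 + enorm xi)).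
Proof.
apply: (@measurableT_comp _ _ _ _ _ _ (@ln R)); first exact: measurable_ln.
by apply: measurable_funD => //; exact: measurable_enorm.
Qed.

Lemma Cc_infty_star phi : Cc_infty Omega phi -> (sqnorm_star phi < +oo)%E.
Proof.
move=> h; have L2phi := Cc_infty_L2 h; have ip := L2_Cintegrable L2phi.
have mf := measurable_fourier (CmeasurableP ip); have mfs := measurable_normc_sq mf.
have mw : measurable_fun setT (fun xi : E => ((1 + enorm xi ^+ 2) * normc (fourier phi xi) ^+ 2)%:E).
  apply/measurable_EFinP; apply: measurable_funM => //; apply: measurable_funD => //.
  by apply: measurable_funX; exact: measurable_enorm.
apply: (@le_lt_trans _ _ (\int[mu]_xi ((2 * expR 1)%:E * ((1 + enorm xi ^+ 2) * normc (fourier phi xi) ^+ 2)%:E))%E).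
  apply: ge0_le_integral => //.
  - move=> x _; rewrite lee_fin mulr_ge0 ?sqr_ge0// (le_trans _ (ln_e_enorm_ge1 x))//.
  - by apply/measurable_EFinP; apply: measurable_funM => //; exact: measurable_ln_e.
  - exact: measurable_funeM.
  - by move=> x _; rewrite -EFinM lee_fin [leRHS]mulrA ler_wpM2r ?sqr_ge0// ln_e_enorm.
rewrite ge0_integralZl//; last first.
  by move=> x _; rewrite lee_fin mulr_ge0 ?sqr_ge0// addr_ge0// sqr_ge0.
by rewrite lte_mul_pinfty ?lee_fin ?mulr_ge0 ?expR_ge0//; exact: Cc_infty_fourier_weight.
Qed.

(** Write [phi = u k - (u k - phi)] for a single [k] at finite distance: the first term is a test
    function, and the star norm of the second is that distance. *)
Lemma Hspace_star phi : Hspace Omega phi -> (sqnorm_star phi < +oo)%E.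
Proof.
move=> [L2phi [u uC uphi]].
have [k hk] : exists k, (sqnorm_star (fun x => u k x - phi x)%R < +oo)%E.
  have : \forall k \near \oo, (sqnorm_star (fun x => u k x - phi x)%R < 1)%E.
    apply: (uphi [set y | y < 1]%E); apply: open_nbhs_nbhs; split => /=; last by rewrite lte_fin.
    exact: open_ereal_lt_ereal.
  by move=> [k _ /(_ k (leqnn k)) hk]; exists k; rewrite (lt_trans hk)// ltry.
have Lu := Cc_infty_L2 (uC k); have su := Cc_infty_star (uC k).
have iu := L2_Cintegrable Lu; have ip := L2_Cintegrable L2phi.
set v := fun x => u k x - phi x in hk.
have iv : Cintegrable v.
  have [i1 i2] := iu; have [j1 j2] := ip; split.
    by apply: eq_integrable (integrableB _ i1 j1) => // x _; rewrite /v compE EFinB.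
  by apply: eq_integrable (integrableB _ i2 j2) => // x _; rewrite /v compE EFinB.
have fphi xi : fourier phi xi = fourier (u k) xi - 1 * fourier v xi.
  rewrite -fourier_subM//; congr fourier; apply/funext => x.
  by rewrite /v mul1r subKr.
have ms w : Cintegrable w -> measurable_fun setT
   (fun xi => (ln (expR 1 + enorm xi) * normc (fourier w xi) ^+ 2)%:E).
  move=> iw; apply/measurable_EFinP; apply: measurable_funM; first exact: measurable_ln_e.
  by apply: measurable_normc_sq; apply: measurable_fourier; exact: CmeasurableP.
have p0 w xi : (0 <= (ln (expR 1 + enorm xi) * normc (fourier w xi) ^+ 2)%:E)%E.
  by rewrite lee_fin mulr_ge0 ?sqr_ge0// (le_trans _ (ln_e_enorm_ge1 xi)).
apply: (@le_lt_trans _ _ (\int[mu]_xi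
  (2%:E * ((ln (expR 1 + enorm xi) * normc (fourier (u k) xi) ^+ 2)%:E +
   (ln (expR 1 + enorm xi) * normc (fourier v xi) ^+ 2)%:E)))%E).
  apply: ge0_le_integral => //.
  - exact: ms.
  - by apply: measurable_funeM; apply: emeasurable_funD; exact: ms.
  - move=> xi _; rewrite -EFinD -EFinM lee_fin -mulrDr [leRHS]mulrCA ler_wpM2l//.
      by rewrite (le_trans _ (ln_e_enorm_ge1 xi)).
    rewrite fphi (le_trans (normc_sq_subM _ _ _))// Normc.normc1 expr1n mulr1.
    by rewrite mulrDr.
rewrite ge0_integralZl//; last 2 first.
- by apply: emeasurable_funD; exact: ms.
- by move=> x _; rewrite adde_ge0.
rewrite ge0_integralD//; [|exact: ms..].
apply: lte_mul_pinfty; [by rewrite lee_fin|by []|].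
by apply: lte_add_pinfty; [exact: su|exact: hk].
Qed.

End Cc_infty_star.

(** * The logarithmic form and the variational bound *)

Section form_domain.
Context {R : realType} {n : nat}.
Local Open Scope complex_scope.
Local Notation mu := (lebesgue_rV (R := R) n).
Local Notation E := 'rV[R]_n.
Local Notation Re := complex.Re.
Local Notation Im := complex.Im.
Local Notation normc := Normc.normc.
Implicit Types (f g phi psi : E -> R[i]) (c : R[i]) (xi : E).
Variables (Omega : set E) (mOmega : measurable Omega) (finOmega : (mu Omega < +oo)%E).
Hypothesis n0 : (0 < n)%N.

Let V := fine (mu Omega).
Let V0 : 0 <= V. Proof. exact: fine_ge0. Qed.

(** Cauchy-Schwarz against the indicator of Omega, from the nonnegativity of the integral of
    [(r x - t * \1_Omega x) ^+ 2] for every real [t]. *)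
Lemma sqr_Rintegral_le (r : E -> R) : mu.-integrable setT (fun x => (r x)%:E) ->
  mu.-integrable setT (fun x => (r x ^+ 2)%:E) -> (forall x, ~ Omega x -> r x = 0) ->
  (\int[mu]_x r x) ^+ 2 <= V * \int[mu]_x (r x ^+ 2).
Proof.
move=> ir ir2 r0; set A := \int[mu]_x r x; set S := \int[mu]_x (r x ^+ 2).
have iO := integrable_indic_fin mOmega finOmega.
have h t : 0 <= S - 2 * t * A + t ^+ 2 * V.
  have <- : \int[mu]_x ((r x - t * \1_Omega x) ^+ 2) = S - 2 * t * A + t ^+ 2 * V.
    transitivity (\int[mu]_x (r x ^+ 2 - 2 * t * r x + t ^+ 2 * \1_Omega x)).
      apply: eq_Rintegral => x _; rewrite indicE; case: (boolP (x \in Omega)) => [_|].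
        by rewrite -[true%:R]/(1 : R); ring.
      by move=> /negP; rewrite inE => /r0 ->; rewrite -[false%:R]/(0 : R); ring.
    rewrite RintegralD//; last 2 first.
    - apply: (integrableB _ ir2 (integrableZl_EFin (2 * t) measurableT ir)) => //.
    - exact: integrableZl_EFin.
    rewrite RintegralB//; last exact: integrableZl_EFin.
    rewrite !RintegralZl//; congr (_ + _ * _).
    by rewrite /Rintegral integral_indicT.
  by apply: Rintegral_ge0 => x _; rewrite sqr_ge0.
have S0 : 0 <= S by apply: Rintegral_ge0 => x _; rewrite sqr_ge0.
have [V00|Vn] := eqVneq V 0.
  rewrite V00 mul0r; have [->|A0] := eqVneq A 0; first by rewrite expr0n.
  (* With [V = 0] the quadratic polynomial is affine in [t], and this [t] gives it the value -1. *)
  have := h ((S + 1) / (2 * A)); rewrite V00 mulr0 addr0.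
  rewrite (_ : 2 * _ * A = S + 1); first by lra.
  by field.
have Vp : 0 < V by rewrite lt_neqAle eq_sym Vn V0.
have := h (A / V); rewrite (_ : S - _ + _ = S - A ^+ 2 / V); last by field.
by rewrite subr_ge0 ler_pdivrMr// mulrC.
Qed.

Definition sqn phi : R := fine (sqnorm setT phi).

Lemma sqnE phi : L2 Omega phi -> sqnorm setT phi = (sqn phi)%:E.
Proof.
move=> [_ _ f]; rewrite /sqn fineK// ge0_fin_numE//.
by apply: integral_ge0 => x _; rewrite lee_fin sqr_ge0.
Qed.

Lemma sqn_ge0 phi : 0 <= sqn phi.
Proof. by apply: fine_ge0; apply: integral_ge0 => x _; rewrite lee_fin sqr_ge0. Qed.

(** The pointwise bound that tames [ln |xi|] near the origin. Real and imaginary parts of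
    [expi (- dotp x xi) * phi x] are estimated separately; their squares add up to |phi|^2, so the
    constant is exactly |Omega|. *)
Lemma fourier_sup phi xi : L2 Omega phi ->
  normc (fourier phi xi) ^+ 2 <= V * sqn phi.
Proof.
move=> L2phi; have ip := L2_Cintegrable mOmega finOmega L2phi; have [m z f] := L2phi.
pose g x := expi (- dotp x xi) * phi x.
have [ig1 ig2] : Cintegrable g by exact: Cintegrable_expiM.
have mg := CmeasurableP (conj ig1 ig2).
have gn x : normc (g x) ^+ 2 = normc (phi x) ^+ 2.
  by rewrite Normc.normcM normc_expi mul1r.
have i2 := L2_sqint L2phi.
have j1 : mu.-integrable setT (fun x => (Re (g x) ^+ 2)%:E).
  apply: le_integrable i2 => //.
    by apply/measurable_EFinP; apply: measurable_funX; case: mg.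
  by move=> x _; rewrite /= lee_fin !ger0_norm ?sqr_ge0// -gn normc_sq lerDl sqr_ge0.
have j2 : mu.-integrable setT (fun x => (Im (g x) ^+ 2)%:E).
  apply: le_integrable i2 => //.
    by apply/measurable_EFinP; apply: measurable_funX; case: mg.
  by move=> x _; rewrite /= lee_fin !ger0_norm ?sqr_ge0// -gn normc_sq lerDr sqr_ge0.
have g0 x : ~ Omega x -> g x = 0 by move=> /z zx; rewrite /g zx mulr0.
rewrite normc_sq.
apply: (le_trans (lerD (sqr_Rintegral_le ig1 j1 _) (sqr_Rintegral_le ig2 j2 _))).
- by move=> x /g0 ->.
- by move=> x /g0 ->.
rewrite -mulrDr -RintegralD// /sqn /sqnorm ler_wpM2l// /Rintegral.
rewrite le_eqVlt; apply/orP; left; apply/eqP; congr fine; apply: eq_integral => x _.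
by rewrite -gn normc_sq.
Qed.

Let lnw xi : R := ln (enorm xi).
(** The negative part of [ln |xi|], written with [ln 1] to match [integral_ln_ball] at radius 1. *)
Let lnm xi : R := \1_(oball 1) xi * (ln 1 - ln (enorm xi)).

Lemma measurable_ln_enorm : measurable_fun setT lnw.
Proof.
apply: (@measurableT_comp _ _ _ _ _ _ (@ln R)); first exact: measurable_ln.
exact: measurable_enorm.
Qed.

Let lnm0 xi : 0 <= lnm xi.
Proof.
rewrite /lnm indicE; case: (boolP (xi \in _)) => [|_]; last by rewrite mul0r.
by rewrite inE /oball/= ln1 sub0r mul1r oppr_ge0 => x1; rewrite ln_le0// ltW.
Qed.

Let mlnm : measurable_fun setT lnm.
Proof.
apply: measurable_funM; first by apply: measurable_indic; exact: measurable_oball.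
by apply: measurable_funB => //; exact: measurable_ln_enorm.
Qed.

Let ilnm : mu.-integrable setT (fun xi => (lnm xi)%:E).
Proof.
apply/integrableP; split; first exact/measurable_EFinP.
under eq_integral => x _ do rewrite /= ger0_norm//.
by rewrite /lnm integral_ln_ball// ltry.
Qed.

Let lnw_lnm xi : - lnm xi <= lnw xi.
Proof.
rewrite /lnm indicE; case: (boolP (xi \in _)).
  by rewrite ln1 sub0r mul1r opprK.
move=> /negP; rewrite inE /oball/= => /negP; rewrite -leNgt => x1.
by rewrite mul0r oppr0 ln_ge0.
Qed.

Let lnw_bound xi : `|lnw xi| <= ln (expR 1 + enorm xi) + lnm xi.
Proof.
have l1 := ln_e_enorm_ge1 xi.
rewrite ler_norml; apply/andP; split.
  by rewrite opprD; have := lnw_lnm xi; lra.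
apply: (@le_trans _ _ (ln (expR 1 + enorm xi))); last by rewrite lerDl.
have [x0|x0] := leP (enorm xi) 0; first by rewrite /lnw ln0//; lra.
by rewrite ler_ln ?posrE// ?lerDr ?expR_ge0// addr_gt0// expR_gt0.
Qed.

(** A class that contains [Hspace], on which the logarithmic form converges, and whose stability
    under subtraction is direct. The algebra of the form takes place here; the eigenvalue equation
    is tested on members of [Hspace] only. *)
Definition form_dom phi := L2 Omega phi /\ (sqnorm_star phi < +oo)%E.

Lemma form_dom_star phi : form_dom phi ->
  mu.-integrable setT (fun xi => (ln (expR 1 + enorm xi) * normc (fourier phi xi) ^+ 2)%:E).
Proof.
move=> [L2phi s]; have ip := L2_Cintegrable mOmega finOmega L2phi.
apply/integrableP; split.
  apply/measurable_EFinP; apply: measurable_funM; first exact: measurable_ln_e.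
  by apply: measurable_normc_sq; apply: measurable_fourier; exact: CmeasurableP.
under eq_integral => x _.
  rewrite /= ger0_norm; last first.
    by rewrite mulr_ge0 ?sqr_ge0// (le_trans _ (ln_e_enorm_ge1 x)).
  over.
exact: s.
Qed.

(** Two regimes of [ln |xi|]: the growth at infinity is controlled by the star norm, the singularity
    at 0 by [fourier_sup] and the integrability of [lnm]. *)
Lemma form_dom_wint phi : form_dom phi -> wint lnw (fourier phi).
Proof.
move=> h; have [L2phi s] := h; have ip := L2_Cintegrable mOmega finOmega L2phi.
have mf := measurable_fourier (CmeasurableP ip).
split => //.
apply: (le_integrable measurableT _ _ (integrableD measurableT (form_dom_star h)
  (integrableZl_EFin (V * sqn phi) measurableT ilnm))).
  apply/measurable_EFinP; apply: measurable_funM; last exact: measurable_normc_sq.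
  by apply: measurableT_comp => //; exact: measurable_ln_enorm.
move=> xi _; rewrite -EFinD /= lee_fin ger0_norm; last by rewrite mulr_ge0 ?sqr_ge0.
apply: le_trans (ler_norm _).
apply: (le_trans (ler_wpM2r (sqr_ge0 _) (lnw_bound xi))).
by rewrite mulrDl lerD// mulrC ler_wpM2r// fourier_sup.
Qed.

Lemma L2_wint phi : L2 Omega phi -> wint (fun=> 1) phi.
Proof.
move=> h; split; first by case: h.
by under eq_fun do rewrite normr1 mul1r; exact: L2_sqint h.
Qed.

Lemma form_dom_subM phi psi c : form_dom phi -> form_dom psi ->
  form_dom (fun x => phi x - c * psi x).
Proof.
move=> h1 h2; have [L1 s1] := h1; have [L2' s2] := h2.
have i1 := L2_Cintegrable mOmega finOmega L1.
have i2 := L2_Cintegrable mOmega finOmega L2'.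
have [m1 z1 f1] := L1; have [m2 z2 f2] := L2'.
have [_ w] := wint_subM (@measurable_cst _ _ _ _ setT (1 : R)) c (L2_wint L1) (L2_wint L2').
split; first split.
- exact: Cmeasurable_subM.
- by move=> x Ox; rewrite z1// z2// mulr0 subr0.
- have /integrableP[_] := w; rewrite /sqnorm; apply: le_lt_trans.
  rewrite le_eqVlt; apply/orP; left; apply/eqP; apply: eq_integral => x _ /=.
  by rewrite normr1 mul1r ger0_norm ?sqr_ge0.
have mw : measurable_fun setT (fun xi : E => ln (expR 1 + enorm xi)) by exact: measurable_ln_e.
have w0 (xi : E) : 0 <= ln (expR 1 + enorm xi) by rewrite (le_trans _ (ln_e_enorm_ge1 xi)).
have wi phi' : form_dom phi' -> wint (fun xi : E => ln (expR 1 + enorm xi)) (fourier phi').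
  move=> h; split.
    apply: measurable_fourier; apply: CmeasurableP.
    by apply: (L2_Cintegrable mOmega finOmega); case: h.
  by under eq_fun do rewrite ger0_norm//; exact: form_dom_star.
have [_ /integrableP[_]] := wint_subM mw c (wi _ h1) (wi _ h2).
apply: le_lt_trans; rewrite le_eqVlt; apply/orP; left; apply/eqP; apply: eq_integral => x _.
rewrite (fourier_subM c x i1 i2) gee0_abs; last first.
  by rewrite lee_fin; apply: mulr_ge0; [exact: normr_ge0|exact: sqr_ge0].
by rewrite (ger0_norm (w0 x)).
Qed.

Lemma Hspace_form_dom phi : Hspace Omega phi -> form_dom phi.
Proof. by move=> h; split; [case: h|exact: Hspace_star h]. Qed.

Lemma l2dotE phi psi : L2 Omega phi ->
  l2dot Omega phi psi = wform (fun=> 1) phi psi.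
Proof.
move=> [_ z _]; rewrite /l2dot Cintegral_restrict.
  by apply: eq_Cintegral => x; rewrite mul1r.
by move=> x /z ->; rewrite mul0r.
Qed.

Lemma log_formE phi psi :
  log_form phi psi = ((2 * pi) ^- n)%:C * wform lnw (fourier phi) (fourier psi).
Proof. by []. Qed.

Lemma fourier_subM_fun phi psi c : form_dom phi -> form_dom psi ->
  fourier (fun x => phi x - c * psi x) = fun xi => fourier phi xi - c * fourier psi xi.
Proof.
move=> [h1 _] [h2 _]; apply/funext => xi.
by rewrite fourier_subM//; exact: (L2_Cintegrable mOmega finOmega).
Qed.

Let mw := measurable_ln_enorm.
Let m1 := @measurable_cst _ _ E _ setT (1 : R).

Lemma log_formBr phi psi chi c : form_dom phi -> form_dom psi -> form_dom chi ->
  log_form phi (fun x => chi x - c * psi x) = log_form phi chi - c^* * log_form phi psi.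
Proof.
move=> h1 h2 h3; rewrite !log_formE (fourier_subM_fun c h3 h2).
by rewrite (wformBr mw c (form_dom_wint h1) (form_dom_wint h2) (form_dom_wint h3)) mulrBr mulrCA.
Qed.

Lemma log_formBl phi psi chi c : form_dom phi -> form_dom psi -> form_dom chi ->
  log_form (fun x => chi x - c * psi x) phi = log_form chi phi - c * log_form psi phi.
Proof.
move=> h1 h2 h3; rewrite !log_formE (fourier_subM_fun c h3 h2).
by rewrite (wformBl mw c (form_dom_wint h1) (form_dom_wint h2) (form_dom_wint h3)) mulrBr mulrCA.
Qed.

Lemma log_formC phi psi : form_dom phi -> form_dom psi ->
  log_form psi phi = (log_form phi psi)^*.
Proof.
move=> h1 h2; rewrite !log_formE (wformC mw (form_dom_wint h1) (form_dom_wint h2)).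
by rewrite conjc_realM.
Qed.

Lemma l2dotBr phi psi chi c : form_dom phi -> form_dom psi -> form_dom chi ->
  l2dot Omega phi (fun x => chi x - c * psi x) = l2dot Omega phi chi - c^* * l2dot Omega phi psi.
Proof.
move=> [h1 _] [h2 _] [h3 _]; rewrite !(l2dotE _ h1).
exact: (wformBr m1 c (L2_wint h1) (L2_wint h2) (L2_wint h3)).
Qed.

Lemma l2dotBl phi psi chi c : form_dom phi -> form_dom psi -> form_dom chi ->
  l2dot Omega (fun x => chi x - c * psi x) phi = l2dot Omega chi phi - c * l2dot Omega psi phi.
Proof.
move=> h1 h2 h3; have [h4 _] := form_dom_subM c h3 h2; move: h1 h2 h3 => [h1 _] [h2 _] [h3 _].
rewrite (l2dotE _ h4) (l2dotE _ h3) (l2dotE _ h2).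
exact: (wformBl m1 c (L2_wint h1) (L2_wint h2) (L2_wint h3)).
Qed.

Lemma l2dotC phi psi : form_dom phi -> form_dom psi ->
  l2dot Omega psi phi = (l2dot Omega phi psi)^*.
Proof.
move=> [h1 _] [h2 _]; rewrite (l2dotE _ h1) (l2dotE _ h2).
exact: (wformC m1 (L2_wint h1) (L2_wint h2)).
Qed.

Lemma l2dot_diag phi : L2 Omega phi -> l2dot Omega phi phi = (sqn phi)%:C.
Proof.
move=> h; rewrite (l2dotE _ h) wform_diag /sqn /sqnorm /Rintegral; congr (fine _)%:C.
by apply: eq_integral => x _; rewrite mul1r.
Qed.

(** Semiboundedness: only [lnm] contributes negatively, [fourier_sup] replaces the squared transform
    by a constant there, and [lnm] has integral [vball R n / n%:R]. *)
Lemma log_form_lower phi : form_dom phi ->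
  - ((2 * pi) ^- n * (V * (vball R n / n%:R))) * sqn phi <= Re (log_form phi phi).
Proof.
move=> h; have [L2phi s] := h; have [mf wi] := form_dom_wint h.
rewrite log_formE wform_diag Re_realM Re_real mulNr -mulrA -mulrN ler_wpM2l//.
  by rewrite invr_ge0 exprn_ge0// mulr_ge0// pi_ge0.
have -> : - (V * (vball R n / n%:R) * sqn phi) = \int[mu]_xi (- (V * sqn phi) * lnm xi).
  rewrite RintegralZl// /Rintegral /lnm integral_ln_ball//= expr1n mul1r; ring.
apply: le_Rintegral => //.
- exact: integrableZl_EFin.
- apply: le_integrable wi => //.
    by apply/measurable_EFinP; apply: measurable_funM => //; exact: measurable_normc_sq.
  by move=> x _; rewrite lee_fin !normrM normr_id.
- move=> xi _; apply: (@le_trans _ _ (- lnm xi * normc (fourier phi xi) ^+ 2)).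
    by rewrite !mulNr lerN2 [leLHS]mulrC ler_wpM2r// fourier_sup.
  by rewrite ler_wpM2r// sqr_ge0.
Qed.

End form_domain.

Section trial.
Context {R : realType} {n : nat}.
Local Open Scope complex_scope.
Local Notation mu := (lebesgue_rV (R := R) n).
Local Notation E := 'rV[R]_n.
Local Notation Re := complex.Re.
Local Notation Im := complex.Im.
Local Notation normc := Normc.normc.
Variables (Omega : set E) (mOmega : measurable Omega) (finOmega : (mu Omega < +oo)%E).
Hypothesis n0 : (0 < n)%N.
Variables (lam : nat -> R) (phi : nat -> E -> R[i]).
Hypothesis ephi : forall k, eigenfunction Omega (lam k) (phi k).
Hypothesis ophi : orthonormal_system Omega phi.
Hypothesis cphi : complete_system Omega phi.

Variables (l : R) (psi : E -> R[i]).
Hypothesis hpsi : Hspace Omega psi.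

Let dom := form_dom Omega.
Let dphi k : dom (phi k).
Proof. by have [h _ _] := ephi k; exact: (Hspace_form_dom mOmega finOmega h). Qed.
Let dpsi : dom psi. Proof. exact: (Hspace_form_dom mOmega finOmega hpsi). Qed.

Let c k := l2dot Omega psi (phi k).
Let w N x := psi x - \sum_(k < N) c k * phi k x.

Let wS N : w N.+1 = fun x => w N x - c N * phi N x.
Proof. by apply/funext => x; rewrite /w big_ord_recr/= opprD addrA. Qed.

Let w0 : w 0 = psi.
Proof. by apply/funext => x; rewrite /w big_ord0 subr0. Qed.

Let F (f : E -> R[i]) : R := l * sqn f - Re (log_form f f).

(** One eigenfunction is removed at a time. The eigenvalue equation against the remainder is part of
    the invariant: it is given for test functions in [Hspace] and reaches [w N] by linearity.
    Orthogonality leaves the later coefficients unchanged. The cross terms and the diagonal term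
    then combine into a loss of [(l - lam N) * normc (c N) ^+ 2]. *)
Let w_spec N : [/\ dom (w N),
  (forall k, log_form (phi k) (w N) = (lam k)%:C * l2dot Omega (phi k) (w N)),
  (forall k, (N <= k)%N -> l2dot Omega (w N) (phi k) = c k) &
  F (w N) = F psi - \sum_(k < N) (l - lam k) * normc (c k) ^+ 2].
Proof.
elim: N => [|N [dw ew cw Fw]].
  rewrite w0; split; [exact: dpsi| |by []|by rewrite big_ord0 subr0].
  by move=> k; have [_ _ h] := ephi k; exact: h.
have eN k j : log_form (phi k) (phi j) = (lam k)%:C * l2dot Omega (phi k) (phi j).
  by have [_ _ h] := ephi k; apply: h; have [h' _ _] := ephi j.
have dw' : dom (fun x => w N x - c N * phi N x).
  exact: (form_dom_subM mOmega finOmega (c N) dw (dphi N)).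
rewrite wS; split.
- exact: dw'.
- move=> k; rewrite (log_formBr mOmega finOmega n0 (c N) (dphi k) (dphi N) dw).
  by rewrite (l2dotBr (c N) (dphi k) (dphi N) dw) ew eN mulrBr mulrCA.
- move=> k Nk; rewrite (l2dotBl mOmega finOmega (c N) (dphi k) (dphi N) dw).
  by rewrite cw ?(ltnW Nk)// ophi (ltn_eqF Nk) mulr0 subr0.
- have Lw : L2 Omega (w N) by case: dw.
  have Lw' : L2 Omega (fun x => w N x - c N * phi N x) by case: dw'.
  have cc : c N * (c N)^* = (normc (c N) ^+ 2)%:C by exact: mulc_conj.
  have b1 : l2dot Omega (phi N) (w N) = (c N)^*.
    by rewrite (l2dotC dw (dphi N)) cw.
  have q1 : log_form (phi N) (w N) = (lam N)%:C * (c N)^* by rewrite ew b1.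
  have q2 : log_form (w N) (phi N) = (lam N)%:C * c N.
    rewrite (log_formC mOmega finOmega n0 (dphi N) dw) q1.
    by rewrite conjc_realM; congr (_ * _); exact: conjcK.
  have hb : sqn (fun x => w N x - c N * phi N x) = sqn (w N) - normc (c N) ^+ 2.
    apply: (@complexI R); rewrite -(l2dot_diag Lw') rmorphB/= -(l2dot_diag Lw) -cc.
    rewrite (l2dotBr (c N) dw' (dphi N) dw) (l2dotBl mOmega finOmega (c N) dw (dphi N) dw).
    by rewrite (l2dotBl mOmega finOmega (c N) (dphi N) (dphi N) dw) (cw N)// b1 ophi eqxx mulr1 subrr mulr0 subr0.
  have hq : log_form (fun x => w N x - c N * phi N x) (fun x => w N x - c N * phi N x) =
     log_form (w N) (w N) - (lam N * normc (c N) ^+ 2)%:C.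
    rewrite rmorphM/= -cc (log_formBr mOmega finOmega n0 (c N) dw' (dphi N) dw).
    rewrite (log_formBl mOmega finOmega n0 (c N) dw (dphi N) dw).
    rewrite (log_formBl mOmega finOmega n0 (c N) (dphi N) (dphi N) dw) q1 q2 eN ophi eqxx mulr1.
    by rewrite [c N * (lam N)%:C]mulrC subrr mulr0 subr0 mulrCA.
  rewrite big_ord_recr/= opprD addrA -Fw /F hb hq Re_subc.
  move: (sqn (w N)) (Re (log_form (w N) (w N))) (normc (c N) ^+ 2) => a b d /=; ring.
Qed.

Let sqnw N : sqnorm Omega (w N) = (sqn (w N))%:E.
Proof.
have [[L s] _ _ _] := w_spec N; rewrite -(sqnE L) /sqnorm integral_mkcond.
apply: eq_integral => x _; rewrite patchE; case: ifPn => // /negP; rewrite inE => Ox.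
by case: L => _ -> // _; rewrite Normc.normc0 expr0n.
Qed.

Let cvg_sqnw : sqn (w N) @[N --> \oo] --> (0 : R).
Proof.
have /cphi : L2 Omega psi by case: dpsi.
rewrite -/(w _) (_ : (fun N => _) = fun N => (sqn (w N))%:E); last first.
  by apply/funext => N; rewrite -sqnw.
by move/fine_cvgP => [].
Qed.

(** By [w_spec], [F psi] exceeds the partial sum up to [N] by [F (w N)]. Semiboundedness gives
    [F (w N) <= (l + C) * sqn (w N)], which tends to 0 by completeness whatever the sign of [l + C].
    The terms with [k >= m] are nonpositive and are dropped. *)
Lemma trial_bound m : (forall k, (m <= k)%N -> l <= lam k) ->
  l * sqn psi - Re (log_form psi psi) <= \sum_(k < m) (l - lam k) * normc (c k) ^+ 2.
Proof.
move=> hm; rewrite -/(F psi).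
pose C := (2 * pi) ^- n * (fine (mu Omega) * (vball R n / n%:R)).
have hF N : F psi - \sum_(k < N) (l - lam k) * normc (c k) ^+ 2 <= (l + C) * sqn (w N).
  have [d _ _ <-] := w_spec N; rewrite /F mulrDl lerD2l lerNl.
  by have := log_form_lower mOmega finOmega n0 d; rewrite mulNr.
have hN N : (m <= N)%N -> F psi - \sum_(k < m) (l - lam k) * normc (c k) ^+ 2 <= (l + C) * sqn (w N).
  move=> mN; apply: le_trans (hF N); rewrite lerB//.
  rewrite -(big_mkord xpredT (fun k => (l - lam k) * normc (c k) ^+ 2)).
  rewrite -(big_mkord xpredT (fun k => (l - lam k) * normc (c k) ^+ 2)).
  rewrite [leLHS](big_cat_nat (leq0n m) mN)/= gerDl big_nat_cond; apply: sumr_le0 => k.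
  rewrite andbT => /andP[mk _]; rewrite mulr_le0_ge0 ?sqr_ge0// subr_le0 hm//.
have cv : ((l + C) * sqn (w N)) @[N --> \oo] --> (l + C) * 0.
  by apply: cvgM => //; exact: cvg_cst.
rewrite mulr0 in cv.
have h : F psi - \sum_(k < m) (l - lam k) * normc (c k) ^+ 2 <=
    limn (fun N => (l + C) * sqn (w N)).
  apply: limr_ge; first by apply/cvg_ex; exists 0.
  by exists m => // N /=; exact: hN.
by rewrite (cvg_lim _ cv)// subr_le0 in h.
Qed.

End trial.

(** * Smooth cutoffs *)

Section flat.
Context {R : realType}.
Implicit Types (m : nat) (s t : R).

(* [flat m] is [t^-m exp (-1/t)], extended by 0 to [t <= 0]; this family is
   stable under differentiation up to linear combinations. *)
Definition flat m t : R := if 0 < t then t^-1 ^+ m * expR (- t^-1) else 0.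

Lemma flat_ge0 m t : 0 <= flat m t.
Proof.
by rewrite /flat; case: ifPn => // t0; rewrite mulr_ge0 ?expR_ge0// exprn_ge0// invr_ge0 ltW.
Qed.

Lemma flat0_gt0 t : 0 < t -> 0 < flat 0 t.
Proof. by rewrite /flat => ->; rewrite mul1r expR_gt0. Qed.

Lemma flat0_le1 t : flat 0 t <= 1.
Proof.
rewrite /flat; case: ifPn => // t0; rewrite mul1r -[leRHS]expR0 ler_expR oppr_le0.
by rewrite invr_ge0 ltW.
Qed.

Lemma flat_le0 m t : t <= 0 -> flat m t = 0.
Proof. by rewrite /flat leNgt => /negbTE ->. Qed.

(** [1 + x <= expR x] at [x = t / k], raised to the power [k]; for [k = 0] the constant is
    [0 ^+ 0 = 1]. *)
Lemma pow_le_expR k t : 0 <= t -> t ^+ k <= k%:R ^+ k * expR t.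
Proof.
move=> t0; case: k => [|k]; first by rewrite !expr0 mul1r -[leLHS]expR0 ler_expR.
have -> : expR t = expR (t / k.+1%:R) ^+ k.+1.
  by rewrite -expRM_natl; congr expR; field.
rewrite -exprMn lerXn2r ?nnegrE// ?mulr_ge0 ?expR_ge0//.
apply: (@le_trans _ _ (k.+1%:R * (1 + t / k.+1%:R))); last by rewrite ler_wpM2l// expR_ge1Dx.
by rewrite mulrDr mulr1 mulrCA mulfV// mulr1 lerDr.
Qed.

(** The factor [t ^+ 2] sends the difference quotients at 0 to 0. It comes from applying
    [pow_le_expR] to [t^-1] with exponent [m.+2] instead of [m]. *)
Lemma flat_bound m t : flat m t <= (m.+2%:R ^+ m.+2) * t ^+ 2.
Proof.
rewrite /flat; case: ifPn => t0; last by rewrite mulr_ge0 ?sqr_ge0// exprn_ge0.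
have := pow_le_expR m.+2 (ltW (_ : 0 < t^-1)); rewrite invr_gt0 => /(_ t0) h.
rewrite -(ler_pM2r (expR_gt0 t^-1)) -mulrA -expRD addNr expR0 mulr1.
rewrite [leLHS](_ : _ = t^-1 ^+ m.+2 * t ^+ 2).
  by rewrite [leRHS]mulrAC ler_wpM2r ?sqr_ge0.
by rewrite !exprS; field; rewrite gt_eqF.
Qed.

Lemma is_derive_flat m t :
  is_derive t (1 : R) (flat m) (flat m.+2 t - m%:R * flat m.+1 t).
Proof.
have [t0|t0|->] := ltgtP t 0.
- rewrite !flat_le0 ?(ltW t0)// mulr0 subr0.
  have fE : \forall s \near t, cst 0 s = flat m s.
    have : \forall s \near t, s < 0 by exact: lt_nbhsl.
    by apply: filterS => s s0; rewrite flat_le0// ltW.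
  exact: (near_eq_is_derive fE (is_derive_cst (0 : R) t 1)).
- have tn : t != 0 by rewrite gt_eqF.
  have fE : \forall s \near t, (fun s : R => s^-1 ^+ m * expR (- s^-1)) s = flat m s.
    have : \forall s \near t, 0 < s by exact: lt_nbhsr.
    by apply: filterS => s s0; rewrite /flat s0.
  apply: (near_eq_is_derive fE).
  have dV : is_derive t (1 : R) (fun s : R => s^-1) (- t^-1 ^+ 2).
    have h := @is_deriveV R id t 1 1 tn (is_derive_id _ _); apply: (is_derive_eq h).
    by rewrite /GRing.scale/= mulr1 exprVn.
  have dX : is_derive t (1 : R) (fun s : R => s^-1 ^+ m) (m%:R * t^-1 ^+ m.-1 * - t^-1 ^+ 2).
    rewrite (_ : (fun s : R => s^-1 ^+ m) = (fun s : R => s^-1) ^+ m).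
      exact: is_deriveX dV.
    by apply/funext => s; rewrite fctE.
  have dE : is_derive t (1 : R) (fun s : R => expR (- s^-1)) (expR (- t^-1) * - - t^-1 ^+ 2).
    exact: (@is_derive1_comp R (@expR R) (fun s : R => - s^-1) t _ _
      (is_derive_expR _) (is_deriveN dV)).
  apply: (is_derive_eq (is_deriveM dX dE)); rewrite /flat t0 /GRing.scale/=.
  case: m {fE dX} => [|m]; first by rewrite !mul0r; ring.
  by rewrite /= !exprS; ring.
- rewrite !flat_le0// mulr0 subr0.
  pose C : R := m.+2%:R ^+ m.+2.
  have C0 : 0 <= C by rewrite exprn_ge0.
  have q : h^-1 *: ((flat m \o shift 0) (h *: (1 : R)) - flat m 0) @[h --> (0 : R)^'] --> (0 : R).
    apply/cvgr0Pnorm_le => e e0.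
    have : \forall h \near (0 : R)^', `|h| < e / (C + 1).
      apply: nbhs_dnbhs; have e1 : 0 < e / (C + 1) by rewrite divr_gt0// ltr_wpDl.
      apply/nbhs_ballP; exists (e / (C + 1)) => //= h.
      by rewrite /ball/= sub0r normrN.
    apply: filterS => h; rewrite ltr_pdivlMr ?ltr_wpDl// => he.
    rewrite /= addr0 [h%:A]mulr1 (flat_le0 m (lexx 0)) subr0 /GRing.scale/= normrM normfV.
    rewrite (ger0_norm (flat_ge0 _ _)).
    have [->|h0] := eqVneq h 0; first by rewrite flat_le0// mulr0 ltW.
    rewrite mulrC ler_pdivrMr ?normr_gt0//.
    apply: (le_trans (flat_bound _ _)); rewrite -/C -real_normK ?num_real// expr2 mulrA ler_wpM2r//.
    by apply: ltW; apply: le_lt_trans he; rewrite mulrC ler_wpM2l// lerDl.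
  by split; [apply/cvg_ex; exists 0|exact/cvg_lim].
Qed.

Lemma continuous_flat m : continuous (flat m).
Proof.
move=> t; apply: differentiable_continuous; apply/derivable1_diffP.
by have [] := is_derive_flat m t.
Qed.

End flat.

Section smooth_class.
Context {R : realType} {n : nat}.
Local Notation E := 'rV[R]_n.
Local Notation e i := (delta_mx 0 i : E).

(** Smoothness quantifies over all finite sequences of partial derivatives; induction on the
    sequence works in any class that its own partial derivatives do not leave. *)
Lemma smooth_class (S : (E -> R) -> Prop) :
  (forall f, S f -> continuous f /\
    forall i, (forall x, derivable f x (e i)) /\ S ('D_(e i) f)) ->
  forall f, S f -> smooth f.
Proof.
move=> hS f Sf s; have Ss : S (partials f s).
  by elim: s => //= i s ih; have [_ /(_ i)[]] := hS _ ih.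
by have [c d] := hS _ Ss; split => // i x; have [] := d i.
Qed.

(* A class of functions visibly closed under partial derivatives, hence smooth. *)
Inductive flat_trig : (E -> R) -> Prop :=
| flat_trig_cst c : flat_trig (fun=> c)
| flat_trig_flat m (j : 'I_n) a b : flat_trig (fun x => flat m (a * x 0 j + b))
| flat_trig_cos xi : flat_trig (fun x => cos (dotp x xi))
| flat_trig_sin xi : flat_trig (fun x => sin (dotp x xi))
| flat_trigD f g : flat_trig f -> flat_trig g -> flat_trig (fun x => f x + g x)
| flat_trigM f g : flat_trig f -> flat_trig g -> flat_trig (fun x => f x * g x).

Lemma is_derive_lineP (f : E -> R) x v (d : R) :
  is_derive (0 : R) (1 : R) (fun h : R => f (h *: v + x)) d -> is_derive x v f d.
Proof.
have E0 : (fun h => h^-1 *: (((fun h : R => f (h *: v + x)) \o shift 0) (h *: (1 : R)) -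
    f (0 *: v + x))) = (fun h => h^-1 *: ((f \o shift x) (h *: v) - f x)).
  by apply/funext => h /=; rewrite addr0 scale0r add0r [h%:A]mulr1.
move=> [d1 d2]; split; first by move: d1; rewrite /derivable E0.
by rewrite -d2 /derive E0.
Qed.

Lemma continuous_coord (j : 'I_n) : continuous (fun x : E => x 0 j).
Proof. by move=> x; exact: coord_continuous. Qed.

Lemma continuous_funD (T : topologicalType) (f g : T -> R) :
  continuous f -> continuous g -> continuous (fun x => f x + g x).
Proof. by move=> cf cg x; apply: cvgD; [exact: cf|exact: cg]. Qed.

Lemma continuous_funM (T : topologicalType) (f g : T -> R) :
  continuous f -> continuous g -> continuous (fun x => f x * g x).
Proof. by move=> cf cg x; apply: cvgM; [exact: cf|exact: cg]. Qed.

Lemma continuous_fun_sum (T : topologicalType) (I : Type) (s : seq I) (f : I -> T -> R) :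
  (forall i, continuous (f i)) -> continuous (fun x => \sum_(i <- s) f i x).
Proof.
move=> cf; elim: s => [|i s ih].
  by under eq_fun do rewrite big_nil; exact: cst_continuous.
by under eq_fun do rewrite big_cons; apply: continuous_funD; [exact: cf|exact: ih].
Qed.

Lemma continuous_dotp (xi : E) : continuous (fun x : E => dotp x xi).
Proof.
apply: continuous_fun_sum => i.
by apply: continuous_funM; [exact: continuous_coord|exact: cst_continuous].
Qed.

Lemma flat_trigP f : flat_trig f -> continuous f /\
  forall i, exists2 g, flat_trig g & forall x, is_derive x (e i) f (g x).
Proof.
elim=> {f} [c|m j a b|xi|xi|f g cf [kf df] cg [kg dg]|f g cf [kf df] cg [kg dg]].
- split; first exact: cst_continuous.
  by move=> i; exists (fun=> 0) => [|x]; [exact: flat_trig_cst|exact: is_derive_cst].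
- split.
    move=> x; apply: (@continuous_comp _ _ _ (fun x : E => a * x 0 j + b) (flat m)); last first.
      exact: continuous_flat.
    apply: continuous_funD; last exact: cst_continuous.
    by apply: continuous_funM; [exact: cst_continuous|exact: continuous_coord].
  move=> i; pose k : R := a * (i == j)%:R.
  exists (fun x => k * (flat m.+2 (a * x 0 j + b) + (- m%:R) * flat m.+1 (a * x 0 j + b))).
    apply: flat_trigM; first exact: flat_trig_cst.
    by apply: flat_trigD; [exact: flat_trig_flat|apply: flat_trigM; [exact: flat_trig_cst|exact: flat_trig_flat]].
  move=> x; apply: is_derive_lineP.
  rewrite (_ : (fun h : R => _) = flat m \o (fun h => k * h + (a * x 0 j + b))); last first.
    by apply/funext => h /=; rewrite !mxE eqxx/= /k [j == i]eq_sym; congr flat; ring.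
  have d1 := is_derive_flat m (k * 0 + (a * x 0 j + b)).
  have d2 : is_derive (0 : R) (1 : R) (fun h => k * h + (a * x 0 j + b)) k.
    by apply: is_derive_eq; rewrite /GRing.scale/=; ring.
  have d3 := @is_derive1_comp R (flat m) (fun h => k * h + (a * x 0 j + b)) 0 _ _ d1 d2.
  apply: (is_derive_eq d3); by rewrite mulr0 add0r; ring.
- split.
    move=> x; apply: (@continuous_comp _ _ _ (fun x : E => dotp x xi) (@cos R)).
      exact: continuous_dotp.
    exact: continuous_cos.
  move=> i; exists (fun x => - xi 0 i * sin (dotp x xi)).
    by apply: flat_trigM; [exact: flat_trig_cst|exact: flat_trig_sin].
  move=> x; apply: is_derive_lineP.
  rewrite (_ : (fun h : R => _) = (fun h => cos (h * xi 0 i + dotp x xi))); last first.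
    by apply/funext => h; rewrite dotpDl dotp_delta.
  by apply: is_derive_eq; rewrite /GRing.scale/= mul0r add0r; ring.
- split.
    move=> x; apply: (@continuous_comp _ _ _ (fun x : E => dotp x xi) (@sin R)).
      exact: continuous_dotp.
    exact: continuous_sin.
  move=> i; exists (fun x => xi 0 i * cos (dotp x xi)).
    by apply: flat_trigM; [exact: flat_trig_cst|exact: flat_trig_cos].
  move=> x; apply: is_derive_lineP.
  rewrite (_ : (fun h : R => _) = (fun h => sin (h * xi 0 i + dotp x xi))); last first.
    by apply/funext => h; rewrite dotpDl dotp_delta.
  by apply: is_derive_eq; rewrite /GRing.scale/= mul0r add0r; ring.
- split; first exact: continuous_funD.
  move=> i; have [f' cf' hf] := df i; have [g' cg' hg] := dg i.
  exists (fun x => f' x + g' x) => [|x]; first exact: flat_trigD.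
  exact: (is_deriveD (hf x) (hg x)).
- split; first exact: continuous_funM.
  move=> i; have [f' cf' hf] := df i; have [g' cg' hg] := dg i.
  exists (fun x => f x * g' x + g x * f' x) => [|x].
    by apply: flat_trigD; exact: flat_trigM.
  exact: (is_deriveM (hf x) (hg x)).
Qed.

Lemma flat_trig_smooth f : flat_trig f -> smooth f.
Proof.
apply: smooth_class => {}f cf; have [kf df] := flat_trigP cf; split => // i.
have [g cg hg] := df i; split; first by move=> x; have [] := hg x.
by rewrite (_ : 'D_(e i) f = g)//; apply/funext => x; have [] := hg x.
Qed.

Lemma flat_trig_prod (I : Type) (s : seq I) (f : I -> E -> R) : (forall i, flat_trig (f i)) ->
  flat_trig (fun x => \prod_(i <- s) f i x).
Proof.
move=> cf; elim: s => [|i s ih].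
  by under eq_fun do rewrite big_nil; exact: flat_trig_cst.
by under eq_fun do rewrite big_cons; exact: flat_trigM.
Qed.

Lemma flat_trigX f N : flat_trig f -> flat_trig (fun x => f x ^+ N).
Proof.
move=> cf; elim: N => [|N ih]; first exact: flat_trig_cst.
by under eq_fun do rewrite exprS; exact: flat_trigM.
Qed.

End smooth_class.

Section cutoff.
Context {R : realType} {n : nat}.
Local Notation mu := (lebesgue_rV (R := R) n).
Local Notation E := 'rV[R]_n.
Variable Omega : set E.

(** Each [flat 0] factor vanishes beyond one face of the cube. The coefficients [1] and [- 1] are
    written out to match the constructor [flat_trig_flat]. *)
Definition bump (c : E) (r : R) (x : E) : R :=
  \prod_(i < n) (flat 0 (1 * x 0 i + (r - c 0 i)) * flat 0 (- 1 * x 0 i + (r + c 0 i))).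

Lemma bump_flat_trig c r : flat_trig (bump c r).
Proof. by apply: flat_trig_prod => i; apply: flat_trigM; exact: flat_trig_flat. Qed.

Lemma bump_ge0 c r x : 0 <= bump c r x.
Proof. by apply: prodr_ge0 => i _; rewrite mulr_ge0// flat_ge0. Qed.

Lemma bump_le1 c r x : bump c r x <= 1.
Proof.
rewrite -[leRHS](_ : \prod_(i < n) 1 = 1); last by rewrite big1.
apply: ler_prod => i _; rewrite mulr_ge0 ?flat_ge0//=.
by rewrite -[leRHS]mulr1 ler_pM ?flat_ge0// flat0_le1.
Qed.

Lemma bump_gt0 c r x : cube c r x -> 0 < bump c r x.
Proof.
move=> xc; apply: prodr_gt0 => i _; have := xc i; rewrite ltr_norml => /andP[h1 h2].
by rewrite mulr_gt0// flat0_gt0//; lra.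
Qed.

Lemma bump_out c r x : ~ ccube c r x -> bump c r x = 0.
Proof.
rewrite -existsNP; case=> i /negP; rewrite ler_norml negb_and -!ltNge => xi.
rewrite /bump (bigD1 i)//=; apply/eqP; rewrite mulf_eq0; apply/orP; left.
rewrite mulf_eq0; apply/orP; case/orP: xi => xi; [left|right];
  by rewrite flat_le0//; lra.
Qed.

Lemma ccube_compact (c : E) r : compact (ccube c r).
Proof.
rewrite (_ : ccube c r = [set x | forall i, `[c 0 i - r, c 0 i + r]%classic (x ord0 i)]).
  by apply: (@rV_compact _ _ (fun i => `[c 0 i - r, c 0 i + r]%classic)) => i; exact: segment_compact.
by apply/seteqP; split => x xc i; have := xc i; rewrite /= in_itv/= ler_distl.
Qed.

(** [unpickle] enumerates the rational cubes, and those that leave Omega are replaced by [set0]: a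
    countable family of compact pieces of Omega without any choice. *)
Definition nth_cube (j : nat) : set E :=
  if unpickle j is Some q then
    if `[< ccube (rat_cube_center q) (rat_cube_radius q) `<=` Omega >]
    then ccube (rat_cube_center q) (rat_cube_radius q) else set0
  else set0.

Definition nth_bump (j : nat) : E -> R :=
  if unpickle j is Some q then
    if `[< ccube (rat_cube_center q) (rat_cube_radius q) `<=` Omega >]
    then bump (rat_cube_center q) (rat_cube_radius q) else fun=> 0
  else fun=> 0.

Lemma nth_cube_sub j : nth_cube j `<=` Omega.
Proof.
by rewrite /nth_cube; case: unpickle => [q|]; last exact: sub0set; case: asboolP => // _; exact: sub0set.
Qed.

Lemma nth_cube_compact j : compact (nth_cube j).
Proof.
rewrite /nth_cube; case: unpickle => [q|]; last exact: compact0.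
by case: asboolP => _; [exact: ccube_compact|exact: compact0].
Qed.

Lemma nth_bump_flat_trig j : flat_trig (nth_bump j).
Proof.
rewrite /nth_bump; case: unpickle => [q|]; last exact: flat_trig_cst.
by case: asboolP => _; [exact: bump_flat_trig|exact: flat_trig_cst].
Qed.

Lemma nth_bump_itv j x : 0 <= nth_bump j x <= 1.
Proof.
rewrite /nth_bump; case: unpickle => [q|]; last by rewrite lexx ler01.
by case: asboolP => _; rewrite ?bump_ge0 ?bump_le1// lexx ler01.
Qed.

Lemma nth_bump_out j x : ~ nth_cube j x -> nth_bump j x = 0.
Proof.
rewrite /nth_cube /nth_bump; case: unpickle => [q|]//.
by case: asboolP => // _; exact: bump_out.
Qed.

Lemma nth_bump_cover x : open Omega -> Omega x -> exists j, 0 < nth_bump j x.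
Proof.
move=> oOmega /(rat_cube_basis oOmega)[q [xq qO]]; exists (pickle q).
by rewrite /nth_bump pickleK asboolT//; exact: bump_gt0.
Qed.

(* The power [N] forces convergence to [1] at every point of [Omega], since
   each of them lies in the positivity set of some bump. *)
Definition cutoff (N : nat) (x : E) : R := 1 - \prod_(j <- iota 0 N) (1 - nth_bump j x) ^+ N.

Lemma cutoff_flat_trig N : flat_trig (cutoff N).
Proof.
rewrite /cutoff; under eq_fun do rewrite -mulN1r.
apply: flat_trigD; first exact: flat_trig_cst.
apply: flat_trigM; first exact: flat_trig_cst.
apply: (@flat_trig_prod _ _ _ _ (fun j x => (1 - nth_bump j x) ^+ N)) => j.
apply: flat_trigX; under eq_fun do rewrite -mulN1r.
apply: flat_trigD; first exact: flat_trig_cst.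
by apply: flat_trigM; [exact: flat_trig_cst|exact: nth_bump_flat_trig].
Qed.

Lemma cutoff_itv N x : 0 <= cutoff N x <= 1.
Proof.
rewrite /cutoff subr_ge0 gerBl; apply/andP; split.
  rewrite -[leRHS](_ : \prod_(j <- iota 0 N) 1 = 1); last by rewrite big1.
  apply: ler_prod => j _; have /andP[h1 h2] := nth_bump_itv j x.
  by rewrite exprn_ge0 ?subr_ge0//= exprn_ile1 ?subr_ge0// gerBl.
apply: prodr_ge0 => j _; have /andP[h1 h2] := nth_bump_itv j x.
by rewrite exprn_ge0// subr_ge0.
Qed.

Lemma cutoff_out N x : ~ (\big[setU/set0]_(j <- iota 0 N) nth_cube j) x -> cutoff N x = 0.
Proof.
move=> nx; rewrite /cutoff big_seq big1 ?subrr// => j jN.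
rewrite nth_bump_out ?subr0 ?expr1n// => xj; apply: nx.
by rewrite -bigcup_seq; exists j.
Qed.

Lemma cutoff_eq0 N x : ~ Omega x -> cutoff N x = 0.
Proof.
by move=> nx; apply: cutoff_out; rewrite -bigcup_seq => -[j _ /nth_cube_sub].
Qed.

Lemma cvg_cutoff x : open Omega -> Omega x -> cutoff N x @[N --> \oo] --> (1 : R).
Proof.
move=> oOmega /(nth_bump_cover oOmega)[j bj].
have /andP[b0 b1] := nth_bump_itv j x.
have h : (1 - nth_bump j x) ^+ N @[N --> \oo] --> (0 : R).
  by apply: cvg_expr; rewrite ger0_norm ?subr_ge0// gtrBl.
rewrite -[X in _ --> X]subr0; apply: cvgB; first exact: cvg_cst.
apply: (@squeeze_cvgr _ _ _ _ (fun=> 0) (fun N => (1 - nth_bump j x) ^+ N)); [|exact: cvg_cst|exact: h].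
(* [iota 0 N] contains [j] once [N] is at least [j.+1]; the other factors of the product are at most
   1. *)
exists j.+1 => // N /= jN.
have h01 i : 0 <= (1 - nth_bump i x) ^+ N <= 1.
  have /andP[h1 h2] := nth_bump_itv i x.
  by rewrite exprn_ge0 ?subr_ge0//= exprn_ile1 ?subr_ge0// gerBl.
apply/andP; split; first by apply: prodr_ge0 => i _; have /andP[] := h01 i.
rewrite (big_rem j)/=; last by rewrite mem_iota.
rewrite ler_piMr//; first by have /andP[] := h01 j.
rewrite -[leRHS](_ : \prod_(j <- rem j (iota 0 N)) 1 = 1); last by rewrite big1.
by apply: ler_prod => i _.
Qed.

End cutoff.

Section cutoff_test.
Context {R : realType} {n : nat}.
Local Open Scope complex_scope.
Local Notation mu := (lebesgue_rV (R := R) n).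
Local Notation E := 'rV[R]_n.
Variable Omega : set E.

Definition wave (chi : E -> R) (xi x : E) : R[i] := expi (dotp x xi) * (chi x)%:C.

(** The cutoff is nonzero only on a finite union of closed cubes inside Omega, which gives the
    compact support; smoothness is membership in [flat_trig]. *)
Lemma wave_Cc_infty N xi : Cc_infty Omega (wave (cutoff Omega N) xi).
Proof.
set K := \big[setU/set0]_(j <- iota 0 N) nth_cube Omega j.
have cK : compact K by apply: bigsetU_compact => j _; exact: nth_cube_compact.
have sK : Defs.support (wave (cutoff Omega N) xi) `<=` K.
  rewrite /Defs.support closureE; apply: smallest_sub.
    by apply: compact_closed => //; exact: norm_hausdorff.
  move=> x /= hx; apply: contrapT => /cutoff_out h; move: hx.
  by rewrite /wave h mulr0 eqxx.
split.
- apply: flat_trig_smooth; rewrite (_ : (fun x => _) = fun x => cos (dotp x xi) * cutoff Omega N x).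
    by apply: flat_trigM; [exact: flat_trig_cos|exact: cutoff_flat_trig].
  by apply/funext => x; rewrite /wave !compE/= mulr0 subr0.
- apply: flat_trig_smooth; rewrite (_ : (fun x => _) = fun x => sin (dotp x xi) * cutoff Omega N x).
    by apply: flat_trigM; [exact: flat_trig_sin|exact: cutoff_flat_trig].
  by apply/funext => x; rewrite /wave !compE/= mulr0 add0r.
- by apply: subclosed_compact cK sK; exact: closed_closure.
- apply: (subset_trans sK) => x; rewrite /K -bigcup_seq => -[j _]; exact: nth_cube_sub.
Qed.

End cutoff_test.

(** * Plane waves as trial functions *)

Section plane_waves.
Context {R : realType} {n : nat}.
Local Open Scope complex_scope.
Local Notation mu := (lebesgue_rV (R := R) n).
Local Notation E := 'rV[R]_n.
Local Notation Re := complex.Re.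
Local Notation Im := complex.Im.
Local Notation normc := Normc.normc.
Variables (Omega : set E) (mOmega : measurable Omega) (finOmega : (mu Omega < +oo)%E).

Lemma Cc_infty_Hspace phi : Cc_infty Omega phi -> Hspace Omega phi.
Proof.
move=> h; split; first exact: Cc_infty_L2.
exists (fun=> phi) => //; rewrite (_ : (fun _ : nat => _) = fun=> 0%E); first exact: cvg_cst.
apply/funext => k; rewrite /sqnorm_star; apply: integral0_eq => xi _.
rewrite (_ : fourier _ _ = 0) ?Normc.normc0 ?expr0n ?mulr0//.
rewrite -[RHS](Cintegral0 (n := n) setT); apply: eq_Cintegral => x.
by rewrite subrr mulr0.
Qed.

(** The constant in the error term C / |xi|: a first moment of the squared transform of [chi],
    finite for test functions by [Cc_infty_fourier_weight]. *)
Definition dispersion (chi : E -> R) : R := (2 * pi) ^- n *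
  \int[mu]_eta (enorm eta * normc (fourier (fun x => (chi x)%:C) eta) ^+ 2).

Variable chi : E -> R.
Hypothesis chi01 : forall x, 0 <= chi x <= 1.
Hypothesis waveC : forall xi, Cc_infty Omega (wave chi xi).
Let X : E -> R[i] := fun x => (chi x)%:C.
Let m : R := sqn X.

Lemma wave0 : wave chi 0 = X.
Proof. by apply/funext => x; rewrite /wave dotpC (_ : dotp 0 x = 0) ?expi0 ?mul1r// /dotp big1// => i _; rewrite mxE mul0r. Qed.

Let L2X : L2 Omega X. Proof. by rewrite -wave0; exact: Cc_infty_L2. Qed.
Let CX : Cc_infty Omega X. Proof. by rewrite -wave0. Qed.

Lemma sqnorm_wave xi : sqnorm setT (wave chi xi) = sqnorm setT X.
Proof.
apply: eq_integral => x _; congr (_ %:E).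
by rewrite /wave Normc.normcM normc_expi mul1r.
Qed.

Lemma fourier_wave xi eta : fourier (wave chi xi) eta = fourier X (eta - xi).
Proof. exact: fourier_mod. Qed.

Let weight (eta : E) : R := enorm eta * normc (fourier X eta) ^+ 2.
Let C : R := dispersion chi.

Let mF : measurable_fun setT (fun eta => normc (fourier X eta) ^+ 2).
Proof.
apply: measurable_normc_sq; apply: measurable_fourier; apply: CmeasurableP.
exact: (L2_Cintegrable mOmega finOmega L2X).
Qed.

Let iF : mu.-integrable setT (fun eta => (normc (fourier X eta) ^+ 2)%:E).
Proof.
apply/integrableP; split; first exact/measurable_EFinP.
under eq_integral => x _ do rewrite /= ger0_norm ?sqr_ge0//.
apply: le_lt_trans (bessel (L2_Cintegrable mOmega finOmega L2X)) _.
by rewrite (sqnE L2X) -EFinM ltry.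
Qed.

Let weight_ge0 eta : 0 <= weight eta.
Proof. by rewrite mulr_ge0 ?enorm_ge0 ?sqr_ge0. Qed.

Let iW : mu.-integrable setT (fun eta => (weight eta)%:E).
Proof.
apply/integrableP; split.
  by apply/measurable_EFinP; apply: measurable_funM => //; exact: measurable_enorm.
apply: le_lt_trans (Cc_infty_fourier_weight mOmega finOmega CX).
apply: ge0_le_integral => //.
- by apply/measurable_EFinP; apply: measurableT_comp => //; apply: measurable_funM => //; exact: measurable_enorm.
- apply/measurable_EFinP; apply: measurable_funM => //; apply: measurable_funD => //.
  by apply: measurable_funX; exact: measurable_enorm.
- move=> x _; rewrite lee_fin ger0_norm ?weight_ge0// /weight ler_wpM2r ?sqr_ge0//.
  by have := sqr_ge0 (enorm x - 1); have := enorm_ge0 x; move: (enorm x) => t ? ?; nra.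
Qed.

Let twopi_ge0 : 0 <= (2 * pi) ^- n :> R.
Proof. by rewrite invr_ge0 exprn_ge0// mulr_ge0// pi_ge0. Qed.

Lemma dispersion_ge0 : 0 <= C.
Proof.
by apply: mulr_ge0; [exact: twopi_ge0|apply: Rintegral_ge0 => eta _; exact: weight_ge0].
Qed.

(** Used in [log_form_wave] after multiplication by [ln |xi|], which is nonnegative there because
    [1 <= enorm xi]. *)
Lemma parseval_le : (2 * pi) ^- n * \int[mu]_eta (normc (fourier X eta) ^+ 2) <= m.
Proof.
rewrite ler_pdivrMl ?exprn_gt0 ?mulr_gt0 ?pi_gt0// -lee_fin EFin_Rintegral//.
by rewrite EFinM -(sqnE L2X); exact: bessel (L2_Cintegrable mOmega finOmega L2X).
Qed.

Lemma ln_enorm_le (xi eta : E) : 1 <= enorm xi ->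
  ln (enorm eta) <= ln (enorm xi) + enorm (eta - xi) / enorm xi.
Proof.
move=> xi1; have xi0 : 0 < enorm xi by exact: lt_le_trans xi1.
have q0 : 0 <= enorm (eta - xi) / enorm xi by rewrite divr_ge0 ?enorm_ge0.
(* At the origin [ln 0 = 0], and the inequality holds because [1 <= enorm xi] makes the right-hand
   side nonnegative. *)
have [e0|e0] := eqVneq (enorm eta) 0.
  by rewrite e0 ln0// addr_ge0// ln_ge0.
have et : 0 < enorm eta by rewrite lt_neqAle eq_sym e0 enorm_ge0.
apply: (@le_trans _ _ (ln (enorm xi * (1 + enorm (eta - xi) / enorm xi)))).
  rewrite ler_ln ?posrE ?mulr_gt0 ?ltr_pwDl// mulrDr mulr1 mulrCA mulfV ?gt_eqF// mulr1.
  by rewrite -[eta in leLHS](subrK xi) addrC; exact: le_trans (enormD _ _) _.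
by rewrite lnM ?posrE ?ltr_pwDl// lerD2l le_ln1Dx// (lt_le_trans _ q0)// ltrN10.
Qed.

(** The density of the form is the squared transform of [chi] translated by [xi]. Inserting
    [ln_enorm_le] and translating back leaves its total mass times [ln |xi|] and its first moment
    divided by [|xi|]. *)
Lemma log_form_wave (n0 : (0 < n)%N) xi : 1 <= enorm xi ->
  Re (log_form (wave chi xi) (wave chi xi)) <= m * ln (enorm xi) + C / enorm xi.
Proof.
move=> xi1; rewrite log_formE wform_diag Re_realM Re_real.
have xi0 : 0 < enorm xi by exact: lt_le_trans xi1.
pose G (eta : E) := ln (enorm xi) * normc (fourier X eta) ^+ 2 + (enorm xi)^-1 * weight eta.
have iG1 := integrableZl_EFin (ln (enorm xi)) measurableT iF.
have iG2 := integrableZl_EFin (enorm xi)^-1 measurableT iW.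
have iG : mu.-integrable setT (EFin \o G) by exact: (integrableD measurableT iG1 iG2).
have G0 eta : 0 <= G eta.
  by rewrite addr_ge0// mulr_ge0 ?ln_ge0 ?sqr_ge0 ?invr_ge0 ?enorm_ge0 ?weight_ge0.
have mG : measurable_fun setT (EFin \o G) by exact: (measurable_int mu).
have eG : (\int[mu]_eta (G (eta - xi))%:E = \int[mu]_eta (G eta)%:E)%E.
  exact: (integral_rV_shift_fun (- xi) mG).
have iGs : mu.-integrable setT (fun eta => (G (eta - xi))%:E).
  apply/integrableP; split.
    exact: (measurable_shift (- xi) mG).
  rewrite (eq_integral (fun x : E => (G (x - xi))%:E)); last first.
    by move=> x _; apply: gee0_abs; rewrite lee_fin.
  by rewrite eG -(EFin_Rintegral iG) ltry.
have [mf wi] : wint (fun eta : E => ln (enorm eta)) (fourier (wave chi xi)).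
  exact: (form_dom_wint mOmega finOmega n0
    (Hspace_form_dom mOmega finOmega (Cc_infty_Hspace (waveC xi)))).
apply: (@le_trans _ _ ((2 * pi) ^- n * \int[mu]_eta G (eta - xi))).
  apply: (ler_wpM2l twopi_ge0); apply: (le_Rintegral measurableT _ iGs).
    apply: (le_integrable measurableT _ _ wi).
      apply/measurable_EFinP; apply: measurable_funM; first exact: measurable_ln_enorm.
      exact: measurable_normc_sq.
    by move=> x _; rewrite lee_fin !normrM normr_id.
  move=> eta _; rewrite fourier_wave.
  apply: (le_trans (ler_wpM2r (sqr_ge0 (normc (fourier X (eta - xi)))) (ln_enorm_le eta xi1))).
  rewrite /G /weight; move: (normc _ ^+ 2) (ln _) (enorm (eta - xi)) (enorm xi)^-1 => a b c e.
  by rewrite mulrDl lerD2l mulrC mulrCA mulrA mulrC mulrA.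
rewrite /Rintegral eG -/(Rintegral mu setT G) /C /dispersion -/weight (RintegralD measurableT iG1 iG2)
  (RintegralZl _ measurableT iF) (RintegralZl _ measurableT iW) mulrDr; apply: lerD.
  by rewrite mulrCA [leRHS]mulrC; apply: ler_wpM2l parseval_le; exact: ln_ge0.
by rewrite mulrCA mulrC.
Qed.

Let L2XM phi : L2 Omega phi -> L2 Omega (fun x => X x * phi x) /\
  (sqnorm setT (fun x => X x * phi x)%R <= sqnorm setT phi)%E.
Proof.
move=> [mphi phi0 fphi]; have [mX _ _] := L2X.
have mXphi := CmeasurableM mX mphi.
have le : (sqnorm setT (fun x => X x * phi x)%R <= sqnorm setT phi)%E.
  apply: ge0_le_integral => //; try exact: measurable_enormc_sq.
  - by move=> x _; rewrite lee_fin sqr_ge0.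
  - move=> x _; rewrite lee_fin Normc.normcM exprMn ler_piMl ?sqr_ge0//.
    rewrite normc_sq /= expr0n addr0; have /andP[h0 h1] := chi01 x.
    by rewrite exprn_ile1.
split=> //; split => //; last exact: le_lt_trans le fphi.
by move=> x /phi0 ->; rewrite mulr0.
Qed.

Lemma l2dot_wave phi xi : L2 Omega phi ->
  l2dot Omega (wave chi xi) phi = (fourier (fun x => X x * phi x) xi)^*.
Proof.
move=> L2phi; have [LX _] := L2XM L2phi; have iX := L2_Cintegrable mOmega finOmega LX.
rewrite /l2dot Cintegral_restrict; last first.
  case: L2phi => _ h _ x /h ->; apply: eq_complexP; rewrite !compE/=; ring.
have [_ i2] := Cintegrable_expiM xi iX.
rewrite -(Cintegral_conj i2 measurableT); apply: eq_Cintegral => x.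
by apply: eq_complexP; rewrite /wave /X !compE /= cosN sinN; ring.
Qed.

Lemma measurable_wave_coef phi : L2 Omega phi ->
  measurable_fun setT (fun xi => normc (l2dot Omega (wave chi xi) phi) ^+ 2).
Proof.
move=> L2phi; have [LX _] := L2XM L2phi.
rewrite (_ : (fun _ => _) = fun xi => normc (fourier (fun x => X x * phi x) xi) ^+ 2).
  by apply: measurable_normc_sq; apply: measurable_fourier; case: LX.
by apply/funext => xi; rewrite l2dot_wave// !normc_sq Re_conjc Im_conjc sqrrN.
Qed.

(** Bessel's inequality for the product of [chi] and [phi], whose norm is at most that of [phi]
    since [chi] takes values in [0, 1]. *)
Lemma wave_coef_le phi : L2 Omega phi ->
  (\int[mu]_xi (normc (l2dot Omega (wave chi xi) phi) ^+ 2)%:E <=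
   ((2 * pi) ^+ n)%:E * sqnorm setT phi)%E.
Proof.
move=> L2phi; have [LX le] := L2XM L2phi.
under eq_integral => xi _ do rewrite l2dot_wave// normc_sq Re_conjc Im_conjc sqrrN -normc_sq.
apply: (le_trans (bessel (L2_Cintegrable mOmega finOmega LX))).
by rewrite lee_wpmul2l// lee_fin exprn_ge0// mulr_ge0// pi_ge0.
Qed.

End plane_waves.

(** * Integration over the trial frequencies *)

Section integrated_trial.
Context {R : realType} {n : nat}.
Local Open Scope complex_scope.
Local Notation mu := (lebesgue_rV (R := R) n).
Local Notation E := 'rV[R]_n.
Local Notation Re := complex.Re.
Local Notation normc := Normc.normc.
Local Notation V := (vball R n).
Variables (Omega : set E) (mOmega : measurable Omega) (finOmega : (mu Omega < +oo)%E).
Hypothesis n0 : (0 < n)%N.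
Variables (lam : nat -> R) (phi : nat -> E -> R[i]).
Hypothesis ephi : forall k, eigenfunction Omega (lam k) (phi k).
Hypothesis ophi : orthonormal_system Omega phi.
Hypothesis cphi : complete_system Omega phi.
Variable chi : E -> R.
Hypothesis chi01 : forall x, 0 <= chi x <= 1.
Hypothesis waveC : forall xi, Cc_infty Omega (wave chi xi).
Let m : R := sqn (fun x => (chi x)%:C).
Let C : R := dispersion chi.

Let L2phi k : L2 Omega (phi k). Proof. by have [[]] := ephi k. Qed.

Let sqn_phi k : sqnorm setT (phi k) = 1%E.
Proof.
rewrite (sqnE (L2phi k)); have := ophi k k; rewrite (l2dot_diag (L2phi k)) eqxx.
by move=> /complexI ->.
Qed.

Let sqn_wave xi : sqn (wave chi xi) = m.
Proof. by rewrite /sqn sqnorm_wave. Qed.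

Variables (l : R) (K : nat).
Hypothesis hK : forall k, (K <= k)%N -> l <= lam k.

(** Positive parts are taken before integrating: the integral of each squared coefficient is bounded
    from above, so it needs a nonnegative factor in front. *)
Let T (xi : E) : R :=
  \sum_(k < K) Num.max (l - lam k) 0 * normc (l2dot Omega (wave chi xi) (phi k)) ^+ 2.

Let max_ge0 k : 0 <= Num.max (l - lam k) 0. Proof. by rewrite le_max lexx orbT. Qed.

Let T_ge0 xi : 0 <= T xi.
Proof. by apply: sumr_ge0 => k _; rewrite mulr_ge0// sqr_ge0. Qed.

Let mT : measurable_fun setT T.
Proof.
apply: measurable_sum => k; apply: measurable_funM => //.
exact: (measurable_wave_coef mOmega finOmega chi01 waveC (L2phi k)).
Qed.

Let intT : (\int[mu]_xi (T xi)%:E <=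
  ((2 * pi) ^+ n * \sum_(k < K) Num.max (l - lam k) 0)%:E)%E.
Proof.
under eq_integral => xi _ do rewrite /T -sumEFin.
have mc k : measurable_fun setT (fun xi => (normc (l2dot Omega (wave chi xi) (phi k)) ^+ 2)%:E).
  by apply/measurable_EFinP; exact: (measurable_wave_coef mOmega finOmega chi01 waveC (L2phi k)).
rewrite ge0_integral_sum//; last 2 first.
  by move=> k; under eq_fun do rewrite EFinM; exact: measurable_funeM.
  by move=> k xi _; rewrite lee_fin mulr_ge0// sqr_ge0.
rewrite mulr_sumr -sumEFin; apply: lee_sum => k _.
under eq_integral => xi _ do rewrite EFinM.
rewrite ge0_integralZl_EFin//; last by move=> xi _; rewrite lee_fin sqr_ge0.
rewrite mulrC EFinM lee_wpmul2l ?lee_fin//.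
have := wave_coef_le mOmega finOmega chi01 waveC (L2phi k).
by rewrite sqn_phi mule1.
Qed.

Let trial xi : 1 <= enorm xi -> m * (l - ln (enorm xi)) <= T xi + C / enorm xi.
Proof.
move=> xi1; have hH := Cc_infty_Hspace mOmega finOmega (waveC xi).
have := trial_bound mOmega finOmega n0 ephi ophi cphi hH hK.
have := log_form_wave mOmega finOmega waveC n0 xi1.
rewrite sqn_wave -/m -/C => h1 h2.
have h3 : \sum_(k < K) (l - lam k) * normc (l2dot Omega (wave chi xi) (phi k)) ^+ 2 <= T xi.
  by apply: ler_sum => k _; rewrite ler_wpM2r ?sqr_ge0// le_max lexx.
move: h1 h2 h3; move: (Re _) (\sum_(k < K) _) (C / _) => a b c h1 h2 h3.
by rewrite mulrBr; lra.
Qed.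

Variable A : R.
Hypothesis A1 : 1 <= A.
Hypothesis lA : ln A <= l.
Let A0 : 0 < A. Proof. exact: lt_le_trans A1. Qed.
Let m0 : 0 <= m. Proof. exact: sqn_ge0. Qed.
Let C0 : 0 <= C. Proof. exact: dispersion_ge0. Qed.

(** The trial inequality in a form valid at every frequency. For [|xi| >= A] the error is at most
    [C / A]. For [|xi| < A] the left-hand side is matched exactly by splitting l - ln |xi| into (ln
    A - ln |xi|) + (l - ln A), and the other terms are nonnegative. *)
Let pointwise xi : m * (\1_(oball (expR l)) xi * (l - ln (enorm xi))) <=
  T xi + C / A * \1_(oball (expR l)) xi + m * (\1_(oball A) xi * (ln A - ln (enorm xi))) +
  m * (l - ln A) * \1_(oball A) xi.
Proof.
have CA : 0 <= C / A by rewrite divr_ge0// ltW.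
rewrite !indicE; have [xiA|Axi] := ltP (enorm xi) A.
  have xir : enorm xi < expR l by rewrite (lt_le_trans xiA)// -[leLHS]lnK ?posrE// ler_expR.
  rewrite (_ : xi \in oball (expR l)) ?inE// (_ : xi \in oball A) ?inE//=.
  rewrite !mul1r !mulr1 -addrA -mulrDr (addrC (ln A - _)) subrKA lerDr addr_ge0//.
rewrite [xi \in oball A](_ : _ = false); last by apply/negbTE; rewrite notin_setE /oball/=; apply/negP; rewrite -leNgt.
rewrite mul0r !mulr0 !addr0; have [xir|xir] := boolP (xi \in oball (expR l)); last first.
  by rewrite mul0r !mulr0 addr0.
rewrite mul1r mulr1; apply: (le_trans (trial (le_trans A1 Axi))).
by rewrite lerD2l ler_wpM2l// lef_pV2 ?posrE// (lt_le_trans A0).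
Qed.

(** The error with factor [C / A] has the full order e^(n l) and is made small through [A]; the two
    errors from the ball of radius [A] are affine in [l]. *)
Lemma trial_integrated : m * (expR l ^+ n * V / n%:R) <=
  (2 * pi) ^+ n * \sum_(k < K) Num.max (l - lam k) 0 + C / A * (expR l ^+ n * V) +
  m * (A ^+ n * V / n%:R) + m * (l - ln A) * (A ^+ n * V).
Proof.
have mi r : measurable_fun setT (fun xi : E => \1_(oball r) xi : R).
  by apply: measurable_indic; exact: measurable_oball.
have ml r : measurable_fun setT (fun xi : E => \1_(oball r) xi * (ln r - ln (enorm xi))).
  by apply: measurable_funM => //; apply: measurable_funB => //; exact: measurable_ln_enorm.
have pl r xi : 1 <= r -> 0 <= \1_(oball r) xi * (ln r - ln (enorm xi)) :> R.
  move=> r1; rewrite indicE; have [|] := boolP (xi \in oball r); last by rewrite mul0r.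
  rewrite inE /oball/= mul1r subr_ge0 => xir.
  have [e0|e0] := eqVneq (enorm xi) 0; first by rewrite e0 ln0// ln_ge0.
  have e1 : 0 < enorm xi by rewrite lt_neqAle eq_sym e0 enorm_ge0.
  by rewrite ler_ln ?posrE// ?ltW// (lt_trans e1).
have el1 : 1 <= expR l by rewrite -[leLHS]expR0 ler_expR (le_trans _ lA)// ln_ge0.
have CA : 0 <= C / A by rewrite divr_ge0// ltW.
have mlA : 0 <= m * (l - ln A) by rewrite mulr_ge0// subr_ge0.
have iball r : 0 < r -> (\int[mu]_xi (\1_(oball r) xi)%:E = (r ^+ n * V)%:E)%E.
  by move=> r0; rewrite integral_indicT ?oballE//; exact: measurable_oball.
rewrite -lee_fin.
apply: (@le_trans _ _ (\int[mu]_xi (T xi + C / A * \1_(oball (expR l)) xi +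
    m * (\1_(oball A) xi * (ln A - ln (enorm xi))) + m * (l - ln A) * \1_(oball A) xi)%:E)%E).
  rewrite EFinM -(integral_ln_ball n0 (expR_gt0 l)) -ge0_integralZl_EFin//.
  - under eq_integral => xi _ do rewrite -EFinM expRK.
    apply: ge0_le_integral => //.
    + by move=> xi _; rewrite lee_fin mulr_ge0// -[l in l - _]expRK pl.
    + apply/measurable_EFinP; apply: measurable_funM => //.
      by under eq_fun do rewrite -[l in l - _]expRK; exact: ml.
    + apply/measurable_EFinP; apply: measurable_funD; last exact: measurable_funM.
      apply: measurable_funD; last exact: measurable_funM.
      by apply: measurable_funD => //; exact: measurable_funM.
    + by move=> xi _; rewrite lee_fin; exact: pointwise.
  - by move=> xi _; rewrite lee_fin pl.
  - by apply/measurable_EFinP; exact: ml.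
under eq_integral => xi _ do rewrite !EFinD.
have m2 : measurable_fun setT (fun xi : E => (C / A * \1_(oball (expR l)) xi)%:E).
  by apply/measurable_EFinP; exact: measurable_funM.
have m3 : measurable_fun setT (fun xi : E => (m * (\1_(oball A) xi * (ln A - ln (enorm xi))))%:E).
  by apply/measurable_EFinP; exact: measurable_funM.
have m4 : measurable_fun setT (fun xi : E => (m * (l - ln A) * \1_(oball A) xi)%:E).
  by apply/measurable_EFinP; exact: measurable_funM.
have m1 : measurable_fun setT (fun xi : E => (T xi)%:E) by exact/measurable_EFinP.
have p2 (xi : E) : (0 <= (C / A * \1_(oball (expR l)) xi)%:E)%E by rewrite lee_fin mulr_ge0.
have p3 (xi : E) : (0 <= (m * (\1_(oball A) xi * (ln A - ln (enorm xi))))%:E)%E.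
  by rewrite lee_fin mulr_ge0// pl.
have p4 (xi : E) : (0 <= (m * (l - ln A) * \1_(oball A) xi)%:E)%E by rewrite lee_fin mulr_ge0.
have p1 (xi : E) : (0 <= (T xi)%:E)%E by rewrite lee_fin.
rewrite ge0_integralD//; [|by move=> xi _; rewrite !adde_ge0|by do 2?apply: emeasurable_funD].
rewrite ge0_integralD//; [|by move=> xi _; rewrite !adde_ge0|by do 2?apply: emeasurable_funD].
rewrite ge0_integralD//.
rewrite !EFinD; apply: leeD; [apply: leeD; [apply: leeD; [exact: intT|]|]|].
- under eq_integral => xi _ do rewrite EFinM.
  by rewrite ge0_integralZl_EFin ?iball ?expR_gt0//; apply/measurable_EFinP.
- under eq_integral => xi _ do rewrite EFinM.
  rewrite ge0_integralZl_EFin ?integral_ln_ball//.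
    by move=> xi _; rewrite lee_fin pl.
  by apply/measurable_EFinP.
- under eq_integral => xi _ do rewrite EFinM.
  by rewrite ge0_integralZl_EFin ?iball//; apply/measurable_EFinP.
Qed.

End integrated_trial.

(** * Passage to the limit *)

Section limits.
Context {R : realType}.

Lemma le_limf_einf (f : R -> \bar R) (c : \bar R) :
  (\forall l \near pinfty_nbhs R, (c <= f l)%E) -> (c <= limf_einf f (pinfty_nbhs R))%E.
Proof.
move=> cf; rewrite limf_einfE; apply: (@le_trans _ _ (ereal_inf (f @` [set l | (c <= f l)%E]))).
  by apply: le_ereal_inf_tmp => _ [l /= cl <-].
by apply: ereal_sup_ubound; exists [set l | (c <= f l)%E].
Qed.

Lemma exp_decay_affine n (a b e : R) : (0 < n)%N -> 0 < e ->
  \forall l \near +oo, expR (- (n%:R * l)) * (a + b * l) <= e.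
Proof.
move=> n0 e0; pose B := `|a| + `|b|.
near=> l.
have l1 : 1 <= l by near: l; exact: nbhs_pinfty_ge.
(* With [l ^+ 2 <= 4 * expR (n%:R * l)], proved next, [4 * B <= e * l] yields
   [B * l <= e * expR (n%:R * l)]. *)
have lB : 4 * B / e <= l by near: l; apply: nbhs_pinfty_ge; exact: num_real.
have l0 : 0 < l by exact: lt_le_trans l1.
have h : l ^+ 2 <= 4 * expR (n%:R * l).
  apply: (le_trans (pow_le_expR 2 (ltW l0))); rewrite -natrX ler_wpM2l// ler_expR.
  by rewrite ler_peMl ?(ltW l0)// ler1n.
rewrite expRN mulrC ler_pdivrMr ?expR_gt0//.
apply: (@le_trans _ _ (B * l)).
  rewrite mulrDl lerD//; last by rewrite ler_wpM2r ?ler_norm// ltW.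
  by rewrite (le_trans (ler_norm _))// ler_peMr.
move: lB; rewrite ler_pdivrMr// => lB.
have B0 : 0 <= B by rewrite addr_ge0.
rewrite -(ler_pM2r l0) -(ler_pM2l (_ : 0 < 4))//.
move: (expR _) h => x h; have := ler_wpM2l (ltW e0) h; rewrite expr2 => h2.
have h3 := ler_wpM2r (ltW (mulr_gt0 l0 l0)) lB; nra.
Unshelve. all: by end_near.
Qed.

Lemma riesz_mean_ge (lam : nat -> R) K l :
  ((\sum_(k < K) Num.max (l - lam k) 0)%:E <= riesz_mean lam l)%E.
Proof.
rewrite -sumEFin -(big_mkord xpredT (fun k => (Num.max (l - lam k) 0)%:E)).
by apply: nneseries_lim_ge => k _ _; rewrite lee_fin le_max lexx orbT.
Qed.

End limits.

Section cutoff_limit.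
Context {R : realType} {n : nat}.
Local Open Scope complex_scope.
Local Notation mu := (lebesgue_rV (R := R) n).
Local Notation E := 'rV[R]_n.
Local Notation V := (vball R n).
Variables (Omega : set E) (mOmega : measurable Omega) (finOmega : (mu Omega < +oo)%E).
Hypothesis n0 : (0 < n)%N.
Variables (lam : nat -> R) (phi : nat -> E -> R[i]).
Hypothesis lamoo : lam k @[k --> \oo] --> +oo.
Hypothesis ephi : forall k, eigenfunction Omega (lam k) (phi k).
Hypothesis ophi : orthonormal_system Omega phi.
Hypothesis cphi : complete_system Omega phi.

Lemma liminf_cutoff (chi : E -> R) : (forall x, 0 <= chi x <= 1) ->
  (forall xi, Cc_infty Omega (wave chi xi)) ->
  (((2 * pi) ^- n * (sqn (fun x => (chi x)%:C) * V / n%:R))%:E <=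
   limf_einf (fun l : R => (expR (- (n%:R * l)))%:E * riesz_mean lam l) (pinfty_nbhs R))%E.
Proof.
move=> chi01 waveC; set m := sqn _; set L := limf_einf _ _.
have m0 : 0 <= m by exact: sqn_ge0.
have C0 : 0 <= dispersion chi by exact: dispersion_ge0.
have V0 : 0 <= V by exact: vball_ge0.
pose p : R := (2 * pi) ^+ n.
have p0 : 0 < p by rewrite exprn_gt0// mulr_gt0// pi_gt0.
apply/lee_addgt0Pr => e e0; rewrite -leeBlDr//; apply: le_limf_einf.
(* Half of [e] is reserved for the error of full order, which fixes [A]; the maximum with 1 keeps
   the frequencies outside the ball in the range of the trial estimate. *)
pose A := Num.max 1 (2 * p^-1 * (dispersion chi * V) / e).
have A1 : 1 <= A by rewrite le_max lexx.
have A0 : 0 < A by exact: lt_le_trans A1.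
have hA : p^-1 * (dispersion chi / A * V) <= e / 2.
  have : 2 * p^-1 * (dispersion chi * V) / e <= A by rewrite le_max lexx orbT.
  rewrite ler_pdivrMr// => h.
  rewrite (_ : p^-1 * _ = p^-1 * (dispersion chi * V) / A); last by field; rewrite !gt_eqF.
  by rewrite ler_pdivrMr//; lra.
(* [a + b * l] collects the contribution of the ball of radius [A], divided by [p]; after
   multiplication by the decaying exponential it takes the other half of [e]. *)
pose b := p^-1 * (m * (A ^+ n * V)).
pose a := p^-1 * (m * (A ^+ n * V / n%:R)) - b * ln A.
near=> l.
have lA : ln A <= l by near: l; apply: nbhs_pinfty_ge; exact: num_real.
have hl : expR (- (n%:R * l)) * (a + b * l) <= e / 2.
  by near: l; apply: exp_decay_affine => //; rewrite divr_gt0.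
(* Only finitely many eigenvalues lie below [l]; [K] depends on [l], but the bound that follows does
   not involve it beyond the finite sum. *)
have [K _ hK] : \forall k \near \oo, l <= lam k by move/cvgryPge : lamoo; exact.
have := trial_integrated mOmega finOmega n0 ephi ophi cphi chi01 waveC hK A1 lA.
rewrite -/m -/p -expRM_natl => hT.
apply: (@le_trans _ _ ((expR (- (n%:R * l)))%:E * (\sum_(k < K) Num.max (l - lam k) 0)%:E)%E); last first.
  by rewrite lee_wpmul2l ?riesz_mean_ge// lee_fin expR_ge0.
rewrite -EFinM -EFinB lee_fin; move: (\sum_(k < K) _) hT => S hT.
have q0 : 0 < p^-1 * expR (- (n%:R * l)) by rewrite mulr_gt0 ?invr_gt0 ?expR_gt0.
have := ler_wpM2l (ltW q0) hT.
have ee : expR (- (n%:R * l)) * expR (n%:R * l) = 1 by rewrite -expRD addNr expR0.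
move: hl hA; rewrite /a /b -/p.
move: (expR (n%:R * l)) (expR (- (n%:R * l))) ee (dispersion chi / A) (A ^+ n) (ln A) => x y xy D An lnA.
move=> h1 h2 h3.
have e1 : p^-1 * y * (m * (x * V / n%:R)) = p^-1 * (m * V / n%:R).
  by transitivity (p^-1 * (m * V / n%:R) * (y * x)); [ring|rewrite xy mulr1].
have e2 : p^-1 * y * (p * S + D * (x * V) + m * (An * V / n%:R) + m * (l - lnA) * (An * V)) =
    y * S + p^-1 * (D * V) + y * (p^-1 * (m * (An * V / n%:R)) - p^-1 * (m * (An * V)) * lnA +
      p^-1 * (m * (An * V)) * l).
  transitivity ((p^-1 * p) * (y * S) + p^-1 * (D * V) * (y * x) +
      y * (p^-1 * (m * (An * V / n%:R)) - p^-1 * (m * (An * V)) * lnA +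
      p^-1 * (m * (An * V)) * l)); first by ring.
  by rewrite xy mulVf ?gt_eqF// mul1r mulr1.
by rewrite e1 e2 in h3; lra.
Unshelve. all: by end_near.
Qed.

End cutoff_limit.

Section cutoff_mass.
Context {R : realType} {n : nat}.
Local Open Scope complex_scope.
Local Notation mu := (lebesgue_rV (R := R) n).
Local Notation E := 'rV[R]_n.
Variables (Omega : set E) (mOmega : measurable Omega) (finOmega : (mu Omega < +oo)%E).

(** Fatou along the squared cutoffs, which tend to the indicator of Omega at every point. *)
Lemma mass_le_of_cutoffs (c : \bar R) (k : R) : 0 <= k -> open Omega ->
  (forall N, ((k * sqn (fun x => (cutoff Omega N x)%:C))%:E <= c)%E) ->
  (k%:E * mu Omega <= c)%E.
Proof.
move=> k0 oOmega hc.
have mc N : measurable_fun setT (cutoff Omega N).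
  by apply: continuous_rV_measurable; have [] := flat_trigP (cutoff_flat_trig Omega N).
rewrite -integral_indicT// -ge0_integralZl_EFin//; last first.
  by apply/measurable_EFinP; exact: measurable_indic.
apply: (@fatou_le _ _ _ mu (fun N x => (k * cutoff Omega N x ^+ 2)%:E)).
- by move=> N; apply/measurable_EFinP; apply: measurable_funM => //; exact: measurable_funX.
- by move=> N x; rewrite lee_fin mulr_ge0// sqr_ge0.
- move=> x; rewrite -EFinM; apply: cvg_EFin; first exact: nearW.
  apply: cvgM; first exact: cvg_cst.
  rewrite indicE; have [|] := boolP (x \in Omega); rewrite ?notin_setE ?inE => Ox.
    rewrite [X in _ --> X](_ : _ = 1 * 1); last by rewrite mulr1.
    by apply: cvgM; exact: cvg_cutoff.
  rewrite (_ : (fun _ => _) = fun=> 0); first exact: cvg_cst.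
  by apply/funext => N; rewrite cutoff_eq0// expr0n.
- move=> N; under eq_integral => x _ do rewrite EFinM.
  rewrite ge0_integralZl_EFin//; last 2 first.
    by move=> x _; rewrite lee_fin sqr_ge0.
    by apply/measurable_EFinP; exact: measurable_funX.
  apply: le_trans (hc N); rewrite EFinM lee_wpmul2l ?lee_fin//.
  have L2c : L2 Omega (fun x => (cutoff Omega N x)%:C).
    rewrite -(wave0 (cutoff Omega N)); apply: Cc_infty_L2 => //; exact: wave_Cc_infty.
  rewrite -(sqnE L2c) le_eqVlt; apply/orP; left; apply/eqP.
  by apply: eq_integral => x _; rewrite normc_sq/= expr0n addr0.
Qed.

End cutoff_mass.

Theorem theorem5p1 (R : realType) (d : nat) (Omega : set 'rV[R]_d)
    (lam : nat -> R) :
  (0 < d)%N -> Omega !=set0 -> open Omega ->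
  (lebesgue_rV d Omega < +oo)%E ->
  eigenvalue_sequence Omega lam ->
  (((2 * pi) ^- d)%:E * lebesgue_rV d Omega * lebesgue_rV d (unit_ball R d)
     * (d%:R^-1)%:E
   <= limf_einf (fun l : R => (expR (- (d%:R * l)))%:E * riesz_mean lam l)
        (pinfty_nbhs R))%E.
Proof.
move=> d0 _ oOmega finOmega [_ _ lamoo [phi [ephi ophi cphi]]].
have mOmega := measurable_rV_open oOmega.
(* The constant is regrouped as a nonnegative real times |Omega|, the shape in which the cutoffs
   approximate it. *)
rewrite vballE -muleA -EFinM (muleC (_%:E) (lebesgue_rV d Omega)) -muleA -EFinM muleC.
apply: (mass_le_of_cutoffs mOmega finOmega) => // [|N].
  by rewrite !mulr_ge0 ?invr_ge0 ?exprn_ge0 ?mulr_ge0 ?pi_ge0 ?vball_ge0.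
have := liminf_cutoff mOmega finOmega d0 lamoo ephi ophi cphi
  (cutoff_itv Omega N) (wave_Cc_infty Omega N).
apply: le_trans; rewrite lee_fin le_eqVlt; apply/orP; left; apply/eqP; ring.
Qed.
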